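(* Let $\Omega\subset\mathbb{R}^d$ be closed, convex and bounded with $\max_{x,y\in\Omega}\|x-y\|\le D$, and let $f:\mathbb{R}^d\to\mathbb{R}$, $f(x)=\mathbb{E}_\xi[F(x,\xi)]$, be convex with $\|\nabla f(x)-\nabla f(y)\|\le L\|x-y\|$ for all $x,y\in\Omega$. Let $x^*$ be a minimum point of $f$ over $\Omega$. Consider solving $\min_{x\in\Omega} f(x)$ by the Stochastic Conditional Gradient Sliding (SCGS) algorithm (described in the context) run for $T$ outer iterations. (a) (First-order setting.) Assume access to the stochastic first-order oracle and that for every $x\in\Omega$ $$\mathbb{E}_\xi\|\nabla F(x,\xi)-\nabla f(x)\|^2\le 2\rho L\,[f(x)-f(x^* )].$$ Then, with $g_t=\tilde\nabla_t$ and $$\beta_t=\frac{4L}{t+2},\quad \gamma_t=\frac{3}{t+2},\quad \eta_t=\frac{LD^2}{t(t+1)},\quad b_t=\lceil 3\rho t(t+1)\rceil,$$ the iterates satisfy, for every $1\le t\le T$, $$\mathbb{E}[f(x_t)-f(x^* )]\le\frac{6LD^2}{(t+2)^2}+\frac{15LD^2+3\|\nabla f(x^* )\|D}{(t+1)(t+2)}.$$ Hence the total numbers of calls to the stochastic first-order oracle and to the linear minimization oracle required to find an $\epsilon$-optimal point are bounded, respectively, by $\mathcal{O}(\epsilon^{-1.5})$ and $\mathcal{O}(\epsilon^{-1})$. (b) (Zeroth-order setting.) Assume access to the stochastic zeroth-order oracle, that almost surely $\|\nabla F(x,\xi)-\nabla F(y,\xi)\|\le L\|x-y\|$ for all $x,y\in\mathbb{R}^d$,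 and that for every $x\in\Omega$ $$\mathbb{E}_\xi\|\nabla F(x,\xi)\|^2\le 2\rho L\,[f(x)-f(x^* )].$$ Then, with $g_t=\bar G_\nu^t$ and $$\beta_t=\frac{4L}{t+2},\quad \gamma_t=\frac{3}{t+2},\quad \eta_t=\frac{LD^2}{t(t+1)},\quad b_t=\lceil 6\rho(d+4)t(t+1)\rceil,\quad \nu=\frac{D}{(T+2)^2(d+6)^{3/2}},$$ the iterates satisfy, for every $1\le t\le T$, $$\mathbb{E}[f(x_t)-f(x^* )]\le\frac{8LD^2}{(t+2)^2}+\frac{32LD^2}{(t+1)(t+2)}.$$ Hence the total numbers of calls to the stochastic zeroth-order oracle and to the linear minimization oracle required to find an $\epsilon$-optimal point are bounded, respectively, by $\mathcal{O}(d\epsilon^{-1.5})$ and $\mathcal{O}(\epsilon^{-1})$.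
   Context: Here $\xi$ is a random vector, $\|\cdot\|$ is the Euclidean norm, $L,D,\rho>0$ are constants, and $\nabla F(x,\xi)$ is the gradient in $x$. The stochastic gradients are unbiased: $\mathbb{E}_\xi[\nabla F(x,\xi)]=\nabla f(x)$. A call to the stochastic first-order oracle returns $\nabla F(x,\xi)$ for a queried $x$ and a fresh sample $\xi$; a call to the stochastic zeroth-order oracle returns a value $F(x,\xi)$ (it can be evaluated at two points with the same $\xi$); a call to the linear minimization oracle returns a minimizer of a linear function over $\Omega$. SCGS algorithm. Input: $x_0\in\Omega$, $T$, $\beta_t>0$, $\gamma_t\in[0,1]$, $\eta_t>0$, batch sizes $b_t$ (and $\nu>0$ in the zeroth-order setting); $y_0=x_0$. For $t=1,\dots,T$: set $z_t=(1-\gamma_t)x_{t-1}+\gamma_t y_{t-1}$; compute a gradient estimate $g_t$ at $z_t$; set $y_t=\mathrm{ICG}(g_t,y_{t-1},\beta_t,\eta_t)$; set $x_t=(1-\gamma_t)x_{t-1}+\gamma_t y_t$. Output $x_T$. Procedure $\mathrm{ICG}(g,u,\beta,\eta)$ (inexact conditional gradient). Set $u_1=u$, $k=1$. (1) Let $v_k$ be an optimal solution of $\max_{v\in\Omega}\{h_k(v)=\langle g+\beta(u_k-u),u_k-v\rangle\}$ (one call to the linear minimization oracle). (2) If $h_k(v_k)\le\eta$, terminate and output $u_k$. (3) Set $u_{k+1}=(1-\alpha_k)u_k+\alpha_k v_k$ with $\alpha_k=\min\left\{1,\frac{\langle\beta(u-u_k)-g,\,v_k-u_k\rangle}{\beta\|v_k-u_k\|^2}\right\}$.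 (4) Set $k\leftarrow k+1$ and go to (1). Gradient estimates. At iteration $t$, fresh i.i.d. samples $\xi_{t,1},\dots,\xi_{t,b_t}$ of $\xi$ are drawn. In the first-order setting $g_t=\tilde\nabla_t:=\frac1{b_t}\sum_{i=1}^{b_t}\nabla F(z_t,\xi_{t,i})$. In the zeroth-order setting $$g_t=\bar G_\nu^t:=\frac1{b_t}\sum_{j=1}^{b_t}\frac{F(z_t+\nu u_{t,j},\xi_{t,j})-F(z_t,\xi_{t,j})}{\nu}\,u_{t,j},$$ where $u_{t,1},\dots,u_{t,b_t}$ are i.i.d. standard Gaussian $N(0,\mathbf{I}_d)$, independent of the $\xi_{t,j}$. All samples are independent across iterations. An $\epsilon$-optimal point is a (random) output $x_T\in\Omega$ with $\mathbb{E}[f(x_T)-f(x^* )]\le\epsilon$. The $\mathcal{O}(\cdot)$ is as $\epsilon\to0$, with hidden constants depending only on $L$, $D$, $\rho$ and $\|\nabla f(x^* )\|$ (in particular not otherwise on $d$). *)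

(* Defs.v *)
From HB Require Import structures.
From mathcomp Require Import all_boot all_order all_algebra finmap.
From mathcomp Require Import all_classical all_reals all_analysis.

Set Implicit Arguments.
Unset Strict Implicit.
Unset Printing Implicit Defensive.

Import Order.TTheory GRing.Theory Num.Theory.
Import numFieldNormedType.Exports.

Local Open Scope classical_set_scope.
Local Open Scope ring_scope.

(* The Borel sigma-algebra of R^d, presented as the product sigma-algebra
   generated by the coordinates (as the library does for tuples). *)
Definition rV_display : measure_display -> measure_display.
Proof. exact. Qed.

Section measurable_rV.
Context (R : realType) (d : nat).

Let coords : 'I_d -> 'rV[R]_d -> R := fun i x => x ord0 i.

Let rV_set0 : g_sigma_preimage coords set0.
Proof. exact: sigma_algebra0. Qed.

Let rV_setC A : g_sigma_preimage coords A -> g_sigma_preimage coords (~` A).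
Proof. exact: sigma_algebraC. Qed.

Let rV_bigcup (A : (set 'rV[R]_d)^nat) :
  (forall i, g_sigma_preimage coords (A i)) ->
  g_sigma_preimage coords (\bigcup_i (A i)).
Proof. exact: sigma_algebra_bigcup. Qed.

HB.instance Definition _ := @isMeasurable.Build
  (rV_display default_measure_display) 'rV[R]_d (g_sigma_preimage coords)
  rV_set0 rV_setC rV_bigcup.

End measurable_rV.

Section euclidean.
Context {R : realType} {d : nat}.
Implicit Types (u v x : 'rV[R]_d) (f : 'rV[R]_d -> R).

Definition dotp u v : R := \sum_(i < d) u ord0 i * v ord0 i.

(* The library norm on row vectors is the sup norm. *)
Definition enorm u : R := Num.sqrt (dotp u u).

Definition grad f x : 'rV[R]_d :=
  \row_(i < d) 'D_(delta_mx ord0 i) (f : 'rV[R]_d -> R^o) x.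

End euclidean.

Section inexact_conditional_gradient.
Context {R : realType} {d : nat}.
Variables (lmo : 'rV[R]_d -> 'rV[R]_d) (g u : 'rV[R]_d) (beta eta : R).

(* Indices are shifted by one: [icg_iter k] is u_{k+1}. *)
Definition icg_vertex (uk : 'rV[R]_d) : 'rV[R]_d :=
  lmo (g + beta *: (uk - u)).

Definition icg_stepsize (uk vk : 'rV[R]_d) : R :=
  Num.min 1 (dotp (beta *: (u - uk) - g) (vk - uk)
             / (beta * enorm (vk - uk) ^+ 2)).

Fixpoint icg_iter (k : nat) : 'rV[R]_d :=
  if k is k'.+1 then
    let uk := icg_iter k' in
    let vk := icg_vertex uk in
    let alpha := icg_stepsize uk vk in
    (1 - alpha) *: uk + alpha *: vk
  else u.

Definition icg_gap (k : nat) : R :=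
  let uk := icg_iter k in dotp (g + beta *: (uk - u)) (uk - icg_vertex uk).

Definition icg_stop : option nat :=
  if pselect (exists k, icg_gap k <= eta) is left ex then Some (ex_minn ex)
  else None.

(* The value on a run that never stops is a dummy; such a run is
   charged infinitely many oracle calls by [icg_calls]. *)
Definition icg : 'rV[R]_d := if icg_stop is Some k then icg_iter k else u.

Definition icg_calls : \bar R :=
  if icg_stop is Some k then (k.+1%:R)%:E else +oo%E.

End inexact_conditional_gradient.

(* [gest t z] is the gradient estimate computed at the point z during
   iteration t; [scgs t] is the pair (x_t, y_t). *)
Section conditional_gradient_sliding.
Context {R : realType} {d : nat}.
Variables (lmo : 'rV[R]_d -> 'rV[R]_d) (beta gamma eta : nat -> R).
Variables (gest : nat -> 'rV[R]_d -> 'rV[R]_d) (x0 : 'rV[R]_d).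

Definition scgs_z (t : nat) (xy : 'rV[R]_d * 'rV[R]_d) : 'rV[R]_d :=
  (1 - gamma t) *: xy.1 + gamma t *: xy.2.

Fixpoint scgs (t : nat) : 'rV[R]_d * 'rV[R]_d :=
  if t is t'.+1 then
    let xy := scgs t' in
    let y := icg lmo (gest t (scgs_z t xy)) xy.2 (beta t) (eta t) in
    ((1 - gamma t) *: xy.1 + gamma t *: y, y)
  else (x0, x0).

Definition scgs_lmo_calls (T : nat) : \bar R :=
  (\sum_(1 <= t < T.+1)
    icg_calls lmo (gest t (scgs_z t (scgs t.-1))) (scgs t.-1).2
              (beta t) (eta t))%E.

End conditional_gradient_sliding.

Section parameters.
Context {R : realType}.
Variables (L D rho : R).

Definition scgs_beta (t : nat) : R := 4 * L / (t%:R + 2).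
Definition scgs_gamma (t : nat) : R := 3 / (t%:R + 2).
Definition scgs_eta (t : nat) : R := L * D ^+ 2 / (t%:R * (t%:R + 1)).

Definition fo_batch (t : nat) : nat :=
  `|Num.ceil (3 * rho * t%:R * (t%:R + 1))|%N.

Definition zo_batch (d t : nat) : nat :=
  `|Num.ceil (6 * rho * (d%:R + 4) * t%:R * (t%:R + 1))|%N.

Definition zo_nu (d T : nat) : R :=
  D / ((T%:R + 2) ^+ 2 * (d%:R + 6) `^ (3 / 2)).

End parameters.

(* [s t i] and [v t i] are the i-th samples of xi and of the Gaussian
   direction drawn during iteration t. *)
Section gradient_estimates.
Context {R : realType} {d : nat} {Xi : Type}.
Variables (F : 'rV[R]_d -> Xi -> R) (b : nat -> nat).

Definition fo_estimate (s : nat -> nat -> Xi) (t : nat) (z : 'rV[R]_d) :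
    'rV[R]_d :=
  (b t)%:R^-1 *: \sum_(i < b t) grad (F ^~ (s t i)) z.

Definition zo_estimate (nu : R) (s : nat -> nat -> Xi)
    (v : nat -> nat -> 'rV[R]_d) (t : nat) (z : 'rV[R]_d) : 'rV[R]_d :=
  (b t)%:R^-1 *: \sum_(j < b t)
    ((F (z + nu *: v t j) (s t j) - F z (s t j)) / nu) *: v t j.

(* One call per gradient, two per finite difference. *)
Definition fo_calls (T : nat) : nat := (\sum_(1 <= t < T.+1) b t)%N.
Definition zo_calls (T : nat) : nat := (\sum_(1 <= t < T.+1) 2 * b t)%N.

End gradient_estimates.

Section probability.
Context {R : realType}.

(* Mutual independence of the sigma-algebras G i, i in A. *)
Definition mutual_independence dW (W : measurableType dW)
    (P : probability W R) (I : choiceType) (A : set I)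
    (G : I -> set (set W)) : Prop :=
  forall (J : {fset I}) (E : I -> set W),
    [set` J] `<=` A -> (forall i, i \in J -> G i (E i)) ->
    P (\bigcap_(i in [set` J]) E i) = (\prod_(i <- J) P (E i))%E.

Definition sigma_rv dW (W : measurableType dW) dX (X : measurableType dX)
    (f : W -> X) : set (set W) :=
  preimage_set_system setT f measurable.

(* N(0, I_d): independent N(0, 1) coordinates. *)
Definition std_gaussian dW (W : measurableType dW) (P : probability W R)
    (d : nat) (v : {RV P >-> 'rV[R]_d}) : Prop :=
  (forall (i : 'I_d) (A : set R), measurable A ->
     P ((fun w => v w ord0 i) @^-1` A) = normal_prob 0 1 A) /\
  mutual_independence P [set: 'I_d]
    (fun i => sigma_rv (fun w => v w ord0 i)).

(* Pairs (t, i) indexing the samples drawn in T iterations. *)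
Definition drawn (b : nat -> nat) (T : nat) : set (nat * nat) :=
  [set ti | (1 <= ti.1 <= T)%N /\ (ti.2 < b ti.1)%N].

Definition fo_samples dX (Xi : measurableType dX) (mu : probability Xi R)
    dW (W : measurableType dW) (P : probability W R) (b : nat -> nat)
    (T : nat) (xi : nat -> nat -> {RV P >-> Xi}) : Prop :=
  (forall t i, drawn b T (t, i) -> forall A, measurable A ->
     distribution P (xi t i) A = mu A) /\
  mutual_independence P (drawn b T) (fun ti => sigma_rv (xi ti.1 ti.2)).

Definition zo_samples dX (Xi : measurableType dX) (mu : probability Xi R)
    (d : nat) dW (W : measurableType dW) (P : probability W R)
    (b : nat -> nat) (T : nat) (xi : nat -> nat -> {RV P >-> Xi})
    (v : nat -> nat -> {RV P >-> 'rV[R]_d}) : Prop :=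
  [/\ forall t i, drawn b T (t, i) -> forall A, measurable A ->
        distribution P (xi t i) A = mu A,
      forall t i, drawn b T (t, i) -> std_gaussian (v t i) &
      mutual_independence P
        [set k : (nat * nat) + (nat * nat) |
           drawn b T (match k with inl ti => ti | inr ti => ti end)]
        (fun k => match k with
                  | inl ti => sigma_rv (xi ti.1 ti.2)
                  | inr ti => sigma_rv (v ti.1 ti.2)
                  end)].

End probability.

Section problem.
Context {R : realType} {d : nat}.

Definition objective dX (Xi : measurableType dX) (mu : probability Xi R)
    (F : 'rV[R]_d -> Xi -> R) (x : 'rV[R]_d) : R :=
  \int[mu]_xi F x xi.

(* Ties between minimizers are broken in a Borel measurable way. *)
Definition is_lmo (Om : set 'rV[R]_d) (lmo : 'rV[R]_d -> 'rV[R]_d) : Prop :=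
  measurable_fun setT lmo /\
  forall c, Om (lmo c) /\ forall v, Om v -> dotp c (lmo c) <= dotp c v.

Record stochastic_problem (L D : R) dX (Xi : measurableType dX)
    (mu : probability Xi R) (F : 'rV[R]_d -> Xi -> R)
    (Om : set 'rV[R]_d) (xs : 'rV[R]_d) : Prop := {
  sp_closed : closed Om;
  sp_convex : convex_set Om;
  sp_diam : forall x y, Om x -> Om y -> enorm (x - y) <= D;
  sp_measurable :
    measurable_fun setT (fun p : 'rV[R]_d * Xi => F p.1 p.2);
  sp_integrable :
    forall x, mu.-integrable setT (fun xi => (F x xi)%:E);
  sp_convex_objective : convex_function setT (objective mu F);
  sp_differentiable_objective :
    forall x, Om x -> differentiable (objective mu F : _ -> R^o) x;
  sp_smooth : forall x y, Om x -> Om y ->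
    enorm (grad (objective mu F) x - grad (objective mu F) y)
      <= L * enorm (x - y);
  sp_feasible : Om xs;
  sp_minimum : forall x, Om x -> objective mu F xs <= objective mu F x;
  sp_differentiable : forall x xi, Om x ->
    differentiable (F ^~ xi : _ -> R^o) x;
  sp_unbiased : forall x (i : 'I_d), Om x ->
    ('E_mu[fun xi => grad (F ^~ xi) x ord0 i] =
      (grad (objective mu F) x ord0 i)%:E)%E }.

Definition fo_variance (L rho : R) dX (Xi : measurableType dX)
    (mu : probability Xi R) (F : 'rV[R]_d -> Xi -> R)
    (Om : set 'rV[R]_d) (xs : 'rV[R]_d) : Prop :=
  forall x, Om x ->
    ('E_mu[fun xi =>
        (enorm (grad (F ^~ xi) x - grad (objective mu F) x) ^+ 2)%R]
     <= (2 * rho * L * (objective mu F x - objective mu F xs))%:E)%E.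

Definition zo_smooth (L : R) dX (Xi : measurableType dX)
    (mu : probability Xi R) (F : 'rV[R]_d -> Xi -> R) : Prop :=
  {ae mu, forall xi,
     (forall x, differentiable (F ^~ xi : _ -> R^o) x) /\
     (forall x y, enorm (grad (F ^~ xi) x - grad (F ^~ xi) y)
                    <= L * enorm (x - y))}.

Definition zo_second_moment (L rho : R) dX (Xi : measurableType dX)
    (mu : probability Xi R) (F : 'rV[R]_d -> Xi -> R)
    (Om : set 'rV[R]_d) (xs : 'rV[R]_d) : Prop :=
  forall x, Om x ->
    ('E_mu[fun xi => (enorm (grad (F ^~ xi) x) ^+ 2)%R]
     <= (2 * rho * L * (objective mu F x - objective mu F xs))%:E)%E.

Definition eps_optimal dW (W : measurableType dW) (P : probability W R)
    (Om : set 'rV[R]_d) (f : 'rV[R]_d -> R) (xs : 'rV[R]_d) (eps : R)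
    (x : W -> 'rV[R]_d) : Prop :=
  (forall w, Om (x w)) /\ ('E_P[fun w => (f (x w) - f xs)%R] <= eps%:E)%E.

End problem.

Section runs.
Context {R : realType} {d : nat} {Xi : Type}.
Variables (L D rho : R) (F : 'rV[R]_d -> Xi -> R).
Variables (lmo : 'rV[R]_d -> 'rV[R]_d) (x0 : 'rV[R]_d).

Definition fo_x (s : nat -> nat -> Xi) (t : nat) : 'rV[R]_d :=
  (scgs lmo (scgs_beta L) scgs_gamma (scgs_eta L D)
        (fo_estimate F (fo_batch rho) s) x0 t).1.

Definition fo_lmo_calls (s : nat -> nat -> Xi) (T : nat) : \bar R :=
  scgs_lmo_calls lmo (scgs_beta L) scgs_gamma (scgs_eta L D)
    (fo_estimate F (fo_batch rho) s) x0 T.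

(* The smoothing parameter depends on the horizon T. *)
Definition zo_x (T : nat) (s : nat -> nat -> Xi)
    (v : nat -> nat -> 'rV[R]_d) (t : nat) : 'rV[R]_d :=
  (scgs lmo (scgs_beta L) scgs_gamma (scgs_eta L D)
        (zo_estimate F (zo_batch rho d) (zo_nu D d T) s v) x0 t).1.

Definition zo_lmo_calls (T : nat) (s : nat -> nat -> Xi)
    (v : nat -> nat -> 'rV[R]_d) : \bar R :=
  scgs_lmo_calls lmo (scgs_beta L) scgs_gamma (scgs_eta L D)
    (zo_estimate F (zo_batch rho d) (zo_nu D d T) s v) x0 T.

End runs.

(* Main.v *)
Require Import Defs.
From HB Require Import structures.
From mathcomp Require Import all_boot all_order all_algebra finmap.
From mathcomp Require Import all_classical all_reals all_analysis measurable_realfun.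
From mathcomp Require Import ring lra.

Set Implicit Arguments.
Unset Strict Implicit.
Unset Printing Implicit Defensive.

Import Order.TTheory GRing.Theory Num.Theory.
Import numFieldNormedType.Exports.

Local Open Scope classical_set_scope.
Local Open Scope ring_scope.

(** Let delta_t be the error of the gradient estimate at z_t and r_t the squared
    distance of y_t to the minimizer xs.  Smoothness, convexity and the accuracy
    eta_t of the inexact conditional gradient step give, on every sample path,
      gap(x_t) <= (1 - gamma_t) gap(x_(t-1)) + 3/(2L) |delta_t|^2
        + gamma_t (eta_t + beta_t/2 (r_(t-1) - r_t) + <delta_t, xs - y_(t-1)>).
    Given the past, delta_t is a mean of b_t independent errors, so the inner
    product has mean zero and E|delta_t|^2 <= 2L/(3t(t+1)) E gap(z_t), up to the
    smoothing bias in the zeroth-order setting.  By convexity gap(z_t) is at most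
    a combination of gap(x_(t-1)) and gap(y_(t-1)); the latter need not decrease
    but stays bounded, because the step also controls <grad f xs, y_t - xs>.
    Hence t(t+1)(t+2) E gap(x_t) + 6L t(t+1)/(t+2) E r_t grows at most linearly.

    In the zeroth-order setting a finite difference along u is within
    L nu |u|^2 / 2 of <grad F, u>, and E|<g, u> u|^2 <= (d + 4) E|g|^2 for a
    standard Gaussian u independent of g; moreover the second moment bound at xs
    forces grad f xs = 0.

    The inner loop is the Frank-Wolfe method on a quadratic with ratio of
    beta_t D^2 to eta_t of order t, so it stops after O(t) steps. *)

(** * Inexact conditional gradient *)

(** The delicate point is the coefficient 3 of |grad f xs| D. Bounding gap(y_t) through the diameter
    alone puts 3 |grad f xs| D into every increment of the potential, whereas only 5/6 of the slope
    [A] is available there, that is 5/2 |grad f xs| D, because the variance term carries t gap(x_t),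
    which takes up to A/6. The estimate of the slope <grad f xs, y_t - xs> lowers the cost to 3/8
    |grad f xs| D. In the zeroth-order setting grad f xs = 0 and the diameter bound suffices.

    Conditioning is done by freezing. The past is a second sigma-algebra on the sample space, turned
    into a measurable type of its own; the lemma on measurability of runs is stated over an
    arbitrary measurable space, so applied to that type it says that an iterate is a function of the
    past. An average over fresh samples is then an inner integral with the past held fixed, by
    Tonelli for the product of two laws.

    The number of inner steps is bounded uniformly over sample paths. This gives a pathwise count of
    oracle calls, and it also makes the output of the inner loop measurable. *)

Section euclidean_theory.
Context {R : realType} {d : nat}.
Implicit Types (u v w : 'rV[R]_d) (a c : R).

Lemma dotpC u v : dotp u v = dotp v u.
Proof. by apply: eq_bigr => i _; rewrite mulrC. Qed.

Lemma dotpDl u v w : dotp (u + v) w = dotp u w + dotp v w.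
Proof. by rewrite -big_split; apply: eq_bigr => i _; rewrite mxE mulrDl. Qed.

Lemma dotpZl a u v : dotp (a *: u) v = a * dotp u v.
Proof. by rewrite mulr_sumr; apply: eq_bigr => i _; rewrite mxE mulrA. Qed.

Lemma dotpDr u v w : dotp w (u + v) = dotp w u + dotp w v.
Proof. by rewrite dotpC dotpDl !(dotpC w). Qed.

Lemma dotpZr a u v : dotp u (a *: v) = a * dotp u v.
Proof. by rewrite dotpC dotpZl dotpC. Qed.

Lemma dotpNl u v : dotp (- u) v = - dotp u v.
Proof. by rewrite -scaleN1r dotpZl mulN1r. Qed.

Lemma dotpNr u v : dotp u (- v) = - dotp u v.
Proof. by rewrite dotpC dotpNl dotpC. Qed.

Definition dotpE := (dotpDl, dotpDr, dotpNl, dotpNr, dotpZl, dotpZr).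

Lemma dotp0l v : dotp 0 v = 0.
Proof. by rewrite -(scale0r v) dotpZl mul0r. Qed.

Lemma dotp0r v : dotp v 0 = 0.
Proof. by rewrite dotpC dotp0l. Qed.

Lemma dotp_suml I (r : seq I) (P : pred I) (F : I -> 'rV[R]_d) v :
  dotp (\sum_(i <- r | P i) F i) v = \sum_(i <- r | P i) dotp (F i) v.
Proof.
by apply: (big_morph (fun u => dotp u v)); [move=> x y; exact: dotpDl|exact: dotp0l].
Qed.

Lemma dotp_sumr I (r : seq I) (P : pred I) (F : I -> 'rV[R]_d) v :
  dotp v (\sum_(i <- r | P i) F i) = \sum_(i <- r | P i) dotp v (F i).
Proof. by rewrite dotpC dotp_suml; apply: eq_bigr => i _; rewrite dotpC. Qed.

Lemma dotp_ge0 u : 0 <= dotp u u.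
Proof. by apply: sumr_ge0 => i _; rewrite -expr2 sqr_ge0. Qed.

Lemma dotp_eq0 u : dotp u u = 0 -> u = 0.
Proof.
move=> /eqP; rewrite psumr_eq0; last by move=> i _; rewrite -expr2 sqr_ge0.
move=> /allP u0; apply/rowP => i; rewrite mxE; apply/eqP.
by have := u0 i (mem_index_enum i); rewrite mulf_eq0 orbb.
Qed.

Lemma sqr_enorm u : enorm u ^+ 2 = dotp u u.
Proof. by rewrite sqr_sqrtr // dotp_ge0. Qed.

Lemma enorm_ge0 u : 0 <= enorm u.
Proof. exact: sqrtr_ge0. Qed.

Lemma enormN u : enorm (- u) = enorm u.
Proof. by rewrite /enorm dotpNl dotpNr opprK. Qed.

Lemma enormZ a u : 0 <= a -> enorm (a *: u) = a * enorm u.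
Proof.
move=> a0; rewrite /enorm dotpZl dotpZr mulrA -expr2 sqrtrM ?sqr_ge0 //.
by rewrite sqrtr_sqr ger0_norm.
Qed.

Lemma enorm0 : enorm (0 : 'rV[R]_d) = 0.
Proof. by rewrite /enorm dotp0l sqrtr0. Qed.

Lemma enorm_le_dotp u c : 0 <= c -> (enorm u <= c) = (dotp u u <= c ^+ 2).
Proof.
by move=> c0; rewrite -sqr_enorm ler_pXn2r // nnegrE // enorm_ge0.
Qed.

(** The difference of the two sides is the square of u - c v divided by 2c. *)
Lemma dotp_young c u v : 0 < c ->
  dotp u v <= dotp u u / (2 * c) + c / 2 * dotp v v.
Proof.
move=> c0; have c2 : 0 < c * 2 by rewrite mulr_gt0.
have h : dotp u u / (2 * c) + c / 2 * dotp v v - dotp u v =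
    dotp (u - c *: v) (u - c *: v) / (2 * c).
  rewrite !dotpE (dotpC v u); field; exact: lt0r_neq0.
by rewrite -subr_ge0 h divr_ge0 ?dotp_ge0 // mulr_ge0 // ltW.
Qed.

Lemma cauchy_schwarz u v : dotp u v <= enorm u * enorm v.
Proof.
have [u0|u0] := eqVneq (enorm u) 0.
  have -> : u = 0 by apply: dotp_eq0; rewrite -sqr_enorm u0 expr0n.
  by rewrite dotp0l enorm0 mul0r.
have [v0|v0] := eqVneq (enorm v) 0.
  have -> : v = 0 by apply: dotp_eq0; rewrite -sqr_enorm v0 expr0n.
  by rewrite dotp0r enorm0 mulr0.
have u1 : 0 < enorm u by rewrite lt_def u0 enorm_ge0.
have v1 : 0 < enorm v by rewrite lt_def v0 enorm_ge0.
(* With this weight each of the two Young terms equals |u| |v| / 2. *)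
have /le_trans -> // := @dotp_young (enorm u / enorm v) u v (divr_gt0 u1 v1).
rewrite -!sqr_enorm le_eqVlt; apply/orP; left; apply/eqP.
by field; rewrite v0 u0.
Qed.

End euclidean_theory.

Ltac nonneg := by repeat first
  [ done | exact: ltW | exact: sqr_ge0 | exact: dotp_ge0 | exact: enorm_ge0
  | apply: addr_ge0 | apply: mulr_ge0 | rewrite invr_ge0 | apply: exprn_ge0 ].

Ltac pos := by repeat first
  [ done | apply: mulr_gt0 | rewrite invr_gt0 | apply: exprn_gt0
  | apply: ltr_wpDl; [nonneg|] | apply: ltr_wpDr; [nonneg|] ].

Section inexact_conditional_gradient_theory.
Context {R : realType} {d : nat}.
Variables (Om : set 'rV[R]_d) (lmo : 'rV[R]_d -> 'rV[R]_d) (D : R).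
Hypothesis Om_conv :
  forall x y (a : R), Om x -> Om y -> 0 <= a <= 1 -> Om ((1 - a) *: x + a *: y).
Hypothesis Om_diam : forall x y, Om x -> Om y -> dotp (x - y) (x - y) <= D ^+ 2.
Hypothesis lmoP :
  forall c, Om (lmo c) /\ forall v, Om v -> dotp c (lmo c) <= dotp c v.
Variables (g u : 'rV[R]_d) (beta eta : R).
Hypotheses (Om_u : Om u) (beta_gt0 : 0 < beta).

Local Notation uk := (icg_iter lmo g u beta).
Local Notation vertex := (icg_vertex lmo g u beta).
Local Notation gap := (icg_gap lmo g u beta).
Local Notation step k := (icg_stepsize g u beta (uk k) (vertex (uk k))).

(** The inner loop is Frank-Wolfe with exact line search on this quadratic: its gradient at u_k is g
    + beta (u_k - u), and [gap] is its Frank-Wolfe gap. *)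
Let model (x : 'rV[R]_d) := dotp g x + beta / 2 * dotp (x - u) (x - u).

Let vertex_Om x : Om (vertex x).
Proof. exact: (lmoP _).1. Qed.

Let gapE k : gap k = dotp (beta *: (u - uk k) - g) (vertex (uk k) - uk k).
Proof. by rewrite /icg_gap !dotpE; ring. Qed.

Let stepE k : step k =
  Num.min 1 (gap k / (beta * dotp (vertex (uk k) - uk k) (vertex (uk k) - uk k))).
Proof. by rewrite /icg_stepsize gapE sqr_enorm. Qed.

Let gap_le k x : Om x -> dotp (g + beta *: (uk k - u)) (uk k - x) <= gap k.
Proof.
move=> Ox; have [_ /(_ _ Ox)] := lmoP (g + beta *: (uk k - u)).
by rewrite /icg_gap /icg_vertex; set c := g + _; rewrite !(dotpDr _ _ c) !(dotpNr c); lra.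
Qed.

Lemma icg_iter_Om k : Om (uk k).
Proof.
elim: k => //= k IH; apply: Om_conv => //.
have gap0 : 0 <= gap k.
  by have := gap_le k IH; rewrite subrr dotp0r.
rewrite stepE ge_min lexx /= le_min ler01 /=.
by rewrite divr_ge0 // mulr_ge0 ?dotp_ge0 // ltW.
Qed.

Let gap_ge0 k : 0 <= gap k.
Proof. by have := gap_le k (icg_iter_Om k); rewrite subrr dotp0r. Qed.

(** Along the segment to the vertex the quadratic is known exactly, and the clipped step minimises
    -a h + a^2 q / 2 over [0, 1], so it does at least as well as any other [a]. A free [a] lets
    later arguments choose a convenient step. *)
Lemma icg_descent k a : 0 <= a <= 1 ->
  model (uk k.+1) <= model (uk k) - a * gap k + a ^+ 2 * (beta * D ^+ 2) / 2.
Proof.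
move=> /andP[a0 a1].
set s := dotp (vertex (uk k) - uk k) (vertex (uk k) - uk k).
have s0 : 0 <= s by exact: dotp_ge0.
have sD : s <= D ^+ 2 by apply: Om_diam => //; exact: icg_iter_Om.
have modelE : model (uk k.+1) =
    model (uk k) - step k * gap k + step k ^+ 2 * (beta * s) / 2.
  rewrite /= /model /s /icg_gap.
  move: (uk k) (vertex (uk k)) (step k) => x v t.
  rewrite !dotpE ?(dotpC u v) ?(dotpC u x) ?(dotpC x v).
  by field.
suff best : - step k * gap k + step k ^+ 2 * (beta * s) / 2 <=
            - a * gap k + a ^+ 2 * (beta * s) / 2.
  rewrite modelE.
  have : a ^+ 2 * (beta * s) / 2 <= a ^+ 2 * (beta * D ^+ 2) / 2.
    by rewrite ler_wpM2r ?invr_ge0 // ler_wpM2l ?sqr_ge0 // ler_wpM2l // ltW.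
  lra.
rewrite stepE -/s.
(* When the vertex is the current point the gap is zero and both sides vanish, whatever step the
   division by zero produces. *)
have [s00|sn0] := eqVneq s 0.
  have v0 : vertex (uk k) - uk k = 0 by exact: dotp_eq0.
  have -> : gap k = 0 by rewrite gapE v0 dotp0r.
  by rewrite s00 !(mulr0, mul0r, addr0).
have sp : 0 < s by rewrite lt_def sn0.
have bs : 0 < beta * s by rewrite mulr_gt0.
move: (gap_ge0 k) bs; move: (gap k) (beta * s) => h q h0 q0.
(* If the step is clipped at 1, then q <= h and the difference factors through 1 - a; otherwise the
   difference is a completed square. *)
rewrite minEle; case: ifPn => [|].
  rewrite ler_pdivlMr // mul1r => qh.
  rewrite -subr_ge0.
  have -> : - a * h + a ^+ 2 * q / 2 - (- 1 * h + 1 ^+ 2 * q / 2) =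
    (1 - a) * (h - (1 + a) / 2 * q) by field.
  rewrite mulr_ge0 ?subr_ge0 //; apply: le_trans qh.
  by rewrite ler_piMl //; [exact: ltW|lra].
move=> _; rewrite -subr_ge0.
have -> : - a * h + a ^+ 2 * q / 2 - (- (h / q) * h + (h / q) ^+ 2 * q / 2) =
    (a * q - h) ^+ 2 / (2 * q) by field; exact: lt0r_neq0.
by rewrite divr_ge0 ?sqr_ge0 // mulr_ge0 // ltW.
Qed.

(** Convexity of the quadratic; the term discarded is beta/2 |u_k - x|^2. *)
Let primal_gap k x : Om x -> model (uk k) - model x <= gap k.
Proof.
move=> Ox; apply: le_trans (gap_le k Ox).
rewrite -subr_ge0 /model.
have -> : dotp (g + beta *: (uk k - u)) (uk k - x) -
  (dotp g (uk k) + beta / 2 * dotp (uk k - u) (uk k - u) -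
    (dotp g x + beta / 2 * dotp (x - u) (x - u))) =
  beta / 2 * dotp (uk k - x) (uk k - x).
  move: (uk k) => v.
  by rewrite !dotpE ?(dotpC u v) ?(dotpC u x) ?(dotpC x v); field.
by rewrite mulr_ge0 ?dotp_ge0 // divr_ge0 // ltW.
Qed.

(** The usual Frank-Wolfe induction. The first step is compared with a = 1, which erases the initial
    error: the bound starts at k = 1 and does not mention the starting point. *)
Let primal_rate k x : Om x -> (0 < k)%N ->
  model (uk k) - model x <= 2 * (beta * D ^+ 2) / (k%:R + 2).
Proof.
move=> Ox; case: k => // k _.
set M := beta * D ^+ 2.
have rec j a : 0 <= a <= 1 -> model (uk j.+1) - model x <=
    (1 - a) * (model (uk j) - model x) + a ^+ 2 * M / 2.
  move=> a01; have /andP[a0 _] := a01.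
  have := icg_descent j a01; rewrite -/M.
  have := ler_wpM2l a0 (primal_gap j Ox); lra.
have M0 : 0 <= M by rewrite mulr_ge0 ?sqr_ge0 // ltW.
elim: k => [|k IH].
  apply: le_trans (rec _ 1 _) _; first by rewrite ler01 lexx.
  rewrite subrr mul0r add0r expr1n mul1r.
  by have -> : 2 * M / (1%:R + 2) = 2 / 3 * M by [field]; lra.
have k0 : 0 <= k%:R :> R by [].
(* The standard step 2/(j + 2) at index j = k + 1. *)
pose a : R := 2 / (k%:R + 3).
have a01 : 0 <= a <= 1.
  by rewrite /a divr_ge0 ?addr_ge0 //= ler_pdivrMr; lra.
have /andP[a0 a1] := a01.
apply: le_trans (rec _ _ a01) _.
have := ler_wpM2l (_ : 0 <= 1 - a) IH; rewrite subr_ge0 => /(_ a1) IH'.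
apply: le_trans (lerD IH' (lexx _)) _.
rewrite -subr_ge0.
have -> : 2 * M / (k.+2%:R + 2) -
     ((1 - a) * (2 * M / (k.+1%:R + 2)) + a ^+ 2 * M / 2) =
     2 * M / ((k%:R + 4) * (k%:R + 3) ^+ 2).
  have -> : k.+2%:R = k%:R + 2 :> R by rewrite -addn2 natrD.
  have -> : k.+1%:R = k%:R + 1 :> R by rewrite -addn1 natrD.
  rewrite /a; field.
  by do ?[apply/andP; split]; apply: lt0r_neq0; lra.
by apply: divr_ge0; apply: mulr_ge0.
Qed.

Hypotheses (eta_gt0 : 0 < eta) (eta_le : eta <= beta * D ^+ 2).

(* Each step with gap above eta decreases the quadratic model by at least
   eta^2/(2 beta D^2), while after n steps it is within
   2 beta D^2/(n+2) of its minimum. *)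
Lemma icg_gap_small n : (0 < n)%N -> 2 * (beta * D ^+ 2) <= n%:R * eta ->
  exists2 k, (k < n.*2)%N & gap k <= eta.
Proof.
move=> n0; set M := beta * D ^+ 2 => Mn.
have M0 : 0 < M by exact: lt_le_trans eta_gt0 eta_le.
apply: contrapT => nogap.
have big k : (k < n.*2)%N -> eta < gap k.
  by move=> kn; rewrite ltNge; apply/negP => ?; apply: nogap; exists k.
have dec k : (k < n.*2)%N ->
    model (uk k.+1) <= model (uk k) - eta ^+ 2 / (2 * M).
  (* This [a] minimises -a eta + a^2 M / 2, with value -eta^2 / (2M); it is at most 1 because eta <=
     M. *)
  move=> kn; have := icg_descent k (a := eta / M); rewrite -/M.
  have a01 : 0 <= eta / M <= 1.
    apply/andP; split; last by rewrite ler_pdivrMr // mul1r.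
    by rewrite divr_ge0 // ltW.
  move=> /(_ a01) h; apply: le_trans h _.
  have /andP[a0 _] := a01.
  have := ler_wpM2l a0 (ltW (big _ kn)).
  have -> : (eta / M) ^+ 2 * M / 2 = eta ^+ 2 / (2 * M).
    by field; exact: lt0r_neq0.
  have -> : eta / M * eta = 2 * (eta ^+ 2 / (2 * M)).
    by field; exact: lt0r_neq0.
  lra.
have decn j : (j <= n)%N ->
    model (uk (n + j)) <= model (uk n) - j%:R * (eta ^+ 2 / (2 * M)).
  elim: j => [|j IH] jn; first by rewrite addn0 mul0r subr0.
  rewrite addnS; apply: le_trans (dec _ _) _.
    by rewrite -addnn ltn_add2l.
  have := IH (ltnW jn); rewrite -(addn1 j) natrD; lra.
(* The rate at step n is compared with the point u_(2n) itself: the decrease between steps n and 2n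
   is at most 2M/(n + 2), so n (n + 2) eta^2 <= 4 M^2, which contradicts n eta >= 2M. *)
have := primal_rate (icg_iter_Om (n + n)) n0; rewrite -/M.
have := decn n (leqnn n); set s := n%:R * _ => h1 h2.
have {h1 h2} : s <= 2 * M / (n%:R + 2) by lra.
have n1 : 0 < n%:R :> R by rewrite ltr0n.
have n2 : 0 < n%:R + 2 :> R by lra.
have M2 : 0 < 2 * M by lra.
rewrite (ler_pdivlMr _ _ n2).
have -> : s * (n%:R + 2) = n%:R * eta ^+ 2 * (n%:R + 2) / (2 * M).
  by rewrite /s; field; exact: lt0r_neq0.
rewrite (ler_pdivrMr _ _ M2) leNgt.
move/negP; apply.
have -> : 2 * M * (2 * M) = (2 * M) ^+ 2 by rewrite expr2.
apply: (@le_lt_trans _ _ ((n%:R * eta) ^+ 2)).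
  rewrite ler_pXn2r // nnegrE; first exact: ltW.
  by rewrite mulr_ge0 // ltW.
have -> : n%:R * eta ^+ 2 * (n%:R + 2) =
   (n%:R * eta) ^+ 2 + 2 * n%:R * eta ^+ 2 by ring.
by rewrite ltrDl mulr_gt0 ?exprn_gt0 // mulr_gt0.
Qed.

Variable n : nat.
Hypotheses (n_gt0 : (0 < n)%N) (n_ge : 2 * (beta * D ^+ 2) <= n%:R * eta).

Lemma icg_stop_spec : exists k,
  [/\ icg_stop lmo g u beta eta = Some k, gap k <= eta, (k < n.*2)%N &
      forall j, (j < k)%N -> eta < gap j].
Proof.
rewrite /icg_stop; case: pselect => [ex|nex]; last first.
  by exfalso; apply: nex; have [k _ ?] := icg_gap_small n_gt0 n_ge; exists k.
case: ex_minnP => k gk kmin; exists k; split => //.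
  have [j jn gj] := icg_gap_small n_gt0 n_ge.
  by rewrite (leq_ltn_trans _ jn) // kmin.
move=> j jk; rewrite ltNge; apply/negP => /kmin.
by rewrite leqNgt jk.
Qed.

Lemma icg_Om : Om (icg lmo g u beta eta).
Proof.
rewrite /icg; have [k [-> _ _ _]] := icg_stop_spec; exact: icg_iter_Om.
Qed.

(** The stopping test bounds a maximum over [Om], so it yields an approximate variational inequality
    at every feasible point. *)
Lemma icg_opt x : Om x ->
  dotp (g + beta *: (icg lmo g u beta eta - u)) (icg lmo g u beta eta - x) <= eta.
Proof.
rewrite /icg; have [k [-> gk _ _]] := icg_stop_spec => Ox.
exact: le_trans (gap_le k Ox) gk.
Qed.

Lemma icg_calls_le : (icg_calls lmo g u beta eta <= (n.*2%:R)%:E)%E.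
Proof.
rewrite /icg_calls; have [k [-> _ kn _]] := icg_stop_spec.
by rewrite lee_fin ler_nat.
Qed.

End inexact_conditional_gradient_theory.

(** * Measurability of vector operations and of the inner loop *)

Section measurability.
Context {R : realType} {d : nat} dT (T : measurableType dT).
Implicit Types (f g : T -> 'rV[R]_d) (h : T -> R).

Lemma measurable_coord (i : 'I_d) :
  measurable_fun setT (fun x : 'rV[R]_d => x ord0 i).
Proof.
move=> _ A mA; rewrite setTI; apply: sub_sigma_algebra => /=.
rewrite -bigcup_seq; exists i; first by rewrite /= mem_index_enum.
by exists A; rewrite ?setTI.
Qed.

Lemma measurable_fun_rV f :
  (forall i, measurable_fun setT (fun w => f w ord0 i)) ->
  measurable_fun setT f.
Proof.
move=> mf; apply: (@measurability _ _ _ _ setT f (\big[setU/set0]_(i < d)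
    preimage_set_system setT (fun x : 'rV[R]_d => x ord0 i) measurable)) => //.
move=> _ [A + <-]; rewrite -bigcup_seq => -[i _ [B mB <-]].
by rewrite !setTI -comp_preimage -[X in measurable X]setTI; exact: mf.
Qed.

Lemma measurable_fun_coord f (i : 'I_d) :
  measurable_fun setT f -> measurable_fun setT (fun w => f w ord0 i).
Proof. exact: (measurableT_comp (measurable_coord i)). Qed.

Lemma measurable_rVD f g : measurable_fun setT f -> measurable_fun setT g ->
  measurable_fun setT (fun w => f w + g w).
Proof.
move=> mf mg; apply: measurable_fun_rV => i; under eq_fun do rewrite mxE.
by apply: measurable_funD; exact: measurable_fun_coord.
Qed.

Lemma measurable_rVZ h f : measurable_fun setT h -> measurable_fun setT f ->
  measurable_fun setT (fun w => h w *: f w).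
Proof.
move=> mh mf; apply: measurable_fun_rV => i; under eq_fun do rewrite mxE.
by apply: measurable_funM => //; exact: measurable_fun_coord.
Qed.

Lemma measurable_rVB f g : measurable_fun setT f -> measurable_fun setT g ->
  measurable_fun setT (fun w => f w - g w).
Proof.
move=> mf mg; apply: measurable_rVD => //.
under eq_fun do rewrite -scaleN1r; exact: measurable_rVZ.
Qed.

Lemma measurable_rV_sum I (s : seq I) (F : I -> T -> 'rV[R]_d) :
  (forall i, measurable_fun setT (F i)) ->
  measurable_fun setT (fun w => \sum_(i <- s) F i w).
Proof.
move=> mF; apply: measurable_fun_rV => i; under eq_fun do rewrite summxE.
by apply: measurable_sum => j; exact: measurable_fun_coord.
Qed.

Lemma measurable_dotp f g : measurable_fun setT f -> measurable_fun setT g ->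
  measurable_fun setT (fun w => dotp (f w) (g w)).
Proof.
move=> mf mg; apply: measurable_sum => i.
by apply: measurable_funM; exact: measurable_fun_coord.
Qed.

End measurability.

(** Inversion is discontinuous at 0, where its value is 0 by convention; the line is cut into the
    point 0 and its open complement. *)
Lemma measurable_inv {R : realType} dT (T : measurableType dT) (h : T -> R) :
  measurable_fun setT h -> measurable_fun setT (fun w => (h w)^-1).
Proof.
apply: measurableT_comp.
have -> : [set: R] = [set 0] `|` [set r | r != 0].
  by apply/seteqP; split => r //= _; have [->|] := eqVneq r 0; [left|right].
have o : open [set r : R | r != 0] by exact: open_neq.
apply/measurable_funU => //; first exact: open_measurable.
split; first exact: measurable_fun_set1.
by apply: open_continuous_measurable_fun => // x /set_mem; exact: inv_continuous.
Qed.

Section measurable_icg.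
Context {R : realType} {d : nat} dT (T : measurableType dT).
Variables (Om : set 'rV[R]_d) (lmo : 'rV[R]_d -> 'rV[R]_d) (D : R).
Hypothesis Om_conv :
  forall x y (a : R), Om x -> Om y -> 0 <= a <= 1 -> Om ((1 - a) *: x + a *: y).
Hypothesis Om_diam : forall x y, Om x -> Om y -> dotp (x - y) (x - y) <= D ^+ 2.
Hypothesis lmoP : is_lmo Om lmo.
Variables (g u : T -> 'rV[R]_d) (beta eta : R).
Hypotheses (mg : measurable_fun setT g) (mu : measurable_fun setT u).

Lemma measurable_icg_iter k :
  measurable_fun setT (fun w => icg_iter lmo (g w) (u w) beta k).
Proof.
elim: k => //= k IH.
set f := fun w => icg_iter lmo (g w) (u w) beta k in IH *.
have mv : measurable_fun setT (fun w => icg_vertex lmo (g w) (u w) beta (f w)).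
  apply: (measurableT_comp lmoP.1).
  by apply: measurable_rVD => //; apply: measurable_rVZ => //; exact: measurable_rVB.
have ma : measurable_fun setT (fun w => icg_stepsize (g w) (u w) beta (f w)
    (icg_vertex lmo (g w) (u w) beta (f w))).
  rewrite /icg_stepsize; under eq_fun do rewrite sqr_enorm.
  apply: measurable_minr => //; apply: measurable_funM.
    apply: measurable_dotp; last exact: measurable_rVB.
    by apply: measurable_rVB => //; apply: measurable_rVZ => //; exact: measurable_rVB.
  apply: measurable_inv; apply: measurable_funM => //.
  by apply: measurable_dotp; exact: measurable_rVB.
by apply: measurable_rVD; apply: measurable_rVZ => //; exact: measurable_funB.
Qed.

Lemma measurable_icg_gap k :
  measurable_fun setT (fun w => icg_gap lmo (g w) (u w) beta k).
Proof.
have mi := measurable_icg_iter k.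
have m1 : measurable_fun setT (fun w =>
    g w + beta *: (icg_iter lmo (g w) (u w) beta k - u w)).
  by apply: measurable_rVD => //; apply: measurable_rVZ => //; exact: measurable_rVB.
apply: measurable_dotp => //; apply: measurable_rVB => //.
exact: (measurableT_comp lmoP.1).
Qed.

(** [icg] finds its stopping index by a choice on an existence proof, which hides measurability.
    This search with fuel is built from measurable tests, and it agrees with [icg] as soon as the
    fuel exceeds the stopping index; the final default [u w] is then never reached. *)
Fixpoint icg_search (n k : nat) (w : T) : 'rV[R]_d :=
  if n is n'.+1 then
    if icg_gap lmo (g w) (u w) beta k <= eta then icg_iter lmo (g w) (u w) beta k
    else icg_search n' k.+1 w
  else u w.

Lemma measurable_icg_search n k : measurable_fun setT (icg_search n k).
Proof.
elim: n k => //= n IH k; apply: measurable_fun_ifT => //.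
- by apply: measurable_fun_ler => //; exact: measurable_icg_gap.
- exact: measurable_icg_iter.
Qed.

Lemma icg_searchE n k j w : (j < n)%N ->
  icg_gap lmo (g w) (u w) beta (k + j) <= eta ->
  (forall i, (i < k + j)%N -> eta < icg_gap lmo (g w) (u w) beta i) ->
  icg_search n k w = icg_iter lmo (g w) (u w) beta (k + j).
Proof.
elim: n k j => // n IH k [|j] jn gj lt /=; first by rewrite addn0 in gj *; rewrite gj.
have := lt k; rewrite -[X in (X < _)%N]addn0 ltn_add2l => /(_ isT) gk.
by rewrite leNgt gk /= (IH _ j) // -?addSnnS // addSnnS.
Qed.

Hypotheses (beta_gt0 : 0 < beta) (eta_gt0 : 0 < eta)
  (eta_le : eta <= beta * D ^+ 2) (u_Om : forall w, Om (u w)).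

Lemma measurable_icg :
  measurable_fun setT (fun w => icg lmo (g w) (u w) beta eta).
Proof.
(* The fuel depends only on beta, D and eta, so it serves all sample points at once. *)
have [n n0 nM] : exists2 n, (0 < n)%N & 2 * (beta * D ^+ 2) <= n%:R * eta.
  set x := 2 * (beta * D ^+ 2) / eta.
  have x0 : 0 <= x by rewrite /x; nonneg.
  exists (Num.truncn x).+1 => //; rewrite -ler_pdivrMr // -/x.
  by have /andP[_ /ltW] := truncn_itv x0.
rewrite (_ : (fun w => _) = icg_search n.*2 0); first exact: measurable_icg_search.
apply/funext => w; rewrite /icg.
have [k [-> gk kn lt]] :=
  icg_stop_spec Om_conv Om_diam lmoP.2 (g w) (u_Om w) beta_gt0 eta_gt0 eta_le n0 nM.
by rewrite (@icg_searchE _ 0 k).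
Qed.

End measurable_icg.

(** * Runs of the sliding algorithm *)

Section sliding_theory.
Context {R : realType} {d : nat}.
Variables (Om : set 'rV[R]_d) (lmo : 'rV[R]_d -> 'rV[R]_d) (L D : R).
Hypotheses (L_gt0 : 0 < L) (D_gt0 : 0 < D).
Hypothesis Om_conv :
  forall x y (a : R), Om x -> Om y -> 0 <= a <= 1 -> Om ((1 - a) *: x + a *: y).
Hypothesis Om_diam : forall x y, Om x -> Om y -> dotp (x - y) (x - y) <= D ^+ 2.
Hypothesis lmoP : is_lmo Om lmo.
Variable x0 : 'rV[R]_d.
Hypothesis x0_Om : Om x0.

Lemma scgs_gamma_itv t : (0 < t)%N -> 0 <= (scgs_gamma t : R) <= 1.
Proof.
case: t => // t _; rewrite /scgs_gamma -addn1 natrD.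
have t0 : 0 <= t%:R :> R by [].
apply/andP; split; first by rewrite divr_ge0.
by rewrite ler_pdivrMr; lra.
Qed.

Lemma scgs_beta_gt0 t : 0 < scgs_beta L t.
Proof.
have t0 : 0 <= t%:R :> R by [].
by rewrite /scgs_beta divr_gt0 ?mulr_gt0 // ltr_wpDl.
Qed.

Lemma scgs_eta_gt0 t : (0 < t)%N -> 0 < scgs_eta L D t.
Proof.
move=> t0; have t1 : 0 < t%:R :> R by rewrite ltr0n.
by rewrite /scgs_eta divr_gt0 ?mulr_gt0 ?exprn_gt0 // ltr_wpDl // ltW.
Qed.

(** Amounts to t + 2 <= 4 t (t + 1), which holds from t = 1 on. *)
Lemma scgs_eta_le t : (0 < t)%N -> scgs_eta L D t <= scgs_beta L t * D ^+ 2.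
Proof.
move=> t0; have t1 : 1 <= t%:R :> R by rewrite ler1n.
rewrite /scgs_eta /scgs_beta.
have -> : 4 * L / (t%:R + 2) * D ^+ 2 = L * D ^+ 2 * (4 / (t%:R + 2)) by ring.
apply: ler_wpM2l; first by rewrite mulr_ge0 ?sqr_ge0 // ltW.
rewrite ler_pdivlMr; last lra.
rewrite mulrC ler_pdivrMr; last by rewrite mulr_gt0; lra.
by nra.
Qed.

(** The ratio 2 beta_t D^2 / eta_t equals 8 t (t + 1) / (t + 2), below 8t. Hence n = 8t in the inner
    loop bound, and at most 16t oracle calls in iteration t. *)
Lemma scgs_search_le t : (0 < t)%N ->
  2 * (scgs_beta L t * D ^+ 2) <= (8 * t)%:R * scgs_eta L D t.
Proof.
move=> t0; have t1 : 1 <= t%:R :> R by rewrite ler1n.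
have tn0 : t%:R != 0 :> R by apply: lt0r_neq0; lra.
have tn1 : t%:R + 1 != 0 :> R by apply: lt0r_neq0; lra.
rewrite /scgs_eta /scgs_beta natrM.
have -> : 2 * (4 * L / (t%:R + 2) * D ^+ 2) = 8 * (L * D ^+ 2) * (t%:R + 2)^-1
  by ring.
have -> : 8 * t%:R * (L * D ^+ 2 / (t%:R * (t%:R + 1))) =
   8 * (L * D ^+ 2) * (t%:R + 1)^-1 by field; rewrite tn0 tn1.
apply: ler_wpM2l; first by rewrite !mulr_ge0 ?sqr_ge0 // ltW.
by rewrite lef_pV2 ?posrE; lra.
Qed.

Section run.
Variable gest : nat -> 'rV[R]_d -> 'rV[R]_d.
Local Notation run := (scgs lmo (scgs_beta L) scgs_gamma (scgs_eta L D) gest x0).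

Lemma scgs_Om t : Om (run t).1 /\ Om (run t).2.
Proof.
elim: t => //= t [IH1 IH2].
set y := icg _ _ _ _ _.
have yO : Om y.
  by apply: (icg_Om Om_conv Om_diam lmoP.2 _ IH2 (scgs_beta_gt0 _)
    (scgs_eta_gt0 _) (scgs_eta_le _) _ (scgs_search_le _)).
by split => //; apply: Om_conv => //; exact: scgs_gamma_itv.
Qed.

Lemma scgs_z_Om t : (0 < t)%N -> Om (scgs_z scgs_gamma t (run t.-1)).
Proof.
move=> t0; have [? ?] := scgs_Om t.-1.
by apply: Om_conv => //; exact: scgs_gamma_itv.
Qed.

Lemma scgs_step_opt t x : (0 < t)%N -> Om x ->
  dotp (gest t (scgs_z scgs_gamma t (run t.-1)) +
        scgs_beta L t *: ((run t).2 - (run t.-1).2)) ((run t).2 - x)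
    <= scgs_eta L D t.
Proof.
case: t => // t _ xO; have [_ yO] := scgs_Om t.
by apply: (icg_opt Om_conv Om_diam lmoP.2 _ yO (scgs_beta_gt0 _)
    (scgs_eta_gt0 _) (scgs_eta_le _) _ (scgs_search_le _)).
Qed.

Lemma scgs_lmo_calls_le n :
  (scgs_lmo_calls lmo (scgs_beta L) scgs_gamma (scgs_eta L D) gest x0 n
     <= ((16 * n * n)%N%:R)%:E)%E.
Proof.
have step t : (0 < t)%N -> (icg_calls lmo (gest t (scgs_z scgs_gamma t (run t.-1)))
    (run t.-1).2 (scgs_beta L t) (scgs_eta L D t) <= ((16 * t)%:R)%:E)%E.
  move=> t0; have [_ yO] := scgs_Om t.-1.
  have -> : (16 * t)%N = (8 * t).*2 by rewrite -muln2 mulnAC.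
  by apply: (icg_calls_le Om_conv Om_diam lmoP.2 _ yO (scgs_beta_gt0 _)
    (scgs_eta_gt0 _) (scgs_eta_le _) _ (scgs_search_le _)) => //; rewrite muln_gt0.
rewrite /scgs_lmo_calls.
apply: (@le_trans _ _ (\sum_(1 <= t < n.+1) ((16 * n)%:R)%:E)%E).
  rewrite !big_seq; apply: lee_sum => t; rewrite mem_index_iota => /andP[t0 tn].
  apply: le_trans (step _ t0) _.
  by rewrite lee_fin ler_nat leq_mul2l.
by rewrite sumEFin lee_fin sumr_const_nat subn1 /= [leRHS]natrM mulr_natr.
Qed.

End run.

Section measurable_run.
Context dW (W : measurableType dW) (gest : W -> nat -> 'rV[R]_d -> 'rV[R]_d).
Variable N : nat.
Hypothesis mgest : forall t Z, (1 <= t <= N)%N -> measurable_fun setT Z ->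
  (forall w, Om (Z w)) -> measurable_fun setT (fun w => gest w t (Z w)).
Local Notation run w :=
  (scgs lmo (scgs_beta L) scgs_gamma (scgs_eta L D) (gest w) x0).

(** [W] is an arbitrary measurable space: it is taken both as the sample space and as the sample
    space with the sigma-algebra of the past. Measurability of [gest] is asked only at points of
    [Om], where the gradients exist. *)
Lemma measurable_scgs t : (t <= N)%N ->
  measurable_fun setT (fun w => (run w t).1) /\
  measurable_fun setT (fun w => (run w t).2).
Proof.
elim: t => [|t IH] tN /=; first by split; exact: measurable_cst.
have [m1 m2] := IH (ltnW tN).
have mz : measurable_fun setT (fun w => scgs_z scgs_gamma t.+1 (run w t)).
  by apply: measurable_rVD; exact: measurable_rVZ.
have my : measurable_fun setT (fun w =>
    icg lmo (gest w t.+1 (scgs_z scgs_gamma t.+1 (run w t))) (run w t).2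
      (scgs_beta L t.+1) (scgs_eta L D t.+1)).
  apply: (measurable_icg Om_conv Om_diam lmoP) => //.
  - by apply: mgest => // w; exact: (scgs_z_Om (gest w) (ltn0Sn t)).
  - exact: scgs_beta_gt0.
  - exact: scgs_eta_gt0.
  - exact: scgs_eta_le.
  - by move=> w; have [] := scgs_Om (gest w) t.
by split => //; apply: measurable_rVD; exact: measurable_rVZ.
Qed.

Lemma measurable_scgs_z t : (1 <= t <= N)%N ->
  measurable_fun setT (fun w => scgs_z scgs_gamma t (run w t.-1)).
Proof.
move=> /andP[t0 tN]; have [m1 m2] := measurable_scgs (leq_trans (leq_pred t) tN).
by apply: measurable_rVD; exact: measurable_rVZ.
Qed.

End measurable_run.

End sliding_theory.

(** * Convexity, gradients and the quadratic upper bound *)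

Section convexity.
Context {R : realType} {d : nat}.
Implicit Types (x y : 'rV[R]_d) (a : R).

Lemma convex_set_comb (Om : set 'rV[R]_d) : convex_set Om ->
  forall x y a, Om x -> Om y -> 0 <= a <= 1 -> Om ((1 - a) *: x + a *: y).
Proof.
move=> cOm x y a Ox Oy /andP[a0 a1].
have := cOm y x (Itv01 a0 a1) (mem_set Oy) (mem_set Ox).
by move/set_mem; rewrite addrC.
Qed.

Lemma convex_function_comb (f : 'rV[R]_d -> R) : convex_function setT f ->
  forall x y a, 0 <= a <= 1 ->
  f ((1 - a) *: x + a *: y) <= (1 - a) * f x + a * f y.
Proof.
move=> cf x y a /andP[a0 a1].
have := cf (Itv01 a0 a1) y x (mem_set I) (mem_set I).
by rewrite [X in f X <= _]addrC [leRHS]addrC.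
Qed.

End convexity.

Section gradient.
Context {R : realType} {d : nat}.
Implicit Types (f : 'rV[R]_d -> R) (x y v : 'rV[R]_d).

Lemma derive_grad f x v : differentiable (f : _ -> R^o) x ->
  'D_v (f : _ -> R^o) x = dotp (grad f x) v.
Proof.
move=> df; rewrite deriveE // [in LHS](row_sum_delta v) linear_sum.
by apply: eq_bigr => i _; rewrite linearZ /= mxE -deriveE // mulrC.
Qed.

Lemma is_derive_line f x v s : differentiable (f : _ -> R^o) (x + s *: v) ->
  is_derive s 1 (fun t => f (x + t *: v) : R^o) (dotp (grad f (x + s *: v)) v).
Proof.
move=> df.
have E : (fun h : R => h^-1 *: ((fun t => f (x + t *: v) : R^o) (h *: 1 + s) -
      (f (x + s *: v) : R^o))) =
   (fun h : R => h^-1 *: ((f : _ -> R^o) (h *: v + (x + s *: v)) - f (x + s *: v))).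
  apply/funext => h; congr (_ *: (f _ - _)).
  by rewrite scalerDl /= [h *: 1]mulr1 addrCA.
apply: DeriveDef.
  by rewrite /derivable E; exact: diff_derivable.
by rewrite /derive E -derive_grad.
Qed.

(** A limit along a sequence, not along a filter on the reals: it passes inequalities to the limit
    and also shows that gradients are measurable. *)
Lemma grad_quotient_cvg f x v : differentiable (f : _ -> R^o) x ->
  (fun n : nat => n.+1%:R * (f (x + n.+1%:R^-1 *: v) - f x)) @ \oo -->
    dotp (grad f x) v.
Proof.
move=> df; rewrite -derive_grad //.
have /cvgr_dnbhsP := diff_derivable (v := v) df.
move=> /(_ (fun n => n.+1%:R^-1)) h.
rewrite (_ : (fun n : nat => _) = (fun n : nat => (n.+1%:R^-1)^-1 *:
    (((f : _ -> R^o) \o shift x) (n.+1%:R^-1 *: v) - f x))).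
  by apply: h; split => [n|]; [rewrite invr_eq0|exact: cvg_harmonic].
by apply/funext => n; rewrite invrK /= [_ *: v + x]addrC.
Qed.

(** By convexity every difference quotient towards y is at most f y - f x. *)
Lemma convex_grad_le f x y : convex_function setT f ->
  differentiable (f : _ -> R^o) x -> f x + dotp (grad f x) (y - x) <= f y.
Proof.
move=> cf df; rewrite -lerBrDl.
apply: (cvgr_to_le (grad_quotient_cvg (v := y - x) df)).
apply: nearW => n /=.
have n0 : 0 < n.+1%:R :> R by [].
have := convex_function_comb cf x y (a := n.+1%:R^-1).
rewrite invr_ge0 ltW //= invf_le1 // ler1n => /(_ isT).
have -> : (1 - n.+1%:R^-1) *: x + n.+1%:R^-1 *: y = x + n.+1%:R^-1 *: (y - x).
  by rewrite scalerBl scale1r scalerBr addrA addrAC.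
by move=> h; rewrite -ler_pdivlMl //; move: n.+1%:R^-1 h => t h; lra.
Qed.

(** Mean value theorem for [psi], the restriction of f to the segment minus its linear and quadratic
    terms; the Lipschitz bound makes the derivative of [psi] nonpositive. The assumptions concern
    the segment alone, so the lemma applies inside [Om] as well as on the whole space. *)
Lemma smooth_taylor f x y L :
  (forall s : R, 0 <= s <= 1 -> differentiable (f : _ -> R^o) (x + s *: (y - x))) ->
  (forall s : R, 0 <= s <= 1 ->
     enorm (grad f (x + s *: (y - x)) - grad f x) <= L * enorm (s *: (y - x))) ->
  f y <= f x + dotp (grad f x) (y - x) + L / 2 * dotp (y - x) (y - x).
Proof.
move=> df Lf; set v := y - x.
pose a := dotp (grad f x) v; pose c := L * dotp v v.
pose psi s : R := f (x + s *: v) - (a * s + c / 2 * (s * s)).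
pose dpsi s : R := dotp (grad f (x + s *: v)) v - (a + c * s).
have dpsiP (s : R) : 0 <= s <= 1 -> is_derive s 1 (psi : R -> R^o) (dpsi s).
  move=> s01; have id1 := is_derive_id s (1 : R^o).
  have := is_deriveB (is_derive_line (df _ s01))
    (is_deriveD (is_deriveZ a id1) (is_deriveZ (c / 2) (is_deriveM id1 id1))).
  move/is_derive_eq; apply; rewrite /dpsi; congr (_ - _).
  by rewrite /GRing.scale /=; field.
have [s s01 E] : exists2 s, s \in `[0, 1]%R & psi 1 - psi 0 = dpsi s * (1 - 0).
  apply: MVT_segment => //.
    move=> s; rewrite in_itv /= => /andP[s0 s1]; apply: dpsiP.
    by rewrite !ltW.
  apply: derivable_within_continuous => s; rewrite in_itv /= => s01.
  by have [] := dpsiP _ s01.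
have {}s01 : 0 <= s <= 1 by move: s01; rewrite in_itv.
have /andP[s0 _] := s01.
have : dpsi s <= 0.
  have := cauchy_schwarz (grad f (x + s *: v) - grad f x) v.
  have := ler_wpM2r (enorm_ge0 v) (Lf _ s01).
  rewrite -/v enormZ // /dpsi /a /c -(sqr_enorm v) dotpDl dotpNl; lra.
move: E; rewrite /psi scale0r addr0 scale1r /a /c subr0 mulr1 => E.
have -> : y = x + v by rewrite /v addrC subrK.
move: E; rewrite -/v; lra.
Qed.

End gradient.

(** * Independence and noise *)

Section independence.
Context {R : realType} dW (W : measurableType dW) (P : probability W R).
Local Open Scope ereal_scope.

(** Dynkin's argument: the events X that satisfy the product formula with the fixed [Y] form a
    lambda-system. *)
Lemma indep_g_sigma (G : set (set W)) (Y : set W) : setI_closed G ->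
  G `<=` measurable -> measurable Y ->
  (forall X, G X -> P (X `&` Y) = P X * P Y) ->
  forall X, <<s G >> X -> P (X `&` Y) = P X * P Y.
Proof.
move=> GI Gm mY GY X sX.
suff : <<s G >> `<=` [set X | measurable X /\ P (X `&` Y) = P X * P Y].
  by move=> /(_ _ sX)[].
apply: lambda_system_subset => //; last by move=> B GB; split; [exact: Gm|exact: GY].
have PY := fin_num_measure P Y mY.
apply/dynkin_lambda_system; split.
- by split => //; rewrite setTI probability_setT mul1e.
- move=> B [mB PB]; split; first exact: measurableC.
  have PBf := fin_num_measure P B mB.
  rewrite probability_setC // muleBl ?fin_num_adde_defr //.
  rewrite mul1e -PB setIC -setDE measureD // ?(setIC Y B) //.
  by rewrite ltey_eq PY.
- move=> F tF Hm; have mF n : measurable (F n) by have [] := Hm n.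
  split; first exact: bigcup_measurable.
  rewrite setI_bigcupl !measure_bigcup //; last 2 first.
  + by move=> i _; exact: measurableI.
  + exact: trivIset_setIr.
  rewrite [RHS]muleC -(fineK PY) -nneseriesZl //.
  by apply: eq_eseriesr => n _; rewrite muleC fineK //; have [] := Hm n.
Qed.

Section blocks.
Variables (I : choiceType) (A : set I) (G : I -> set (set W)).
Hypothesis indG : mutual_independence P A G.
Hypothesis sigG : forall i, A i -> sigma_algebra setT (G i).
Hypothesis Gm : forall i, A i -> G i `<=` measurable.

(** The pi-system that generates the sigma-algebra of the block [J]; on it, independence of disjoint
    blocks is the product formula over a union of finite index sets. *)
Definition cylinder (J : set I) : set (set W) :=
  [set X | exists (K : {fset I}) (E : I -> set W), [/\ [set` K] `<=` J,
     (forall i, i \in K -> G i (E i)) & X = \bigcap_(i in [set` K]) E i]].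

Let GI i X Y : A i -> G i X -> G i Y -> G i (X `&` Y).
Proof.
by move=> /sigG sG; rewrite -(measurable_g_measurableTypeE sG); exact: measurableI.
Qed.

Let GT i : A i -> G i setT.
Proof. by move=> /sigG sG; rewrite -(measurable_g_measurableTypeE sG). Qed.

Lemma cylinder_setI J : J `<=` A -> setI_closed (cylinder J).
Proof.
move=> JA _ _ [K [E [KJ GE ->]]] [K' [E' [KJ' GE' ->]]].
pose F i := (if i \in K then E i else setT) `&` (if i \in K' then E' i else setT).
exists (K `|` K')%fset, F; split.
- by move=> i /=; rewrite in_fsetU => /orP[/KJ|/KJ'].
- move=> i; rewrite in_fsetU => ii.
  have Ai : A i by case/orP: ii => [/KJ|/KJ'] /JA.
  by apply: GI => //; case: ifPn => [|_]; [exact: GE|exact: GT|exact: GE'|exact: GT].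
- apply/seteqP; split => w.
    move=> [h h'] i /= _; rewrite /F.
    by split; case: ifPn => // ik; [exact: h|exact: h'].
  move=> h; split => i /= ik.
    by have := h i; rewrite /F /= in_fsetU ik => /(_ isT) [].
  by have := h i; rewrite /F /= in_fsetU ik orbT => /(_ isT) [].
Qed.

Lemma cylinder_measurable J : J `<=` A -> cylinder J `<=` measurable.
Proof.
move=> JA _ [K [E [KJ GE ->]]]; apply: fin_bigcap_measurable => // i /= ik.
by apply: Gm (GE _ ik); exact/JA/KJ.
Qed.

Lemma indep_cylinder J J' X Y : J `<=` A -> J' `<=` A -> J `&` J' = set0 ->
  cylinder J X -> cylinder J' Y -> P (X `&` Y) = P X * P Y.
Proof.
move=> JA JA' JJ [K [E [KJ GE ->]]] [K' [E' [KJ' GE' ->]]].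
have KK i : i \in K -> i \in K' -> False.
  by move=> /KJ Ji /KJ' Ji'; have : (J `&` J') i by []; rewrite JJ.
pose F i := if i \in K then E i else E' i.
have -> : \bigcap_(i in [set` K]) E i `&` \bigcap_(i in [set` K']) E' i =
    \bigcap_(i in [set` (K `|` K')%fset]) F i.
  apply/seteqP; split => w.
    move=> [h h'] i /=; rewrite in_fsetU /F.
    by case: ifPn => /= [ik _|_ ik]; [exact: h|exact: h'].
  move=> h; split => i /= ik.
    by have := h i; rewrite /F /= in_fsetU ik => /(_ isT).
  have := h i; rewrite /F /= in_fsetU ik orbT => /(_ isT).
  by case: ifPn => // /KK /(_ ik).
rewrite !indG //.
- have pKK : perm_eq (K `|` K')%fset (K ++ K').
    apply: uniq_perm => //; last by move=> i; rewrite in_fsetU mem_cat.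
    rewrite cat_uniq !fset_uniq andbT /=.
    by apply/hasPn => i ik'; apply/negP => /KK /(_ ik').
  rewrite (perm_big _ pKK) big_cat /=; congr (_ * _); apply: eq_big_seq => i ik.
    by rewrite /F ik.
  by rewrite /F; case: ifPn => // /KK /(_ ik).
- by move=> i /KJ' /JA'.
- by move=> i /KJ /JA.
- by move=> i /=; rewrite in_fsetU => /orP[/KJ /JA|/KJ' /JA'].
- move=> i; rewrite in_fsetU /F; case: ifPn => /= [/GE //|_]; exact: GE'.
Qed.

Lemma indep_blocks J J' X Y : J `<=` A -> J' `<=` A -> J `&` J' = set0 ->
  <<s \bigcup_(i in J) G i >> X -> <<s \bigcup_(i in J') G i >> Y ->
  P (X `&` Y) = P X * P Y.
Proof.
move=> JA JA' JJ.
have sub K : K `<=` A -> <<s \bigcup_(i in K) G i >> `<=` <<s cylinder K >>.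
  move=> KA; apply: sub_smallest2r; first exact: smallest_sigma_algebra.
  move=> Z [i Ki GZ].
  exists [fset i]%fset, (fun _ => Z); split.
  - by move=> j /=; rewrite in_fset1 => /eqP ->.
  - by move=> j; rewrite in_fset1 => /eqP ->.
  - apply/seteqP; split => w; first by move=> Zw j _.
    by move=> /(_ i); apply; rewrite /= in_fset1.
have mS K Z : K `<=` A -> <<s cylinder K >> Z -> measurable Z.
  move=> KA; apply: smallest_sub; first exact: sigma_algebra_measurable.
  exact: cylinder_measurable.
move=> /(sub _ JA) sX /(sub _ JA') sY.
apply: (indep_g_sigma (cylinder_setI JA) (cylinder_measurable JA)) => //.
  exact: mS sY.
move=> {sX}X cX; rewrite setIC muleC.
(* Second use of the pi-lambda argument, with the two blocks exchanged: [X] is now a cylinder, and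
   the formula is extended in [Y]. *)
apply: (indep_g_sigma (cylinder_setI JA') (cylinder_measurable JA')) => //.
  exact: cylinder_measurable cX.
by move=> Z cZ; rewrite setIC muleC; exact: (indep_cylinder JA JA' JJ).
Qed.

End blocks.

Section freezing.
Variables (G : set (set W)) (Gm : G `<=` measurable).
Context dE (E : measurableType dE) (Y : W -> E).
Hypothesis mY : measurable_fun setT Y.
Hypothesis indY : forall B A, <<s G >> B -> measurable A ->
  P (B `&` Y @^-1` A) = P B * P (Y @^-1` A).

(* Measurability of a function on WG * E says that it depends on the sample
   point only through the events of G. *)
Local Notation WG := (g_sigma_algebraType G).

Let idG : W -> WG := id.

Let midG : measurable_fun setT idG.
Proof.
move=> _ B mB; rewrite setTI; move: mB.
by apply: smallest_sub; [exact: sigma_algebra_measurable|exact: Gm].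
Qed.

Let mpair : measurable_fun setT (fun w => (idG w, Y w)).
Proof. exact: measurable_fun_pair. Qed.

Let pidG : {mfun W >-> WG} := HB.pack idG (isMeasurableFun.Build _ _ _ _ _ midG).
Let pY : {mfun W >-> E} := HB.pack Y (isMeasurableFun.Build _ _ _ _ _ mY).
Let ppair : {mfun W >-> (WG * E)%type} :=
  HB.pack (fun w => (idG w, Y w)) (isMeasurableFun.Build _ _ _ _ _ mpair).

(** Independence says that the law of the pair (past, Y) agrees with the product of the two laws on
    rectangles, hence everywhere; Tonelli then integrates [Y] out while the past stays fixed. *)
Lemma freezing_ge0 (h : WG * E -> \bar R) : measurable_fun setT h ->
  (forall x, 0 <= h x) ->
  \int[P]_w h (w, Y w) = \int[P]_w \int[P]_w' h (w, Y w').
Proof.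
move=> mh h0.
transitivity (\int[distribution P ppair]_x h x).
  by rewrite ge0_integral_distribution.
transitivity (\int[distribution P pidG \x distribution P pY]_x h x).
  apply: eq_measure_integral => S mS _; apply/esym.
  by apply: product_measure_unique => // B A mB mA; exact: indY.
rewrite fubini_tonelli1 // ge0_integral_distribution //; last 2 first.
- exact: measurable_fun_fubini_tonelli_F.
- by move=> y; exact: integral_ge0.
apply: eq_integral => w _ /=; rewrite /fubini_F ge0_integral_distribution //.
exact: measurableT_comp.
Qed.

(** Positive and negative parts are frozen separately. A zero inner mean makes their inner integrals
    equal at each [w], so the outer integrals agree, and integrability excludes that both are
    infinite. *)
Lemma freezing_eq0 (h : WG * E -> R) : measurable_fun setT h ->
  P.-integrable setT (fun w => (h (w, Y w))%:E) ->
  (forall w, \int[P]_w' (h (w, Y w'))%:E = 0) ->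
  \int[P]_w (h (w, Y w))%:E = 0.
Proof.
move=> mh ih h0.
have mh' : measurable_fun setT (EFin \o h) by exact/measurable_EFinP.
have split_int (u : W -> R) : \int[P]_w (u w)%:E =
    \int[P]_w maxe (u w)%:E 0 - \int[P]_w maxe (- (u w)%:E) 0.
  rewrite integralE; congr (_ - _); apply: eq_integral => w _.
    by rewrite funeposE.
  by rewrite funenegE.
have eq_parts : \int[P]_w maxe (h (w, Y w))%:E 0 = \int[P]_w maxe (- (h (w, Y w))%:E) 0.
  rewrite (freezing_ge0 (h := fun x => maxe (h x)%:E 0)); last 2 first.
  - by apply: measurable_maxe.
  - by move=> x; rewrite le_max lexx orbT.
  rewrite (freezing_ge0 (h := fun x => maxe (- (h x)%:E) 0)); last 2 first.
  - by apply: measurable_maxe => //; exact: measurableT_comp.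
  - by move=> x; rewrite le_max lexx orbT.
  apply: eq_integral => w _; have := h0 w; rewrite split_int.
  move: (integral _ _ _) (integral _ _ _) => [a| |] [b| |] //= ab.
  by congr EFin; apply/eqP; rewrite -subr_eq0; apply/eqP; case: ab.
have fin : \int[P]_w (h (w, Y w))%:E \is a fin_num by exact: integrable_fin_num.
move: fin; rewrite split_int eq_parts.
by case: (integral _ _ _) => [r| |] //= _; rewrite -EFinB subrr.
Qed.

End freezing.

End independence.

Section real_expectation.
Context {R : realType} dT (T : measurableType dT) (P : probability T R).
Implicit Types (X Y : T -> R) (c : R).

Definition integ X := P.-integrable setT (EFin \o X).
Definition ex X : R := \int[P]_w X w.

Lemma exE X : integ X -> (\int[P]_w (X w)%:E = (ex X)%:E)%E.
Proof. by move=> iX; rewrite /ex /Rintegral fineK // integrable_fin_num. Qed.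

Lemma integ_measurable X : integ X -> measurable_fun setT X.
Proof. by move=> iX; apply/measurable_EFinP; exact: measurable_int iX. Qed.

Lemma integ_cst c : integ (fun=> c).
Proof. exact: finite_measure_integrable_cst. Qed.

Lemma integD X Y : integ X -> integ Y -> integ (fun w => X w + Y w).
Proof. by move=> iX iY; exact: (integrableD measurableT iX iY). Qed.

Lemma integZ c X : integ X -> integ (fun w => c * X w).
Proof. by move=> iX; exact: (integrableZl measurableT c iX). Qed.

Lemma integB X Y : integ X -> integ Y -> integ (fun w => X w - Y w).
Proof. by move=> iX iY; exact: (integrableB measurableT iX iY). Qed.

Lemma eq_integ X Y : X =1 Y -> integ X -> integ Y.
Proof. by move=> /funext ->. Qed.

Lemma integ_sum I (s : seq I) (F : I -> T -> R) : (forall i, integ (F i)) ->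
  integ (fun w => \sum_(i <- s) F i w).
Proof.
move=> iF; elim: s => [|i s IH].
  by apply: eq_integ (integ_cst 0) => w; rewrite big_nil.
by apply: eq_integ (integD (iF i) IH) => w; rewrite big_cons.
Qed.

Lemma integ_dom X Y : measurable_fun setT X -> (forall w, `|X w| <= Y w) ->
  integ Y -> integ X.
Proof.
move=> mX XY iY; apply: (le_integrable measurableT _ _ iY).
  exact/measurable_EFinP.
by move=> w _ /=; rewrite lee_fin; exact: le_trans (XY w) (ler_norm _).
Qed.

Lemma integ_bounded X c : measurable_fun setT X -> (forall w, `|X w| <= c) ->
  integ X.
Proof. by move=> mX Xc; exact: integ_dom mX Xc (integ_cst c). Qed.

(** An upper bound on an extended integral already contains integrability; the moment assumptions
    enter real-valued computations in this way. *)
Lemma integ_ge0_le X c : measurable_fun setT X -> (forall w, 0 <= X w) ->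
  (\int[P]_w (X w)%:E <= c%:E)%E -> integ X /\ ex X <= c.
Proof.
move=> mX X0 Xc; have iX : integ X.
  apply/integrableP; split; first exact/measurable_EFinP.
  apply: le_lt_trans (ltry c); apply: le_trans Xc; rewrite le_eqVlt.
  apply/orP; left; apply/eqP; apply: eq_integral => w _ /=.
  by rewrite ger0_norm.
by split => //; rewrite -lee_fin -exE.
Qed.

Lemma ex_cst c : ex (fun=> c) = c.
Proof.
by apply: EFin_inj; rewrite -exE ?integral_cst //= ?probability_setT ?mule1 //; exact: integ_cst.
Qed.

Lemma exD X Y : integ X -> integ Y -> ex (fun w => X w + Y w) = ex X + ex Y.
Proof. by move=> iX iY; exact: RintegralD. Qed.

Lemma exB X Y : integ X -> integ Y -> ex (fun w => X w - Y w) = ex X - ex Y.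
Proof. by move=> iX iY; exact: RintegralB. Qed.

Lemma exZ c X : integ X -> ex (fun w => c * X w) = c * ex X.
Proof. by move=> iX; exact: RintegralZl. Qed.

Lemma eq_ex X Y : X =1 Y -> ex X = ex Y.
Proof. by move=> /funext ->. Qed.

Lemma ex_sum I (s : seq I) (F : I -> T -> R) : (forall i, integ (F i)) ->
  ex (fun w => \sum_(i <- s) F i w) = \sum_(i <- s) ex (F i).
Proof.
move=> iF; elim: s => [|i s IH].
  by rewrite big_nil -[RHS](ex_cst 0); apply: eq_ex => w; rewrite big_nil.
rewrite big_cons -IH -exD //; last exact: integ_sum.
by apply: eq_ex => w; rewrite big_cons.
Qed.

Lemma ex_le X Y : integ X -> integ Y -> (forall w, X w <= Y w) -> ex X <= ex Y.
Proof. by move=> iX iY XY; apply: le_Rintegral. Qed.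

Lemma ex_ge0 X : (forall w, 0 <= X w) -> 0 <= ex X.
Proof. by move=> X0; exact: Rintegral_ge0. Qed.

Lemma integ_mul X Y : measurable_fun setT X -> measurable_fun setT Y ->
  integ (fun w => X w ^+ 2) -> integ (fun w => Y w ^+ 2) ->
  integ (fun w => X w * Y w).
Proof.
move=> mX mY iX iY; apply: (integ_dom _ _ (integD iX iY)).
  exact: measurable_funM.
move=> w; rewrite normrM -(real_normK (num_real (X w))) -(real_normK (num_real (Y w))).
by have := sqr_ge0 (`|X w| - `|Y w|); nra.
Qed.

Lemma integ_sqr X : measurable_fun setT X -> integ (fun w => X w ^+ 2) -> integ X.
Proof.
move=> mX iX; apply: (integ_dom mX _ (integD iX (integ_cst 1))) => w.
rewrite -(real_normK (num_real (X w))).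
by have := sqr_ge0 (`|X w| - 1); have := normr_ge0 (X w); nra.
Qed.

Section vectors.
Context {d : nat}.
Implicit Types (U V : T -> 'rV[R]_d).

Lemma integ_dotp U V : measurable_fun setT U -> measurable_fun setT V ->
  integ (fun w => dotp (U w) (U w)) -> integ (fun w => dotp (V w) (V w)) ->
  integ (fun w => dotp (U w) (V w)).
Proof.
move=> mU mV iU iV; apply: (integ_dom _ _ (integD iU iV)).
  exact: measurable_dotp.
move=> w; have := dotp_ge0 (U w + V w); have := dotp_ge0 (U w - V w).
rewrite !dotpE (dotpC (V w)) ler_norml => h1 h2.
by apply/andP; split; have := dotp_ge0 (U w); have := dotp_ge0 (V w); lra.
Qed.

Lemma integ_coord U i : measurable_fun setT U ->
  integ (fun w => dotp (U w) (U w)) -> integ (fun w => U w ord0 i).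
Proof.
move=> mU iU; apply: integ_sqr; first exact: measurable_fun_coord.
apply: (integ_dom _ _ iU).
  by apply: measurable_funX; exact: measurable_fun_coord.
move=> w; rewrite ger0_norm ?sqr_ge0 // /dotp (bigD1 i) //= -expr2 lerDl.
by apply: sumr_ge0 => j _; rewrite -expr2 sqr_ge0.
Qed.

Lemma integ_dotpD U V : measurable_fun setT U -> measurable_fun setT V ->
  integ (fun w => dotp (U w) (U w)) -> integ (fun w => dotp (V w) (V w)) ->
  integ (fun w => dotp (U w + V w) (U w + V w)).
Proof.
move=> mU mV iU iV.
apply: eq_integ (integD (integD iU (integZ 2 (integ_dotp mU mV iU iV))) iV) => w.
by rewrite !dotpE (dotpC (V w) (U w)); ring.
Qed.

End vectors.

End real_expectation.

(** * Mini-batch averages of conditionally centred errors *)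

Section minibatch.
Context {R : realType} dW (W : measurableType dW) (P : probability W R).
Context {d : nat} dE (E : measurableType dE).
Variables (G : set (set W)) (b : nat) (Y : 'I_b -> W -> E).

Let GY j : set (set W) := G `|` preimage_set_system setT (Y j) measurable.

Hypothesis b_gt0 : (0 < b)%N.
Hypothesis Gm : G `<=` measurable.
Hypothesis mY : forall j, measurable_fun setT (Y j).
Hypothesis indY : forall j B A, (<<s G >> B -> measurable A ->
  P (B `&` Y j @^-1` A) = P B * P (Y j @^-1` A))%E.
Hypothesis indYY : forall j k, j != k -> forall B A, (<<s GY j >> B -> measurable A ->
  P (B `&` Y k @^-1` A) = P B * P (Y k @^-1` A))%E.

Local Notation WG := (g_sigma_algebraType G).

Variable phi : W * E -> 'rV[R]_d.
Hypothesis mphi : measurable_fun setT (phi : WG * E -> 'rV[R]_d).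
Hypothesis phi_mean : forall w j i, (\int[P]_w' (phi (w, Y j w') ord0 i)%:E = 0)%E.
Variable V : W -> R.
Hypothesis iV : integ P V.
Hypothesis phi_var : forall w j,
  (\int[P]_w' (dotp (phi (w, Y j w')) (phi (w, Y j w')))%:E <= (V w)%:E)%E.

(** [phi] is the error of one draw as a function of the past (first argument) and of the draw
    (second); [V] bounds its second moment given the past. *)
Definition batch_mean (w : W) : 'rV[R]_d :=
  b%:R^-1 *: \sum_(j < b) phi (w, Y j w).

Let id_measurable (G1 G2 : set (set W)) : G2 `<=` G1 ->
  measurable_fun setT
    ((fun w => w) : g_sigma_algebraType G1 -> g_sigma_algebraType G2).
Proof.
move=> G12 _ B mB; rewrite setTI.
by move: mB; apply: sub_smallest2r => //; exact: smallest_sigma_algebra.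
Qed.

Let idG : W -> WG := fun w => w.

Let idm : measurable_fun setT idG.
Proof.
move=> _ B mB; rewrite setTI; move: mB.
by apply: smallest_sub; [exact: sigma_algebra_measurable|exact: Gm].
Qed.

Let mphiE j : measurable_fun setT (fun w => phi (w, Y j w)).
Proof.
apply: (@measurableT_comp _ _ _ _ _ _ (phi : WG * E -> _)) => //.
exact: measurable_fun_pair.
Qed.

Let mphi1 w : measurable_fun setT (fun s => phi (w, s)).
Proof. exact: (measurableT_comp mphi (pair1_measurable (w : WG))). Qed.

Let sample_var j : integ P (fun w => dotp (phi (w, Y j w)) (phi (w, Y j w))) /\
  ex P (fun w => dotp (phi (w, Y j w)) (phi (w, Y j w))) <= ex P V.
Proof.
apply: integ_ge0_le.
- exact: measurable_dotp.
- by move=> w; exact: dotp_ge0.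
rewrite (freezing_ge0 Gm (mY j) (@indY j)
  (h := fun x => (dotp (phi x) (phi x))%:E)); last 2 first.
- by apply/measurable_EFinP; exact: measurable_dotp.
- by move=> x; rewrite lee_fin dotp_ge0.
rewrite -exE //; apply: ge0_le_integral => //.
- by move=> w _; apply: integral_ge0 => w' _; rewrite lee_fin dotp_ge0.
(* The inner integral is measurable in [w] for the past by Tonelli on [WG * W], and then for the
   sample space because the past is coarser. *)
- pose f : WG * W -> \bar R := fun x => (dotp (phi (x.1, Y j x.2)) (phi (x.1, Y j x.2)))%:E.
  have mf : measurable_fun setT f.
    have mp : measurable_fun setT (fun x : WG * W => phi (x.1, Y j x.2)).
      apply: (@measurableT_comp _ _ _ _ _ _ (phi : WG * E -> _)) => //.
      apply: measurable_fun_pair => //.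
      exact: (measurableT_comp (mY j) measurable_snd).
    by apply/measurable_EFinP; exact: measurable_dotp.
  have mF : measurable_fun setT (fubini_F P f).
    by apply: measurable_fun_fubini_tonelli_F => // x; rewrite lee_fin dotp_ge0.
  move=> _ B mB; have := mF measurableT B mB; rewrite setTI => mS.
  by have := idm measurableT mS; rewrite setTI.
- by apply: measurable_int; exact: iV.
Qed.

Let frozen_integ w j : integ P (fun w' => dotp (phi (w, Y j w')) (phi (w, Y j w'))).
Proof.
have [] // := @integ_ge0_le _ _ _ P (fun w' => dotp (phi (w, Y j w')) (phi (w, Y j w'))) (V w).
- by apply: measurable_dotp; exact: (measurableT_comp (mphi1 w) (mY j)).
- by move=> w'; exact: dotp_ge0.
Qed.

Let frozen_mean w j (v : 'rV[R]_d) :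
  (\int[P]_w' (dotp v (phi (w, Y j w')))%:E = 0)%E.
Proof.
have mp : measurable_fun setT (fun w' => phi (w, Y j w')).
  exact: (measurableT_comp (mphi1 w) (mY j)).
have ic i : integ P (fun w' => phi (w, Y j w') ord0 i).
  exact: integ_coord mp (frozen_integ w j).
rewrite exE; last by apply: integ_sum => i; exact: integZ.
rewrite ex_sum => [|i]; last exact: integZ.
rewrite big1 // => i _; rewrite exZ //.
by have := phi_mean w j i; rewrite exE // => -[] ->; rewrite mulr0.
Qed.

(** Freezing the past together with draw j turns the first factor into a constant vector, whose
    pairing with the centred error of draw k averages to zero. *)
Let cross j k : j != k ->
  ex P (fun w => dotp (phi (w, Y j w)) (phi (w, Y k w))) = 0.
Proof.
move=> jk; apply: EFin_inj; rewrite -exE; last first.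
  by apply: integ_dotp => //; exact: (sample_var _).1.
pose WGj := g_sigma_algebraType (GY j).
have GYm : GY j `<=` measurable.
  move=> B [/Gm //|[A mA <-]]; exact: mY.
pose pj : WGj -> WG := fun w => w.
have mpj : measurable_fun setT pj by apply: id_measurable => B GB; left.
have m1 : measurable_fun setT (fun x : WGj * E => pj x.1).
  exact: (measurableT_comp mpj measurable_fst).
have mp1 : measurable_fun setT (fun x : WGj * E => phi (pj x.1, x.2)).
  apply: (@measurableT_comp _ _ _ _ _ _ (phi : WG * E -> _)) => //.
  exact: measurable_fun_pair.
pose Yj : WGj -> E := Y j.
have mYj : measurable_fun setT Yj.
  by move=> _ A mA; apply: sub_sigma_algebra; right; exists A.
have mp2 : measurable_fun setT (fun x : WGj * E => phi (pj x.1, Yj x.1)).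
  apply: (@measurableT_comp _ _ _ _ _ _ (phi : WG * E -> _)) => //.
  apply: measurable_fun_pair => //.
  exact: (measurableT_comp mYj measurable_fst).
apply: (freezing_eq0 GYm (mY k) (indYY jk)
  (h := fun x => dotp (phi (pj x.1, Yj x.1)) (phi (pj x.1, x.2)))).
- exact: measurable_dotp.
- apply: (@integ_dotp _ _ _ _ _ (fun w => phi (w, Y j w))) => //.
  + exact: (mphiE k).
  + exact: (sample_var j).1.
  + exact: (sample_var k).1.
- by move=> w; exact: (frozen_mean w k (phi (w, Y j w))).
Qed.

Lemma batch_mean_measurable : measurable_fun setT batch_mean.
Proof. by apply: measurable_rVZ => //; exact: measurable_rV_sum. Qed.

Lemma batch_mean_var : integ P (fun w => dotp (batch_mean w) (batch_mean w)) /\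
  ex P (fun w => dotp (batch_mean w) (batch_mean w)) <= b%:R^-1 * ex P V.
Proof.
have ijk j k : integ P (fun w => dotp (phi (w, Y j w)) (phi (w, Y k w))).
  by apply: integ_dotp => //; exact: (sample_var _).1.
have E1 w : dotp (batch_mean w) (batch_mean w) = b%:R ^- 2 *
    \sum_(j < b) \sum_(k < b) dotp (phi (w, Y j w)) (phi (w, Y k w)).
  rewrite /batch_mean dotpZl dotpZr mulrA -expr2 exprVn; congr (_ * _).
  by rewrite dotp_suml; apply: eq_bigr => j _; rewrite dotp_sumr.
have i1 j : integ P (fun w => \sum_(k < b) dotp (phi (w, Y j w)) (phi (w, Y k w))).
  by apply: integ_sum.
have i2 := integ_sum (index_enum 'I_b) i1.
split; first exact: eq_integ (fsym E1) (integZ _ i2).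
rewrite (eq_ex P E1) exZ // ex_sum //.
under eq_bigr do rewrite ex_sum //.
have b0 : b%:R != 0 :> R by rewrite pnatr_eq0 -lt0n.
apply: (@le_trans _ _ (b%:R ^- 2 * \sum_(j < b) ex P V)); last first.
  rewrite sumr_const card_ord -mulr_natl.
  by rewrite le_eqVlt; apply/orP; left; apply/eqP; field.
rewrite ler_wpM2l ?invr_ge0 ?exprn_ge0 //; apply: ler_sum => j _.
rewrite (bigD1 j) //= big1 ?addr0; first exact: (sample_var j).2.
by move=> k kj; apply: cross; rewrite eq_sym.
Qed.

(** This removes the inner product of the error with xs - y_(t-1), a bounded function of the
    past. *)
Lemma batch_mean_orth (h : W -> 'rV[R]_d) (c : R) :
  measurable_fun setT (h : WG -> 'rV[R]_d) -> (forall w, dotp (h w) (h w) <= c) ->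
  ex P (fun w => dotp (batch_mean w) (h w)) = 0.
Proof.
move=> mh hc.
have mh' : measurable_fun setT (h : W -> _) by exact: (measurableT_comp mh idm).
have ih : integ P (fun w => dotp (h w) (h w)).
  apply: (@integ_bounded _ _ _ _ _ c); first exact: measurable_dotp.
  by move=> w; rewrite ger0_norm ?dotp_ge0.
have ij j : integ P (fun w => dotp (h w) (phi (w, Y j w))).
  by apply: integ_dotp => //; exact: (sample_var _).1.
rewrite (_ : (fun w => _) = fun w =>
    b%:R^-1 * \sum_(j < b) dotp (h w) (phi (w, Y j w))); last first.
  apply/funext => w; rewrite dotpZl dotp_suml; congr (_ * _).
  by apply: eq_bigr => j _; rewrite dotpC.
rewrite exZ; last exact: integ_sum.
rewrite ex_sum // big1 ?mulr0 // => j _.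
apply: EFin_inj; rewrite -exE //.
apply: (freezing_eq0 Gm (mY j) (@indY j)
  (h := fun x => dotp (h x.1) (phi x))).
- by apply: measurable_dotp => //; exact: (measurableT_comp mh measurable_fst).
- exact: ij.
- by move=> w; exact: (frozen_mean w j (h w)).
Qed.

End minibatch.

(** * Moments of the standard normal law *)

Section gaussian_moments.
Context {R : realType}.

(** The Radon-Nikodym derivative of the normal law agrees almost everywhere with the explicit
    density, both having the same integral over every measurable set. *)
Lemma integral_normal_prob (h : R -> \bar R) : measurable_fun setT h ->
  (forall x, 0 <= h x)%E ->
  (\int[normal_prob (0 : R) 1]_x h x =
   \int[lebesgue_measure]_x (h x * (normal_pdf 0 1 x)%:E))%E.
Proof.
move=> mh h0; set nu := normal_prob (0 : R) 1.
have dom := normal_prob_dominates (0 : R) 1.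
rewrite -(Radon_Nikodym_SigmaFinite.change_of_variables dom) //.
apply: ae_eq_integral => //.
- apply: emeasurable_funM => //.
  exact: measurable_int (Radon_Nikodym_SigmaFinite.f_integrable dom).
- apply: emeasurable_funM => //; apply/measurable_EFinP.
  exact: measurable_normal_pdf.
apply: ae_eqe_mul2l; apply: integral_ae_eq => //.
- exact: Radon_Nikodym_SigmaFinite.f_integrable.
- by apply/measurable_EFinP; exact: measurable_normal_pdf.
- by move=> A _ mA; rewrite -(Radon_Nikodym_SigmaFinite.f_integral dom).
Qed.

Lemma normal_pdf_shift (m x : R) :
  normal_pdf m 1 x = expR (m * x - m ^+ 2 / 2) * normal_pdf 0 1 x.
Proof.
rewrite !normal_pdfE ?oner_neq0 // mulrCA; congr (_ * _).
rewrite /normal_fun -expRD expr1n; congr expR; rewrite subr0.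
have -> : (1 *+ 2)^-1 = 2^-1 :> R by [].
by field.
Qed.

Lemma normal_pdf_scale (s x : R) : 0 < s ->
  normal_pdf 0 s x = s^-1 * expR ((1 - s ^- 2) / 2 * x ^+ 2) * normal_pdf 0 1 x.
Proof.
move=> s0; have sn0 : s != 0 by exact: lt0r_neq0.
rewrite !normal_pdfE ?oner_neq0 //.
have -> : normal_peak s = s^-1 * normal_peak 1.
  rewrite /normal_peak expr1n mul1r -mulrnAr sqrtrM ?sqr_ge0 // sqrtr_sqr.
  by rewrite ger0_norm ?invfM // ltW.
have -> : normal_fun 0 s x = expR ((1 - s ^- 2) / 2 * x ^+ 2) * normal_fun 0 1 x.
  rewrite /normal_fun -expRD subr0 expr1n; congr expR.
  rewrite -mulr_natl -[1 *+ 2]mulr_natl.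
  by field.
by ring.
Qed.

Lemma expR_ge_cubic (y : R) : 0 <= y -> 1 + y + y ^+ 2 / 2 + y ^+ 3 / 6 <= expR y.
Proof.
move=> y0; have h : series (exp_coeff y) 4 <= expR y.
  apply: nondecreasing_cvgn_le; last exact: is_cvg_series_exp_coeff.
  by apply: nondecreasing_series => n _ _; exact: exp_coeff_ge0.
apply: le_trans h; rewrite /series /= !big_nat_recr //= big_nil /exp_coeff /=.
rewrite le_eqVlt; apply/orP; left; apply/eqP.
have -> : 3`! = 6%N by []. have -> : 2`! = 2%N by [].
by rewrite /factorial /=; field.
Qed.

(* All moments come from E exp(m X - m^2/2) = 1 and E exp((1 - s^-2)/2 X^2) = s:
   the exact ones by letting m and s vary in exp x >= 1 + x, the bounds on the
   fourth and sixth ones by a cubic lower bound of exp at a single s. *)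
Section standard_normal.
Context dT (T : measurableType dT) (P : probability T R) (X : T -> R).
Hypothesis mX : measurable_fun setT X.
Hypothesis lawX : forall A, measurable A -> P (X @^-1` A) = normal_prob 0 1 A.

Let integral_law (h : R -> R) : measurable_fun setT h -> (forall x, 0 <= h x) ->
  (\int[P]_w (h (X w))%:E =
   \int[lebesgue_measure]_x ((h x) * (normal_pdf 0 1 x))%:E)%E.
Proof.
move=> mh h0; have mh' : measurable_fun setT (EFin \o h) by exact/measurable_EFinP.
have := @integral_normal_prob (EFin \o h) mh'.
rewrite /= => <- //.
pose X' : T -> measurableTypeR R := X.
have mX' : measurable_fun setT X' by exact: mX.
pose pX : {mfun T >-> measurableTypeR R} :=
  HB.pack X' (isMeasurableFun.Build _ _ _ _ _ mX').
transitivity (\int[distribution P pX]_x (EFin \o h) x)%E.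
  by rewrite ge0_integral_distribution // => x; rewrite lee_fin.
by apply: eq_measure_integral => A mA _; exact: lawX.
Qed.

Let exp_shift m : integ P (fun w => expR (m * X w - m ^+ 2 / 2)) /\
  ex P (fun w => expR (m * X w - m ^+ 2 / 2)) = 1.
Proof.
have mh : measurable_fun setT (fun x : R => expR (m * x - m ^+ 2 / 2)).
  by apply: measurableT_comp => //; apply: measurable_funB => //; exact: measurable_funM.
have E : (\int[P]_w (expR (m * X w - m ^+ 2 / 2))%:E = 1)%E.
  rewrite (integral_law mh) => [|x]; last exact: expR_ge0.
  under eq_integral do rewrite -normal_pdf_shift.
  exact: integral_normal_pdf.
have [i _] : integ P (fun w => expR (m * X w - m ^+ 2 / 2)) /\
    ex P (fun w => expR (m * X w - m ^+ 2 / 2)) <= 1.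
  apply: integ_ge0_le; last by rewrite E.
    exact: (measurableT_comp mh mX).
  by move=> w; exact: expR_ge0.
by split => //; apply: EFin_inj; rewrite -exE.
Qed.

Let exp_scale s : 0 < s ->
  integ P (fun w => expR ((1 - s ^- 2) / 2 * X w ^+ 2)) /\
  ex P (fun w => expR ((1 - s ^- 2) / 2 * X w ^+ 2)) = s.
Proof.
move=> s0; set c := (1 - s ^- 2) / 2.
have mh : measurable_fun setT (fun x : R => expR (c * x ^+ 2)).
  by apply: measurableT_comp => //; apply: measurable_funM => //; exact: measurable_funX.
have mhX : measurable_fun setT (fun w => expR (c * X w ^+ 2)).
  exact: (measurableT_comp mh mX).
have si0 : 0 <= s^-1 by rewrite invr_ge0 ltW.
have E : (\int[P]_w (s^-1 * expR (c * X w ^+ 2))%:E = 1)%E.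
  have mh1 : measurable_fun setT (fun x : R => s^-1 * expR (c * x ^+ 2)).
    exact: measurable_funM.
  rewrite (integral_law mh1) => [|x]; last by rewrite mulr_ge0 // expR_ge0.
  under eq_integral do rewrite -normal_pdf_scale //.
  exact: integral_normal_pdf.
have [i _] : integ P (fun w => s^-1 * expR (c * X w ^+ 2)) /\
    ex P (fun w => s^-1 * expR (c * X w ^+ 2)) <= 1.
  apply: integ_ge0_le; last by rewrite E.
    exact: measurable_funM.
  by move=> w; rewrite mulr_ge0 // expR_ge0.
have i' : integ P (fun w => expR (c * X w ^+ 2)).
  by apply: eq_integ (integZ s i) => w; rewrite mulrA divff ?mul1r // lt0r_neq0.
split => //; have : ex P (fun w => s^-1 * expR (c * X w ^+ 2)) = 1.
  by apply: EFin_inj; rewrite -exE.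
by rewrite exZ // => /(congr1 ( *%R s)); rewrite mulrA divff ?mul1r ?mulr1 // lt0r_neq0.
Qed.

Lemma std_normal_sqr : integ P (fun w => X w ^+ 2) /\ ex P (fun w => X w ^+ 2) = 1.
Proof.
have iX : integ P (fun w => X w ^+ 2).
  (* At s = 2 the exponent is 3/8 X^2, and exp y >= 1 + y gives the domination X^2 <= 8/3 exp(3/8
     X^2). *)
  have s0 : 0 < 2 :> R by [].
  have [i _] := exp_scale s0.
  apply: (integ_dom _ _ (integZ (8 / 3) i)); first exact: measurable_funX.
  move=> w; rewrite ger0_norm ?sqr_ge0 //.
  have := expR_ge1Dx ((1 - 2 ^- 2) / 2 * X w ^+ 2).
  set e := expR _; move: e (X w ^+ 2) => e q; lra.
split => //.
have bound s : 0 < s -> 1 + (1 - s ^- 2) / 2 * ex P (fun w => X w ^+ 2) <= s.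
  move=> s0; have [i E] := exp_scale s0.
  rewrite -[leRHS]E -[X in X + _](ex_cst P) -exZ // -exD; last 2 first.
  - exact: integ_cst.
  - exact: integZ.
  apply: ex_le => //; first by apply: integD (integ_cst _ _) (integZ _ _).
  by move=> w; exact: expR_ge1Dx.
have m0 : 0 <= ex P (fun w => X w ^+ 2) by apply: ex_ge0 => w; exact: sqr_ge0.
move: (ex P _) m0 bound => m m0 bound.
have {}bound s : 0 < s -> (s - 1) * ((s + 1) * m - 2 * s ^+ 2) <= 0.
  move=> s0; have := bound _ s0.
  rewrite -lerBrDl -(ler_pM2r (_ : 0 < 2 * s ^+ 2)); last pos.
  have -> : (1 - s ^- 2) / 2 * m * (2 * s ^+ 2) = (s ^+ 2 - 1) * m.
    by field; exact: lt0r_neq0.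
  lra.
apply/eqP; rewrite eq_le; apply/andP; split; rewrite leNgt; apply/negP => m1.
  (* A small multiple of m - 1, below 1: at s = 1 + e the factor (s + 1) m - 2 s^2 is still
     positive. *)
  pose e := (m - 1) / (6 + (m - 1)).
  have d0 : 0 < 6 + (m - 1) by lra.
  have eE : e * (6 + (m - 1)) = m - 1 by rewrite /e divfK // lt0r_neq0.
  have e0 : 0 < e by rewrite /e divr_gt0 //; lra.
  have s0 : 0 < 1 + e by lra.
  have := bound _ s0.
  have -> : 1 + e - 1 = e by ring.
  rewrite pmulr_rle0 // => h.
  have e1 : e < 1 by rewrite /e ltr_pdivrMr //; lra.
  have ee : e * e <= e by rewrite ler_piMl // ltW.
  have em : 0 <= e * (m - 1) by rewrite mulr_ge0 // ?subr_ge0 ltW.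
  by nra.
(* Below 1 the sign of s - 1 flips and the same factor is negative; m >= 0 keeps s positive. *)
have s0 : 0 < 1 - (1 - m) / 4 by lra.
have := bound _ s0.
have -> : 1 - (1 - m) / 4 - 1 = - ((1 - m) / 4) by ring.
rewrite mulNr oppr_le0 pmulr_rge0 ?divr_gt0 ?subr_gt0 // => h.
by nra.
Qed.

Lemma std_normal_mean : integ P X /\ ex P X = 0.
Proof.
have iX : integ P X by exact: integ_sqr (std_normal_sqr.1).
split => //; have bound m : m * ex P X <= m ^+ 2 / 2.
  have [i E] := exp_shift m.
  have i1 : integ P (fun w => m * X w - m ^+ 2 / 2).
    by apply: integB; [exact: integZ|exact: integ_cst].
  have : ex P (fun w => 1 + (m * X w - m ^+ 2 / 2)) <= 1.
    rewrite -[leRHS]E; apply: ex_le => //; first exact: integD (integ_cst _ _) i1.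
    by move=> w; exact: expR_ge1Dx.
  have iZ : integ P (fun w => m * X w) by exact: integZ.
  have iC c : integ P (fun=> c) by exact: integ_cst.
  rewrite exD // exB // exZ // !ex_cst; lra.
(* Taking m = E X gives (E X)^2 <= (E X)^2 / 2. *)
have := bound (ex P X); rewrite -expr2 => h.
by apply/eqP; rewrite -sqrf_eq0 eq_le sqr_ge0 andbT; lra.
Qed.

Lemma std_normal_pow6 :
  integ P (fun w => X w ^+ 6) /\ ex P (fun w => X w ^+ 6) <= 64.
Proof.
(* With s = 3/2 the exponent is 5/18 X^2 and the remainder 3/2 - 1 - 5/18 = 2/9 yields about 62.2.
   The exact moment is 15; 64 is what the constant 16 of the smoothing bias allows. *)
have s0 : 0 < 3 / 2 :> R by [].
have [i E] := exp_scale s0.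
have sE : (1 - (3 / 2) ^- 2) / 2 = 5 / 18 :> R by field.
rewrite sE in i E.
have iX2 := std_normal_sqr.
have i1 : integ P (fun=> 1) by exact: integ_cst.
have iZ : integ P (fun w => 5 / 18 * X w ^+ 2) by exact: integZ iX2.1.
have pt w : (5 / 18) ^+ 3 / 6 * X w ^+ 6 <=
    expR (5 / 18 * X w ^+ 2) - (1 + 5 / 18 * X w ^+ 2).
  have q0 := sqr_ge0 (X w).
  have := expR_ge_cubic (y := 5 / 18 * X w ^+ 2).
  rewrite mulr_ge0 // => /(_ isT).
  have -> : X w ^+ 6 = (X w ^+ 2) ^+ 3 by rewrite -exprM.
  set e := expR _; move: e (X w ^+ 2) q0 => e q q0 h.
  rewrite -subr_ge0; rewrite -subr_ge0 in h.
  have -> : e - (1 + 5 / 18 * q) - (5 / 18) ^+ 3 / 6 * q ^+ 3 =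
     e - (1 + 5 / 18 * q + (5 / 18 * q) ^+ 2 / 2 + (5 / 18 * q) ^+ 3 / 6) +
     (5 / 18) ^+ 2 / 2 * q ^+ 2 by field.
  by rewrite addr_ge0 // mulr_ge0 // sqr_ge0.
have iR : integ P (fun w => expR (5 / 18 * X w ^+ 2) - (1 + 5 / 18 * X w ^+ 2)).
  by apply: integB => //; exact: integD.
have i6 : integ P (fun w => (5 / 18) ^+ 3 / 6 * X w ^+ 6).
  apply: (integ_dom _ _ iR).
    by apply: measurable_funM => //; exact: measurable_funX.
  by move=> w; rewrite ger0_norm // mulr_ge0 // exprn_even_ge0.
have i6' : integ P (fun w => X w ^+ 6).
  apply: eq_integ (integZ (6 / (5 / 18) ^+ 3) i6) => w; field.
  by [].
split => //.
have := ex_le i6 iR pt; rewrite exZ // exB //; last exact: integD.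
rewrite exD // exZ; last exact: iX2.1.
rewrite ex_cst E iX2.2.
have -> : (5 / 18) ^+ 3 = 125 / 5832 :> R by field.
lra.
Qed.

Lemma std_normal_pow4 :
  integ P (fun w => X w ^+ 4) /\ ex P (fun w => X w ^+ 4) <= 5.
Proof.
(* With s = 5/4 the exponent is 9/50 X^2 and the bound is about 4.33. The exact moment is 3; the
   value 5 is what leads to d - 1 + 5 = d + 4. *)
have s0 : 0 < 5 / 4 :> R by [].
have [i E] := exp_scale s0.
have sE : (1 - (5 / 4) ^- 2) / 2 = 9 / 50 :> R by field.
rewrite sE in i E.
have iX2 := std_normal_sqr.
have i1 : integ P (fun=> 1) by exact: integ_cst.
have iZ : integ P (fun w => 9 / 50 * X w ^+ 2) by exact: integZ iX2.1.
have pt w : (9 / 50) ^+ 2 / 2 * X w ^+ 4 <=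
    expR (9 / 50 * X w ^+ 2) - (1 + 9 / 50 * X w ^+ 2).
  have q0 := sqr_ge0 (X w).
  have := expR_ge_cubic (y := 9 / 50 * X w ^+ 2).
  rewrite mulr_ge0 // => /(_ isT).
  have -> : X w ^+ 4 = (X w ^+ 2) ^+ 2 by rewrite -exprM.
  set e := expR _; move: e (X w ^+ 2) q0 => e q q0 h.
  rewrite -subr_ge0; rewrite -subr_ge0 in h.
  have -> : e - (1 + 9 / 50 * q) - (9 / 50) ^+ 2 / 2 * q ^+ 2 =
     e - (1 + 9 / 50 * q + (9 / 50 * q) ^+ 2 / 2 + (9 / 50 * q) ^+ 3 / 6) +
     (9 / 50) ^+ 3 / 6 * q ^+ 3 by field.
  by rewrite addr_ge0 // mulr_ge0 // exprn_ge0.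
have iR : integ P (fun w => expR (9 / 50 * X w ^+ 2) - (1 + 9 / 50 * X w ^+ 2)).
  by apply: integB => //; exact: integD.
have i4 : integ P (fun w => (9 / 50) ^+ 2 / 2 * X w ^+ 4).
  apply: (integ_dom _ _ iR).
    by apply: measurable_funM => //; exact: measurable_funX.
  by move=> w; rewrite ger0_norm // mulr_ge0 // exprn_even_ge0.
have i4' : integ P (fun w => X w ^+ 4).
  apply: eq_integ (integZ (2 / (9 / 50) ^+ 2) i4) => w; field.
  by [].
split => //.
have := ex_le i4 iR pt; rewrite exZ // exB //; last exact: integD.
rewrite exD // exZ; last exact: iX2.1.
rewrite ex_cst E iX2.2.
by have -> : (9 / 50) ^+ 2 = 81 / 2500 :> R by [field]; lra.
Qed.

End standard_normal.
End gaussian_moments.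

Section independent_products.
Context {R : realType} dW (W : measurableType dW) (P : probability W R).

Lemma sigma_rv_sigma_algebra dX (X : measurableType dX) (f : W -> X) :
  sigma_algebra setT (sigma_rv f).
Proof. exact/sigma_algebra_preimage/sigma_algebra_measurable. Qed.

Lemma sigma_rv_measurable dX (X : measurableType dX) (f : W -> X) :
  measurable_fun setT f -> sigma_rv f `<=` measurable.
Proof. by move=> mf _ [A mA <-]; exact: mf. Qed.

Lemma sigma_rv_preimage dX (X : measurableType dX) (f : W -> X) A :
  measurable A -> sigma_rv f (f @^-1` A).
Proof. by move=> mA; exists A => //; rewrite setTI. Qed.

Definition indep_of (G : set (set W)) dE (E : measurableType dE) (Y : W -> E) :=
  forall B A, (<<s G >> B -> measurable A ->
    P (B `&` Y @^-1` A) = P B * P (Y @^-1` A))%E.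

Lemma indep_of_family (I : choiceType) (A : set I) (G : I -> set (set W))
    (J J' : set I) dE (E : measurableType dE) (Y : W -> E) :
  mutual_independence P A G ->
  (forall i, A i -> sigma_algebra setT (G i)) ->
  (forall i, A i -> G i `<=` measurable) ->
  J `<=` A -> J' `<=` A -> J `&` J' = set0 ->
  measurable_fun setT (Y : g_sigma_algebraType (\bigcup_(i in J') G i) -> E) ->
  indep_of (\bigcup_(i in J) G i) Y.
Proof.
move=> ind sG Gm JA JA' JJ mY B C sB mC.
apply: (indep_blocks ind sG Gm JA JA' JJ) => //.
by rewrite -[X in <<s _ >> X]setTI; exact: mY.
Qed.

Lemma indep_prod (G : set (set W)) (X : W -> R) dE (E : measurableType dE)
    (U : W -> E) (psi : E -> R) : G `<=` measurable ->
  measurable_fun setT (X : g_sigma_algebraType G -> R) ->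
  measurable_fun setT U -> measurable_fun setT psi -> indep_of G U ->
  integ P X -> integ P (psi \o U) ->
  integ P (fun w => X w * psi (U w)) /\
  ex P (fun w => X w * psi (U w)) = ex P X * ex P (psi \o U).
Proof.
move=> Gm mX mU mpsi ind iX iU.
pose X' : g_sigma_algebraType G -> R := X.
have mX' : measurable_fun setT X' by exact: mX.
have mp : measurable_fun setT (fun x : g_sigma_algebraType G * E => X' x.1 * psi x.2).
  apply: measurable_funM; first exact: (measurableT_comp mX' measurable_fst).
  exact: (measurableT_comp mpsi measurable_snd).
have mXW := integ_measurable iX.
have mUW := integ_measurable iU.
have iXU : integ P (fun w => X w * psi (U w)).
  apply/integrableP; split; first by apply/measurable_EFinP; exact: measurable_funM.
  have -> : (\int[P]_w `|(EFin \o (fun w => (X w * psi (U w))%R)) w| =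
      \int[P]_w (fun x : g_sigma_algebraType G * E => (`|X' x.1 * psi x.2|%R)%:E) (w, U w))%E.
    by [].
  rewrite (freezing_ge0 Gm mU ind (h := fun x => (`|X' x.1 * psi x.2|)%:E)) //; last first.
    by apply/measurable_EFinP; exact: measurableT_comp.
  have iaX : integ P (fun w => `|X w|).
    by have := integrable_norm iX.
  have iaU : integ P (fun w => `|psi (U w)|).
    by have := integrable_norm iU.
  have -> : (\int[P]_w \int[P]_w' (`|X' w * psi (U w')|%R)%:E =
      \int[P]_w (ex P (fun w' => `|psi (U w')|%R) * `|X w|%R)%:E)%E.
    apply: eq_integral => w _.
    under eq_integral do rewrite normrM.
    by rewrite exE ?exZ 1?mulrC //; exact: integZ.
  by rewrite exE ?ltry //; exact: integZ.
split => //.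
set c := ex P (psi \o U).
have iXc : integ P (fun w => X w * c).
  by apply: eq_integ (integZ c iX) => w; rewrite mulrC.
suff : ex P (fun w => X w * (psi (U w) - c)) = 0.
  rewrite (_ : (fun w => _) = fun w => X w * psi (U w) - X w * c); last first.
    by apply/funext => w; rewrite mulrBr.
  rewrite exB // => /eqP; rewrite subr_eq0 => /eqP ->.
  rewrite (_ : (fun w => X w * c) = fun w => c * X w); last first.
    by apply/funext => w; rewrite mulrC.
  by rewrite exZ // mulrC.
have i0 : integ P (fun w => X w * (psi (U w) - c)).
  by apply: eq_integ (integB iXU iXc) => w; rewrite mulrBr.
apply: EFin_inj; rewrite -exE //.
apply: (freezing_eq0 Gm mU ind (h := fun x => X' x.1 * (psi x.2 - c))).
- apply: measurable_funM; first exact: (measurableT_comp mX' measurable_fst).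
  by apply: measurable_funB => //; exact: (measurableT_comp mpsi measurable_snd).
- exact: i0.
- move=> w /=.
  have ic : integ P (fun w' => psi (U w') - c) by exact: integB iU (integ_cst _ _).
  rewrite exE; last exact: integZ.
  by rewrite exZ // exB ?ex_cst ?subrr ?mulr0 //; exact: integ_cst.
Qed.

End independent_products.

(** Power mean inequality: expand the cube into triples and apply the arithmetic-geometric mean
    inequality to each. It reduces E|u|^6 to sixth moments of coordinates. *)
Lemma sum_cube_le {R : realType} n (a : 'I_n -> R) : (forall i, 0 <= a i) ->
  (\sum_i a i) ^+ 3 <= n%:R ^+ 2 * \sum_i a i ^+ 3.
Proof.
move=> a0.
have amgm i j k : a i * a j * a k <= (a i ^+ 3 + a j ^+ 3 + a k ^+ 3) / 3.
  move: (a0 i) (a0 j) (a0 k); move: (a i) (a j) (a k) => x y z x0 y0 z0.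
  rewrite -subr_ge0.
  have -> : (x ^+ 3 + y ^+ 3 + z ^+ 3) / 3 - x * y * z =
    (x + y + z) * ((x - y) ^+ 2 + (y - z) ^+ 2 + (x - z) ^+ 2) / 6 by field.
  by rewrite divr_ge0 // mulr_ge0 ?addr_ge0 ?sqr_ge0.
have -> : (\sum_i a i) ^+ 3 = \sum_i \sum_j \sum_k a i * a j * a k.
  rewrite exprS expr2 mulr_suml; apply: eq_bigr => i _.
  rewrite mulrA [a i * _]mulr_sumr mulr_suml; apply: eq_bigr => j _.
  by rewrite mulr_sumr.
apply: (@le_trans _ _
    (\sum_i \sum_j \sum_k (a i ^+ 3 + a j ^+ 3 + a k ^+ 3) / 3)).
  by do 3!apply: ler_sum => ? _.
set S := \sum_i a i ^+ 3.
have E3 i j : \sum_k (a i ^+ 3 + a j ^+ 3 + a k ^+ 3) / 3 =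
   (n%:R * a i ^+ 3 + n%:R * a j ^+ 3 + S) / 3.
  rewrite -mulr_suml !big_split /= !sumr_const card_ord.
  by rewrite -(mulr_natl (a i ^+ 3)) -(mulr_natl (a j ^+ 3)).
have SE c : \sum_i c * a i ^+ 3 = c * S by rewrite mulr_sumr.
have cst c : \sum_(i < n) c = n%:R * c by rewrite sumr_const card_ord mulr_natl.
have E2 i : \sum_j \sum_k (a i ^+ 3 + a j ^+ 3 + a k ^+ 3) / 3 =
   (n%:R ^+ 2 * a i ^+ 3 + n%:R * S + n%:R * S) / 3.
  under eq_bigr do rewrite E3.
  by rewrite -mulr_suml !big_split /= SE !cst; ring.
under eq_bigr do rewrite E2.
by rewrite -mulr_suml !big_split /= SE !cst le_eqVlt; apply/orP; left; apply/eqP; field.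
Qed.

Section gaussian_vector.
Context {R : realType} dW (W : measurableType dW) (P : probability W R).
Context {d : nat} (u : {RV P >-> 'rV[R]_d}).
Hypothesis gu : std_gaussian u.

Local Notation U i := (fun w => u w ord0 i).

Let mU i : measurable_fun setT (U i).
Proof. exact: measurable_fun_coord. Qed.

Let G i : set (set W) := sigma_rv (U i).

Let indU i : indep_of P (\bigcup_(j in [set j | j != i]) G j) (U i).
Proof.
apply: (indep_of_family (J' := [set i]) gu.2) => //.
- by move=> j _; exact: sigma_rv_sigma_algebra.
- by move=> j _; exact: sigma_rv_measurable.
- by apply/seteqP; split => j // [/= /eqP].
- move=> _ A mA; apply: sub_sigma_algebra; exists i => //.
  by rewrite setTI; exact: sigma_rv_preimage.
Qed.

Let GU i : \bigcup_(j in [set j | j != i]) G j `<=` measurable.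
Proof. by move=> B [j _]; exact: sigma_rv_measurable. Qed.

Let mUG i j : j != i ->
  measurable_fun setT (U j : g_sigma_algebraType (\bigcup_(k in [set k | k != i]) G k) -> R).
Proof.
move=> ji _ A mA; apply: sub_sigma_algebra; exists j => //.
by rewrite setTI; exact: sigma_rv_preimage.
Qed.

Let mean i := std_normal_mean (mU i) (gu.1 i).
Let sqr i := std_normal_sqr (mU i) (gu.1 i).
Let pow4 i := std_normal_pow4 (mU i) (gu.1 i).
Let pow6 i := std_normal_pow6 (mU i) (gu.1 i).

Lemma gaussian_pow6 : integ P (fun w => dotp (u w) (u w) ^+ 3) /\
  ex P (fun w => dotp (u w) (u w) ^+ 3) <= 64 * d%:R ^+ 3.
Proof.
have pt w : dotp (u w) (u w) ^+ 3 <= d%:R ^+ 2 * \sum_i U i w ^+ 6.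
  have -> : \sum_i U i w ^+ 6 = \sum_i (U i w * U i w) ^+ 3.
    by apply: eq_bigr => i _; rewrite -expr2 -exprM.
  by apply: sum_cube_le => i; rewrite -expr2 sqr_ge0.
have iS : integ P (fun w => \sum_i U i w ^+ 6) by apply: integ_sum => i; exact: (pow6 i).1.
have iL : integ P (fun w => dotp (u w) (u w) ^+ 3).
  apply: (integ_dom _ _ (integZ (d%:R ^+ 2) iS)).
    by apply: measurable_funX; exact: measurable_dotp.
  by move=> w; rewrite ger0_norm // exprn_ge0 // dotp_ge0.
split => //; apply: le_trans (ex_le iL (integZ _ iS) pt) _.
rewrite exZ // ex_sum => [|i]; last exact: (pow6 i).1.
have -> : 64 * d%:R ^+ 3 = d%:R ^+ 2 * (\sum_(i < d) 64) :> R.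
  by rewrite sumr_const card_ord -mulr_natl; ring.
by rewrite ler_wpM2l ?sqr_ge0 //; apply: ler_sum => i _; exact: (pow6 i).2.
Qed.

Lemma gaussian_cov i k : integ P (fun w => U i w * U k w) /\
  ex P (fun w => U i w * U k w) = (i == k)%:R.
Proof.
have [<-|ik] := eqVneq i k.
  have [] := sqr i; under eq_fun do rewrite expr2; by [].
have := indep_prod (@GU k) (mUG ik) (mU k) (@measurable_id _ _ _) (@indU k)
  (mean i).1 (mean k).1.
by move=> [? ->]; split => //; rewrite (mean i).2 mul0r.
Qed.

Let q w := dotp (u w) (u w).

Let mq : measurable_fun setT q.
Proof. exact: measurable_dotp. Qed.

Let iq2 : integ P (fun w => q w ^+ 2).
Proof.
apply: (integ_dom _ _ (integD gaussian_pow6.1 (integ_cst P 1))).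
  exact: measurable_funX.
move=> w; rewrite ger0_norm ?sqr_ge0 //.
have : 0 <= q w by exact: dotp_ge0.
rewrite -/(q w); move: (q w) => x x0.
have [x1|/ltW x1] := lerP x 1.
  by rewrite ler_wpDl ?exprn_ge0 // exprn_ile1.
by rewrite ler_wpDr // [leRHS]exprS ler_peMl ?sqr_ge0.
Qed.

Let sq_le j w : U j w ^+ 2 <= q w.
Proof.
rewrite /q /dotp (bigD1 j) //= -expr2 lerDl.
by apply: sumr_ge0 => l _; rewrite -expr2 sqr_ge0.
Qed.

Let mul_le i k w : `|U i w * U k w| <= q w.
Proof.
have := sq_le i w; have := sq_le k w; rewrite ler_norml.
have := sqr_ge0 (U i w - U k w); have := sqr_ge0 (U i w + U k w).
by rewrite sqrrB sqrrD => *; apply/andP; split; lra.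
Qed.

Let iUUq i k : integ P (fun w => U i w * U k w * q w).
Proof.
apply: (integ_dom _ _ iq2).
  by apply: measurable_funM => //; exact: measurable_funM.
move=> w; have q0 : 0 <= q w by exact: dotp_ge0.
by rewrite normrM (ger0_norm q0) expr2 ler_wpM2r.
Qed.

Let iUUU i k l : integ P (fun w => U i w * U k w * U l w ^+ 2).
Proof.
apply: (integ_dom _ _ iq2).
  by apply: measurable_funM => //; [exact: measurable_funM|exact: measurable_funX].
move=> w; rewrite normrM [in leRHS]expr2 ler_pM //.
by rewrite ger0_norm ?sqr_ge0.
Qed.

Let qE i k : (fun w => U i w * U k w * q w) =
  (fun w => \sum_l U i w * U k w * U l w ^+ 2).
Proof.
apply/funext => w; rewrite /q /dotp mulr_sumr.
by apply: eq_bigr => l _; rewrite expr2.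
Qed.

Let iUU2 k l : integ P (fun w => U k w * U l w ^+ 2).
Proof.
apply: integ_mul => //; first exact: measurable_funX.
  exact: (sqr k).1.
by apply: eq_integ (pow4 l).1 => w; rewrite -exprM.
Qed.

Let offdiag i k l : i != k -> l != i -> ex P (fun w => U k w * U l w ^+ 2 * U i w) = 0.
Proof.
move=> ik li; have mX : measurable_fun setT
  ((fun w => U k w * U l w ^+ 2) :
    g_sigma_algebraType (\bigcup_(j in [set j | j != i]) G j) -> R).
  apply: measurable_funM; first by apply: mUG; rewrite eq_sym.
  by apply: measurable_funX; exact: mUG.
have [_ ->] := indep_prod (@GU i) mX (mU i) (@measurable_id _ _ _) (@indU i)
  (iUU2 k l) (mean i).1.
by rewrite (mean i).2 mulr0.
Qed.

(** In U_i U_k U_l^2 with i != k, at least one of the coordinates i, k differs from l. It occurs to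
    the first power and is independent of the other factors, so the mean vanishes. *)
Lemma gaussian_wcov i k : integ P (fun w => U i w * U k w * q w) /\
  (i != k -> ex P (fun w => U i w * U k w * q w) = 0).
Proof.
split => // ik; rewrite qE ex_sum // big1 // => l _.
have [->|li] := eqVneq l i.
  rewrite -(@offdiag k i i) 1?eq_sym // ; last by rewrite eq_sym.
  by apply: eq_ex => w /=; ring.
by rewrite -(@offdiag i k l) //; apply: eq_ex => w /=; ring.
Qed.

(** The d - 1 indices l != i contribute 1 each, and l = i contributes the fourth moment, at most
    5. *)
Lemma gaussian_wvar i : ex P (fun w => U i w * U i w * q w) <= d%:R + 4.
Proof.
rewrite qE ex_sum //.
have term l : ex P (fun w => U i w * U i w * U l w ^+ 2) <= 1 + 4 * (l == i)%:R.
  have [->|li] := eqVneq l i.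
    have -> : 1 + 4 * true%:R = 5 :> R by rewrite /=; ring.
    apply: le_trans (pow4 i).2; rewrite le_eqVlt; apply/orP; left; apply/eqP.
    by apply: eq_ex => w /=; ring.
  have mX : measurable_fun setT ((fun w => U l w ^+ 2) :
      g_sigma_algebraType (\bigcup_(j in [set j | j != i]) G j) -> R).
    by apply: measurable_funX; exact: mUG.
  have mpsi : measurable_fun setT (fun x : R => x ^+ 2) by exact: measurable_funX.
  have [_ E] := indep_prod (@GU i) mX (mU i) mpsi (@indU i) (sqr l).1 (sqr i).1.
  rewrite mulr0 addr0 -[leRHS](mulr1 1) -[X in _ <= X * _](sqr l).2.
  rewrite -[X in _ <= _ * X](sqr i).2 -E le_eqVlt; apply/orP; left; apply/eqP.
  by apply: eq_ex => w /=; ring.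
apply: le_trans (ler_sum _ (fun l _ => term l)) _.
rewrite big_split /= sumr_const card_ord -mulr_sumr (bigD1 i) //= eqxx big1.
  by rewrite addr0 mulr1.
by move=> l /negbTE ->.
Qed.

Section random_direction.
Variables (H : set (set W)) (g : W -> 'rV[R]_d) (m : 'rV[R]_d).
Hypothesis Hm : H `<=` measurable.
Hypothesis mgH : forall i, measurable_fun setT
  ((fun w => g w ord0 i) : g_sigma_algebraType H -> R).
Hypothesis indHu : indep_of P H u.
Hypothesis ig : integ P (fun w => dotp (g w) (g w)).
Hypothesis gm : forall i, ex P (fun w => g w ord0 i) = m ord0 i.

Let mg : measurable_fun setT g.
Proof.
apply: measurable_fun_rV => i _ A mA; rewrite setTI.
have := @mgH i measurableT _ mA; rewrite setTI.
by apply: smallest_sub; [exact: sigma_algebra_measurable|exact: Hm].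
Qed.

Let mgg k l : measurable_fun setT
  ((fun w => g w ord0 k * g w ord0 l) : g_sigma_algebraType H -> R).
Proof. by apply: measurable_funM; exact: (@mgH _). Qed.

Let igk k : integ P (fun w => g w ord0 k).
Proof. exact: integ_coord. Qed.

Let igg k l : integ P (fun w => g w ord0 k * g w ord0 l).
Proof.
have isq j : integ P (fun w => g w ord0 j ^+ 2).
  apply: (integ_dom _ _ ig).
    by apply: measurable_funX; exact: measurable_fun_coord.
  move=> w; rewrite ger0_norm ?sqr_ge0 // /dotp (bigD1 j) //= -expr2 lerDl.
  by apply: sumr_ge0 => i _; rewrite -expr2 sqr_ge0.
by apply: integ_mul => //; exact: measurable_fun_coord.
Qed.

(** Error of the estimator obtained from the finite difference as the smoothing parameter tends to
    0; it is centred because E u u^T is the identity. *)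
Definition directional_error w : 'rV[R]_d := dotp (g w) (u w) *: u w - m.

Let coordE w i : directional_error w ord0 i =
  \sum_k g w ord0 k * (U k w * U i w) - m ord0 i.
Proof.
rewrite !mxE /dotp mulr_suml; congr (_ - _).
by apply: eq_bigr => k _; rewrite mulrA.
Qed.

Let mpsi k l : measurable_fun setT (fun v : 'rV[R]_d => v ord0 k * v ord0 l).
Proof. by apply: measurable_funM; exact: measurable_coord. Qed.

Let gUU k i : integ P (fun w => g w ord0 k * (U k w * U i w)) /\
  ex P (fun w => g w ord0 k * (U k w * U i w)) = m ord0 k * (k == i)%:R.
Proof.
have [c1 c2] := gaussian_cov k i.
have := indep_prod Hm (@mgH k) (measurable_funP u) (mpsi k i) indHu (igk k) c1.
by rewrite gm => -[? ->]; split => //; congr (_ * _).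
Qed.

Lemma directional_error_mean i :
  ex P (fun w => directional_error w ord0 i) = 0.
Proof.
rewrite (eq_ex P (fun w => coordE w i)) exB ?ex_cst ?ex_sum //.
- rewrite (bigD1 i) //= (gUU i i).2 eqxx mulr1 big1 ?addr0 ?subrr //.
  by move=> k ki; rewrite (gUU k i).2 (negbTE ki) mulr0.
- by move=> k; exact: (gUU k i).1.
- by apply: integ_sum => k; exact: (gUU k i).1.
- exact: integ_cst.
Qed.

Let gUUq k l : integ P (fun w => g w ord0 k * g w ord0 l * (U k w * U l w * q w)) /\
  ex P (fun w => g w ord0 k * g w ord0 l * (U k w * U l w * q w)) =
  ex P (fun w => g w ord0 k * g w ord0 l) * ex P (fun w => U k w * U l w * q w).
Proof.
have mpsi2 : measurable_fun setT
    (fun v : 'rV[R]_d => v ord0 k * v ord0 l * dotp v v).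
  by apply: measurable_funM => //; exact: measurable_dotp.
exact: (indep_prod Hm (@mgg k l) (measurable_funP u) mpsi2 indHu (igg k l) (iUUq k l)).
Qed.

Lemma directional_error_var :
  integ P (fun w => dotp (directional_error w) (directional_error w)) /\
  ex P (fun w => dotp (directional_error w) (directional_error w)) <=
    (d%:R + 4) * ex P (fun w => dotp (g w) (g w)).
Proof.
(* [A] is |<g,u> u|^2 and [B] is <g,u><u,m>, expanded so that every term is a function of g times a
   function of u. Since E B = |m|^2, centring only lowers the second moment, and in E A just the
   diagonal survives. *)
pose A w := \sum_k \sum_l g w ord0 k * g w ord0 l * (U k w * U l w * q w).
pose B w := \sum_i m ord0 i * (\sum_k g w ord0 k * (U k w * U i w)).
have AE w : dotp (g w) (u w) ^+ 2 * q w = A w.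
  rewrite /A; move: (q w) => c.
  rewrite expr2 /dotp mulr_suml mulr_suml; apply: eq_bigr => k _.
  by rewrite mulr_sumr mulr_suml; apply: eq_bigr => l _; ring.
have BE w : dotp (g w) (u w) * dotp (u w) m = B w.
  rewrite /B /dotp mulr_sumr; apply: eq_bigr => i _.
  rewrite mulr_suml mulr_sumr; apply: eq_bigr => k _; ring.
have E w : dotp (directional_error w) (directional_error w) =
    A w - 2 * B w + dotp m m.
  by rewrite -AE -BE /directional_error !dotpE (dotpC m (u w)) /q; ring.
have iA : integ P A.
  by apply: integ_sum => k; apply: integ_sum => l; exact: (gUUq k l).1.
have iBi i : integ P (fun w => \sum_k g w ord0 k * (U k w * U i w)).
  by apply: integ_sum => k; exact: (gUU k i).1.
have iB : integ P B by apply: integ_sum => i; exact: integZ.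
have i2B : integ P (fun w => 2 * B w) by exact: integZ.
have iAB : integ P (fun w => A w - 2 * B w) by exact: integB.
split; first by apply: eq_integ (integD iAB (integ_cst P (dotp m m))) => w; rewrite E.
rewrite (eq_ex P E) exD ?exB ?exZ ?ex_cst //; last exact: integ_cst.
have -> : ex P B = dotp m m.
  rewrite ex_sum => [|i]; last exact: integZ.
  apply: eq_bigr => i _; rewrite exZ // ex_sum => [|k]; last exact: (gUU k i).1.
  rewrite (bigD1 i) //= (gUU i i).2 eqxx mulr1 big1 ?addr0 //.
  by move=> k ki; rewrite (gUU k i).2 (negbTE ki) mulr0.
apply: (@le_trans _ _ (ex P A)).
  have := dotp_ge0 m; lra.
rewrite ex_sum => [|k]; last by apply: integ_sum => l; exact: (gUUq k l).1.
have -> : ex P (fun w => dotp (g w) (g w)) =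
    \sum_k ex P (fun w => g w ord0 k * g w ord0 k) by rewrite -ex_sum.
rewrite mulr_sumr; apply: ler_sum => k _.
rewrite ex_sum => [|l]; last exact: (gUUq k l).1.
rewrite (bigD1 k) //= big1 ?addr0 => [|l lk]; last first.
  by rewrite (gUUq k l).2 (gaussian_wcov k l).2 ?mulr0 // eq_sym.
rewrite (gUUq k k).2 mulrC ler_wpM2r //; first by apply: ex_ge0 => w; rewrite -expr2 sqr_ge0.
exact: gaussian_wvar.
Qed.

End random_direction.

End gaussian_vector.

(** * Convergence rate *)

Section sliding_analysis.
Context {R : realType} {d : nat}.
Variables (Om : set 'rV[R]_d) (lmo : 'rV[R]_d -> 'rV[R]_d) (L D : R).
Hypotheses (L_gt0 : 0 < L) (D_gt0 : 0 < D).
Hypothesis Om_conv :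
  forall x y (a : R), Om x -> Om y -> 0 <= a <= 1 -> Om ((1 - a) *: x + a *: y).
Hypothesis Om_diam : forall x y, Om x -> Om y -> dotp (x - y) (x - y) <= D ^+ 2.
Hypothesis lmoP : is_lmo Om lmo.
Variables (x0 xs : 'rV[R]_d) (f : 'rV[R]_d -> R).
Hypotheses (x0_Om : Om x0) (xs_Om : Om xs).
Hypothesis f_conv : convex_function setT f.
Hypothesis f_diff : forall x, Om x -> differentiable (f : _ -> R^o) x.
Hypothesis f_smooth : forall x y, Om x -> Om y ->
  enorm (grad f x - grad f y) <= L * enorm (x - y).
Hypothesis f_min : forall x, Om x -> f xs <= f x.

Lemma descent x y : Om x -> Om y ->
  f y <= f x + dotp (grad f x) (y - x) + L / 2 * dotp (y - x) (y - x).
Proof.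
move=> Ox Oy; have seg (s : R) : 0 <= s <= 1 -> Om (x + s *: (y - x)).
  move=> s01; have -> : x + s *: (y - x) = (1 - s) *: x + s *: y.
    by rewrite scalerBl scale1r scalerBr addrA addrAC.
  exact: Om_conv.
apply: smooth_taylor => s s01; first exact/f_diff/seg.
apply: le_trans (f_smooth (seg _ s01) Ox) _.
by rewrite addrC addKr.
Qed.

Lemma gap_le_grad x : Om x ->
  f x - f xs <= dotp (grad f xs) (x - xs) + L * D ^+ 2 / 2.
Proof.
move=> Ox; have := descent xs_Om Ox.
have : L / 2 * dotp (x - xs) (x - xs) <= L / 2 * D ^+ 2.
  by apply: ler_wpM2l; [rewrite divr_ge0 // ltW|exact: Om_diam].
lra.
Qed.

Lemma gap_le_norm x : Om x ->
  f x - f xs <= enorm (grad f xs) * D + L * D ^+ 2 / 2.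
Proof.
move=> Ox; apply: le_trans (gap_le_grad Ox) _; rewrite lerD2r.
apply: le_trans (cauchy_schwarz _ _) _; apply: ler_wpM2l; first exact: enorm_ge0.
by rewrite (enorm_le_dotp _ (ltW D_gt0)); exact: Om_diam.
Qed.

Section one_run.
Variables (gest : nat -> 'rV[R]_d -> 'rV[R]_d) (t : nat).
Hypothesis t_gt0 : (0 < t)%N.
Local Notation run := (scgs lmo (scgs_beta L) scgs_gamma (scgs_eta L D) gest x0).
Local Notation x' := (run t.-1).1.
Local Notation y' := (run t.-1).2.
Local Notation x := (run t).1.
Local Notation y := (run t).2.
Local Notation z := (scgs_z scgs_gamma t (run t.-1)).
Local Notation gamma := (scgs_gamma t : R).
Local Notation beta := (scgs_beta L t).
Local Notation eta := (scgs_eta L D t).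
Local Notation delta := (gest t z - grad f z).

Let x_Om : Om x. Proof. exact: (scgs_Om L_gt0 D_gt0 Om_conv Om_diam lmoP x0_Om gest _).1. Qed.
Let y_Om : Om y. Proof. exact: (scgs_Om L_gt0 D_gt0 Om_conv Om_diam lmoP x0_Om gest _).2. Qed.
Let z_Om : Om z. Proof. exact: (scgs_z_Om L_gt0 D_gt0 Om_conv Om_diam lmoP x0_Om). Qed.

Let xE : x = (1 - gamma) *: x' + gamma *: y.
Proof. by case: t t_gt0 => // k _. Qed.

Let zE : z = (1 - gamma) *: x' + gamma *: y'.
Proof. by []. Qed.

Let gamma01 : 0 <= gamma <= 1.
Proof. exact: scgs_gamma_itv. Qed.

Let gamma0 : 0 <= gamma. Proof. by case/andP: gamma01. Qed.
Let gamma1 : gamma <= 1. Proof. by case/andP: gamma01. Qed.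

Let step_opt := scgs_step_opt L_gt0 D_gt0 Om_conv Om_diam lmoP x0_Om gest t_gt0 xs_Om.

Lemma scgs_z_gap : f z - f xs <= (1 - gamma) * (f x' - f xs) + gamma * (f y' - f xs).
Proof.
by rewrite zE; have := convex_function_comb f_conv x' y' gamma01; lra.
Qed.

(* Three-point form of the optimality of y at the accuracy eta. *)
Let prox_ineq : dotp (gest t z) (y - xs) <=
  eta + beta / 2 * (dotp (y' - xs) (y' - xs) - dotp (y - xs) (y - xs)
                    - dotp (y - y') (y - y')).
Proof.
move: step_opt; rewrite dotpDl.
have -> : dotp (beta *: (y - y')) (y - xs) = - (beta / 2 *
   (dotp (y' - xs) (y' - xs) - dotp (y - xs) (y - xs) - dotp (y - y') (y - y'))).
  move: (run t).2 (run t.-1).2 => u v.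
  by rewrite !dotpE ?(dotpC v u) ?(dotpC xs u) ?(dotpC xs v); field.
lra.
Qed.

Lemma scgs_step_gap : f x - f xs <= (1 - gamma) * (f x' - f xs)
  + gamma * (eta + beta / 2 * (dotp (y' - xs) (y' - xs) - dotp (y - xs) (y - xs))
             + dotp delta (xs - y'))
  + 3 / (2 * L) * dotp delta delta.
Proof.
have t0 : 0 <= t%:R :> R by [].
have t2 : 0 < t%:R + 2 :> R by rewrite ltr_wpDl.
have h1 := descent z_Om x_Om.
have xz : x - z = gamma *: (y - y').
  by rewrite xE zE opprD addrACA subrr add0r -scalerBr.
have h2 : f z + dotp (grad f z) (x - z) <=
    (1 - gamma) * f x' + gamma * (f z + dotp (grad f z) (y - z)).
  have : f z + dotp (grad f z) (x' - z) <= f x'.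
    exact: convex_grad_le f_conv (f_diff z_Om).
  have g1 : 0 <= 1 - gamma by rewrite subr_ge0.
  move=> /(ler_wpM2l g1).
  have -> : x - z = (1 - gamma) *: (x' - z) + gamma *: (y - z).
    rewrite xE; move: (scgs_z _ _ _) (run t.-1).1 (run t).2 => a b c.
    by apply/rowP => i; rewrite !mxE; ring.
  rewrite !dotpE; lra.
have h3 : f z + dotp (grad f z) (xs - z) <= f xs.
  exact: convex_grad_le f_conv (f_diff z_Om).
have h4 := prox_ineq.
(* Of beta_t/2 |y - y'|^2, the smoothness term uses L gamma_t/2 |y - y'|^2; what remains is half of
   L/(t+2) times |y - y'|^2, exactly the Young term for the weight L/(t+2). Multiplied by gamma_t,
   the other term becomes 3/(2L) |delta|^2. *)
have young : dotp delta (y' - y) <= dotp delta delta / (2 * (L / (t%:R + 2))) +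
    L / (t%:R + 2) / 2 * dotp (y' - y) (y' - y).
  by apply: dotp_young; rewrite divr_gt0.
have sqE : dotp (y' - y) (y' - y) = dotp (y - y') (y - y').
  by rewrite -opprB dotpNl dotpNr opprK.
(* [y] depends on the current draws, so the error paired with it does not average out. Only the
   pairing at [y'], known from the past, is kept; the remainder goes to Young. *)
have split_delta : dotp (grad f z) (y - z) =
   dotp (grad f z) (xs - z) + dotp (gest t z) (y - xs) + dotp delta (xs - y')
   + dotp delta (y' - y).
  move: (scgs_z _ _ _) (run t).2 (run t.-1).2 => a b c.
  by rewrite !dotpE; ring.
set w := dotp (y - y') (y - y') in sqE h4 young *.
rewrite xz !dotpZr dotpZl -/w in h1.
rewrite xz dotpZr in h2.
rewrite sqE in young.
have key : gamma * (f z + dotp (grad f z) (y - z)) + L / 2 * (gamma * (gamma * w)) <=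
   gamma * (f xs + eta + beta / 2 * (dotp (y' - xs) (y' - xs) - dotp (y - xs) (y - xs))
      + dotp delta (xs - y')) + 3 / (2 * L) * dotp delta delta.
  have -> : 3 / (2 * L) * dotp delta delta = gamma *
     (dotp delta delta / (2 * (L / (t%:R + 2)))).
    rewrite /scgs_gamma; field.
    by rewrite ?(lt0r_neq0 t2) ?(lt0r_neq0 L_gt0).
  rewrite mulrCA -!mulrDr; apply: ler_wpM2l => //.
  have -> : L / 2 * (gamma * w) = beta / 2 * w - L / (t%:R + 2) / 2 * w.
    by rewrite /scgs_gamma /scgs_beta; field; exact: lt0r_neq0.
  rewrite split_delta; lra.
lra.
Qed.

(** Replacing grad f xs by grad f z costs at most L D times D; the rest is the optimality of y, with
    Young weight beta_t so that |y - y'|^2 cancels. Together with [gap_le_grad] this bounds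
    gap(y_t). *)
Lemma scgs_y_slope : dotp (grad f xs) (y - xs) <= L * D ^+ 2 + eta
  + beta / 2 * (dotp (y' - xs) (y' - xs) - dotp (y - xs) (y - xs))
  + dotp delta (xs - y') + dotp delta delta / (2 * beta).
Proof.
have b0 := scgs_beta_gt0 L_gt0 t.
have h1 : dotp (grad f xs - grad f z) (y - xs) <= L * D ^+ 2.
  apply: le_trans (cauchy_schwarz _ _) _.
  have eD u v : Om u -> Om v -> enorm (u - v) <= D.
    by move=> Ou Ov; rewrite (enorm_le_dotp _ (ltW D_gt0)); exact: Om_diam.
  rewrite expr2 mulrA; apply: ler_pM; rewrite ?enorm_ge0 ?eD //.
  apply: le_trans (f_smooth xs_Om z_Om) _.
  by apply: ler_wpM2l; [exact: ltW|exact: eD].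
have h2 := prox_ineq.
have young := dotp_young delta (y' - y) b0.
have sqE : dotp (y' - y) (y' - y) = dotp (y - y') (y - y').
  by rewrite -opprB dotpNl dotpNr opprK.
have split_delta : dotp (grad f xs) (y - xs) =
   dotp (grad f xs - grad f z) (y - xs) + dotp (gest t z) (y - xs)
   + dotp delta (xs - y') + dotp delta (y' - y).
  move: (scgs_z _ _ _) (run t).2 (run t.-1).2 => a b c.
  by rewrite !dotpE; ring.
rewrite split_delta; rewrite sqE in young; lra.
Qed.

End one_run.

End sliding_analysis.

(** * The deterministic recursion behind the rate *)

Section recursion.
Context {R : realType}.
(* phi, q and zeta stand for the expected gaps at x_t, y_t and z_t, r for the
   expected squared distance of y_t to the minimizer, n1 and n2 for the bias and
   the second moment of the gradient error. *)
Variables (L D A : R) (N : nat) (phi r q n1 n2 zeta : nat -> R) (om1 om2 kappa : R).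
Hypothesis L_gt0 : 0 < L.
Hypothesis r_itv : forall t, (t <= N)%N -> 0 <= r t <= D ^+ 2.
Hypothesis step : forall t, (t < N)%N ->
  phi t.+1 <= (1 - scgs_gamma t.+1) * phi t
  + scgs_gamma t.+1 * (scgs_eta L D t.+1
       + scgs_beta L t.+1 / 2 * (r t - r t.+1) + n1 t.+1)
  + 3 / (2 * L) * n2 t.+1.
Hypothesis n1_le : forall t, (t < N)%N -> n1 t.+1 <= om1.
Hypothesis n2_le : forall t, (t < N)%N ->
  n2 t.+1 <= 2 * L / (3 * (t.+1%:R * (t.+1%:R + 1))) * zeta t.+1 + om2.
Hypothesis zeta_le : forall t, (t < N)%N ->
  zeta t.+1 <= (1 - scgs_gamma t.+1) * phi t + scgs_gamma t.+1 * q t.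
Hypothesis kappa_ge : forall t, (t < N)%N ->
  3 * ((t%:R + 1) * (t%:R + 2)) * om1
  + 3 / (2 * L) * ((t%:R + 1) * (t%:R + 2) * (t%:R + 3)) * om2 <= kappa.
Hypothesis A_ge0 : 0 <= A.
Hypothesis q0_le : 3 * L * D ^+ 2 + 3 * q 0 + kappa <= A.
Hypothesis q_le : forall t, (t < N)%N -> (0 < t)%N ->
  15 / 4 * L * D ^+ 2 + 3 * q t + kappa <= 5 / 6 * A.

(** Up to the factor 6L, this is t (t+1) (t+2) gamma_t beta_t / 2, the weight of the squared
    distance. It is nondecreasing, so its increments against r_t <= D^2 sum to at most D^2 c(t). *)
Let c (s : R) := s * (s + 1) / (s + 2).

(** Multiplying step t+1 by (t+1)(t+2)(t+3) turns 1 - gamma into t (t+1) (t+2), the eta term into 3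
    L D^2, the bias terms into at most kappa, and the variance term into (t+3) zeta <= t phi_t + 3
    q_t. All of this except the telescoping terms must fit into [A]. *)
Let potential t : (t <= N)%N ->
  t%:R * (t%:R + 1) * (t%:R + 2) * phi t + 6 * L * c t%:R * r t <=
  6 * L * D ^+ 2 * c t%:R + A * t%:R.
Proof.
elim: t => [|t IH] tN; first by rewrite /c !(mul0r, mulr0, add0r).
have {}IH := IH (ltnW tN).
have s0 : 0 <= t%:R :> R by [].
have sS : t.+1%:R = t%:R + 1 :> R by rewrite -addn1 natrD.
(* The induction hypothesis bounds t phi_t by 3/4 L D^2 + A/6, the maxima of 6 t/(t+2)^2 and of
   t/((t+1)(t+2)). Hence 15/4 = 3 + 3/4 and 5/6 = 1 - 1/6 in the hypothesis on q_t. *)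
have bracket : t%:R * phi t + 3 * L * D ^+ 2 + 3 * q t + kappa <= A.
  have [->|t0] := posnP t; first by rewrite mul0r add0r.
  have := q_le tN t0.
  suff : t%:R * phi t <= 3 / 4 * L * D ^+ 2 + A / 6 by lra.
  have t1 : 1 <= t%:R :> R by rewrite ler1n.
  have w0 : 0 < (t%:R + 1) * (t%:R + 2) :> R by rewrite mulr_gt0; lra.
  rewrite -(ler_pM2r w0).
  have /andP[rt0 _] := r_itv (ltnW tN).
  have c0 : 0 <= c t%:R by rewrite /c divr_ge0 ?mulr_ge0 //; lra.
  have rc0 : 0 <= 6 * L * c t%:R * r t by rewrite !mulr_ge0 // ltW.
  have -> : t%:R * phi t * ((t%:R + 1) * (t%:R + 2)) =
    t%:R * (t%:R + 1) * (t%:R + 2) * phi t by ring.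
  have cle : 6 * L * D ^+ 2 * c t%:R <=
      3 / 4 * L * D ^+ 2 * ((t%:R + 1) * (t%:R + 2)).
    have -> : 6 * L * D ^+ 2 * c t%:R = 3 / 4 * L * D ^+ 2 * (8 * c t%:R) by field.
    apply: ler_wpM2l; first nonneg.
    rewrite /c mulrA ler_pdivrMr; last lra.
    have := sqr_ge0 (t%:R - 2 : R); nra.
  have Ale : A * t%:R <= A / 6 * ((t%:R + 1) * (t%:R + 2)).
    have -> : A / 6 * ((t%:R + 1) * (t%:R + 2)) =
      A * (((t%:R + 1) * (t%:R + 2)) / 6) by ring.
    apply: ler_wpM2l => //.
    (* 6t <= (t+1)(t+2) means (t-1)(t-2) >= 0, false strictly between 1 and 2; integrality of t is
       used here. *)
    have [->|t2] := eqVneq t 1%N; first by lra.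
    have : 2 <= t%:R :> R by rewrite ler_nat ltn_neqAle eq_sym t2.
    nra.
  lra.
have w0 : 0 < (t%:R + 1) * (t%:R + 2) * (t%:R + 3) :> R.
  by rewrite !mulr_gt0 //; lra.
have rec : (t%:R + 1) * (t%:R + 2) * (t%:R + 3) * phi t.+1 <=
    t%:R * (t%:R + 1) * (t%:R + 2) * phi t + t%:R * phi t + 3 * L * D ^+ 2 + 3 * q t
    + 6 * L * c (t%:R + 1) * (r t - r t.+1) + kappa.
  have n0 : forall k, 0 < t%:R + k.+1%:R :> R by move=> k; rewrite ltr_wpDl.
  have t1 := lt0r_neq0 (n0 0%N); have t2 := lt0r_neq0 (n0 1%N).
  have t3 := lt0r_neq0 (n0 2%N); have L0 := lt0r_neq0 L_gt0.
  have g0 : 0 <= scgs_gamma t.+1 :> R by case/andP: (@scgs_gamma_itv R _ (ltn0Sn t)).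
  have L3 : 0 <= 3 / (2 * L) by nonneg.
  have k0 : 0 <= 2 * L / (3 * (t.+1%:R * (t.+1%:R + 1))) by nonneg.
  have h1 := ler_wpM2l g0 (n1_le tN).
  have h2 := ler_wpM2l L3 (n2_le tN).
  have h3 := ler_wpM2l L3 (ler_wpM2l k0 (zeta_le tN)).
  have h4 := step tN.
  have h5 : phi t.+1 <= (1 - scgs_gamma t.+1) * phi t
    + scgs_gamma t.+1 * (scgs_eta L D t.+1 + scgs_beta L t.+1 / 2 * (r t - r t.+1))
    + scgs_gamma t.+1 * om1
    + 3 / (2 * L) * (2 * L / (3 * (t.+1%:R * (t.+1%:R + 1))) *
       ((1 - scgs_gamma t.+1) * phi t + scgs_gamma t.+1 * q t))
    + 3 / (2 * L) * om2.
    move: h1 h2 h3 h4; move: (scgs_gamma _) (scgs_eta _ _ _) (scgs_beta _ _) (3 / (2 * L)) (2 * L / _).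
    by move=> g e b u v; lra.
  move: (ler_wpM2l (ltW w0) h5); rewrite /scgs_gamma /scgs_eta /scgs_beta sS.
  have := kappa_ge tN; set K1 := 3 * _ * om1 + _.
  set rhs := (X in _ -> _ * phi t.+1 <= X -> _) => hK.
  suff -> : rhs = t%:R * (t%:R + 1) * (t%:R + 2) * phi t + t%:R * phi t
    + 3 * L * D ^+ 2 + 3 * q t + 6 * L * c (t%:R + 1) * (r t - r t.+1) + K1 by lra.
  rewrite /rhs /K1 /c.
  have t2' : t%:R + 1 + 1 != 0 :> R by rewrite -addrA.
  have t3' : t%:R + 1 + 2 != 0 :> R by rewrite -addrA [1 + 2](_ : _ = 3%:R) //; ring.
  field.
  by rewrite ?t1 ?t2 ?t3 ?L0 ?t2' ?t3'.
rewrite sS.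
have -> : t%:R + 1 + 1 = t%:R + 2 :> R by ring.
have -> : t%:R + 1 + 2 = t%:R + 3 :> R by ring.
have cmono : c t%:R <= c (t%:R + 1).
  rewrite /c ler_pdivrMr; last lra.
  rewrite mulrAC ler_pdivlMr; last lra.
  nra.
have /andP[rt0 rt1] := r_itv (ltnW tN).
have : 6 * L * (c (t%:R + 1) - c t%:R) * r t <= 6 * L * (c (t%:R + 1) - c t%:R) * D ^+ 2.
  by apply: ler_wpM2l => //; rewrite !mulr_ge0 ?subr_ge0 // ltW.
lra.
Qed.

Lemma sliding_rate t : (1 <= t <= N)%N ->
  phi t <= 6 * L * D ^+ 2 / (t%:R + 2) ^+ 2 + A / ((t%:R + 1) * (t%:R + 2)).
Proof.
move=> /andP[t0 tN]; have t1 : 1 <= t%:R :> R by rewrite ler1n.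
have w0 : 0 < t%:R * (t%:R + 1) * (t%:R + 2) :> R by rewrite !mulr_gt0; lra.
have /andP[rt0 _] := r_itv tN.
have pot := potential tN.
have c0 : 0 <= c t%:R by rewrite /c divr_ge0 ?mulr_ge0 //; lra.
have rc0 : 0 <= 6 * L * c t%:R * r t by rewrite !mulr_ge0 // ltW.
rewrite -(ler_pM2l w0).
have -> : t%:R * (t%:R + 1) * (t%:R + 2) *
   (6 * L * D ^+ 2 / (t%:R + 2) ^+ 2 + A / ((t%:R + 1) * (t%:R + 2))) =
   6 * L * D ^+ 2 * c t%:R + A * t%:R.
  by rewrite /c; field; apply/andP; split; apply: lt0r_neq0; lra.
lra.
Qed.

End recursion.

Section stochastic_sliding.
Context {R : realType} {d : nat}.
Variables (Om : set 'rV[R]_d) (lmo : 'rV[R]_d -> 'rV[R]_d) (L D : R).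
Hypotheses (L_gt0 : 0 < L) (D_gt0 : 0 < D).
Hypothesis Om_conv :
  forall x y (a : R), Om x -> Om y -> 0 <= a <= 1 -> Om ((1 - a) *: x + a *: y).
Hypothesis Om_diam : forall x y, Om x -> Om y -> dotp (x - y) (x - y) <= D ^+ 2.
Hypothesis lmoP : is_lmo Om lmo.
Variables (x0 xs : 'rV[R]_d) (f : 'rV[R]_d -> R).
Hypotheses (x0_Om : Om x0) (xs_Om : Om xs).
Hypothesis f_conv : convex_function setT f.
Hypothesis f_diff : forall x, Om x -> differentiable (f : _ -> R^o) x.
Hypothesis f_smooth : forall x y, Om x -> Om y ->
  enorm (grad f x - grad f y) <= L * enorm (x - y).
Hypothesis f_min : forall x, Om x -> f xs <= f x.
Hypothesis mf : measurable_fun setT f.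
Context dW (W : measurableType dW) (P : probability W R).
Variables (gest : W -> nat -> 'rV[R]_d -> 'rV[R]_d) (N : nat).
Hypothesis mgest : forall t Z, (1 <= t <= N)%N -> measurable_fun setT Z ->
  (forall w, Om (Z w)) -> measurable_fun setT (fun w => gest w t (Z w)).
Local Notation run w :=
  (scgs lmo (scgs_beta L) scgs_gamma (scgs_eta L D) (gest w) x0).
Local Notation z t w := (scgs_z scgs_gamma t (run w t.-1)).
Local Notation delta t w := (gest w t (z t w) - grad f (z t w)).
Local Notation gap x := (f x - f xs).

Variables (om1 om2 : R).
Hypothesis delta_sqr : forall t, (1 <= t <= N)%N ->
  integ P (fun w => dotp (delta t w) (delta t w)).
Hypothesis delta_meas : forall t, (1 <= t <= N)%N ->
  measurable_fun setT (fun w => delta t w).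
Hypothesis delta_bias : forall t, (1 <= t <= N)%N ->
  ex P (fun w => dotp (delta t w) (xs - (run w t.-1).2)) <= om1.
Hypothesis delta_var : forall t, (1 <= t <= N)%N ->
  ex P (fun w => dotp (delta t w) (delta t w)) <=
  2 * L / (3 * (t%:R * (t%:R + 1))) * ex P (fun w => gap (z t w)) + om2.

Let phi t := ex P (fun w => gap (run w t).1).
Let r t := ex P (fun w => dotp ((run w t).2 - xs) ((run w t).2 - xs)).
Let q t := ex P (fun w => gap (run w t).2).

Let run_Om w t := scgs_Om L_gt0 D_gt0 Om_conv Om_diam lmoP x0_Om (gest w) t.
Let mrun t (tN : (t <= N)%N) :=
  measurable_scgs L_gt0 D_gt0 Om_conv Om_diam lmoP x0_Om mgest tN.
Let mz t (tN : (1 <= t <= N)%N) :=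
  measurable_scgs_z L_gt0 D_gt0 Om_conv Om_diam lmoP x0_Om mgest tN.
Let z_Om w t (t0 : (0 < t)%N) :=
  scgs_z_Om L_gt0 D_gt0 Om_conv Om_diam lmoP x0_Om (gest w) t0.

Let integ_gap (Z : W -> 'rV[R]_d) : measurable_fun setT Z -> (forall w, Om (Z w)) ->
  integ P (fun w => gap (Z w)).
Proof.
move=> mZ OZ; apply: (@integ_bounded _ _ _ _ _ (enorm (grad f xs) * D + L * D ^+ 2 / 2)).
  by apply: measurable_funB => //; exact: (measurableT_comp mf mZ).
move=> w; rewrite ger0_norm ?subr_ge0 ?f_min //.
exact: (gap_le_norm L_gt0 D_gt0 Om_conv Om_diam xs_Om f_diff f_smooth (OZ w)).
Qed.

Let integ_dist (Z : W -> 'rV[R]_d) : measurable_fun setT Z -> (forall w, Om (Z w)) ->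
  integ P (fun w => dotp (Z w - xs) (Z w - xs)).
Proof.
move=> mZ OZ; apply: (@integ_bounded _ _ _ _ _ (D ^+ 2)).
  by apply: measurable_dotp; exact: measurable_rVB.
by move=> w; rewrite ger0_norm ?dotp_ge0 ?Om_diam.
Qed.

Let integ_phi t : (t <= N)%N -> integ P (fun w => gap (run w t).1).
Proof. by move=> tN; apply: integ_gap (mrun tN).1 _ => w; exact: (run_Om w t).1. Qed.

Let integ_q t : (t <= N)%N -> integ P (fun w => gap (run w t).2).
Proof. by move=> tN; apply: integ_gap (mrun tN).2 _ => w; exact: (run_Om w t).2. Qed.

Let integ_r t : (t <= N)%N ->
  integ P (fun w => dotp ((run w t).2 - xs) ((run w t).2 - xs)).
Proof. by move=> tN; apply: integ_dist (mrun tN).2 _ => w; exact: (run_Om w t).2. Qed.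

Let integ_z t : (1 <= t <= N)%N -> integ P (fun w => gap (z t w)).
Proof.
by move=> tN; apply: integ_gap (mz tN) _ => w; apply: z_Om; case/andP: tN.
Qed.

Let integ_bias t : (1 <= t <= N)%N ->
  integ P (fun w => dotp (delta t w) (xs - (run w t.-1).2)).
Proof.
move=> tN; have tN' : (t.-1 <= N)%N.
  by case/andP: tN => _; exact: leq_trans (leq_pred t).
apply: integ_dotp; [exact: delta_meas| |exact: delta_sqr|].
  by apply: measurable_rVB => //; exact: (mrun tN').2.
by apply: eq_integ (integ_r tN') => w; rewrite -[in RHS]opprB dotpNl dotpNr opprK.
Qed.

Let r_itv t : (t <= N)%N -> 0 <= r t <= D ^+ 2.
Proof.
move=> tN; apply/andP; split; first by apply: ex_ge0 => w; exact: dotp_ge0.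
rewrite -[leRHS](ex_cst P); apply: ex_le; [exact: integ_r|exact: integ_cst|].
by move=> w; apply: Om_diam => //; exact: (run_Om w t).2.
Qed.

Let n1 t := ex P (fun w => dotp (delta t w) (xs - (run w t.-1).2)).
Let n2 t := ex P (fun w => dotp (delta t w) (delta t w)).

Let step t : (t < N)%N ->
  phi t.+1 <= (1 - scgs_gamma t.+1) * phi t
  + scgs_gamma t.+1 * (scgs_eta L D t.+1
       + scgs_beta L t.+1 / 2 * (r t - r t.+1) + n1 t.+1)
  + 3 / (2 * L) * n2 t.+1.
Proof.
move=> tN; have tN1 : (1 <= t.+1 <= N)%N by [].
have tN' := ltnW tN.
have i1 := integZ (1 - scgs_gamma t.+1) (integ_phi tN').
have i2 := integB (integ_r tN') (integ_r tN).
have i3 := integD (integ_cst P (scgs_eta L D t.+1)) (integZ (scgs_beta L t.+1 / 2) i2).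
have i4 := integD i3 (integ_bias tN1).
have i5 := integD i1 (integZ (scgs_gamma t.+1) i4).
have i6 := integD i5 (integZ (3 / (2 * L)) (delta_sqr tN1)).
have := ex_le (integ_phi tN) i6 (fun w => scgs_step_gap L_gt0 D_gt0 Om_conv Om_diam
  lmoP x0_Om xs_Om f_conv f_diff f_smooth (gest w) (ltn0Sn t)).
rewrite (exD i5 (integZ _ (delta_sqr tN1))) (exD i1 (integZ _ i4)).
rewrite (exZ _ (integ_phi tN')) (exZ _ i4) (exD i3 (integ_bias tN1)).
rewrite (exD (integ_cst P _) (integZ _ i2)) ex_cst (exZ _ i2).
by rewrite (exB (integ_r tN') (integ_r tN)) (exZ _ (delta_sqr tN1)).
Qed.

(** The constant 3/2 is 1 from the slope estimate plus 1/2 from the smoothness of f around xs. *)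
Lemma expected_slope t : (1 <= t <= N)%N ->
  q t <= 3 / 2 * L * D ^+ 2 + scgs_eta L D t + scgs_beta L t / 2 * D ^+ 2 + om1
    + (2 * L / (3 * (t%:R * (t%:R + 1))) * ex P (fun w => gap (z t w)) + om2)
      / (2 * scgs_beta L t).
Proof.
move=> tN; have [t0 tN0] := andP tN.
have tN' : (t.-1 <= N)%N by exact: leq_trans (leq_pred t) tN0.
have b0 := scgs_beta_gt0 L_gt0 t.
have b20 : 0 <= (2 * scgs_beta L t)^-1 by nonneg.
have i2 := integB (integ_r tN') (integ_r tN0).
have i3 := integD (integ_cst P (3 / 2 * L * D ^+ 2 + scgs_eta L D t))
  (integZ (scgs_beta L t / 2) i2).
have i4 := integD i3 (integ_bias tN).
have i5 := integD i4 (integZ (2 * scgs_beta L t)^-1 (delta_sqr tN)).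
have pt w : gap (run w t).2 <= 3 / 2 * L * D ^+ 2 + scgs_eta L D t
    + scgs_beta L t / 2 * (dotp ((run w t.-1).2 - xs) ((run w t.-1).2 - xs)
        - dotp ((run w t).2 - xs) ((run w t).2 - xs))
    + dotp (delta t w) (xs - (run w t.-1).2)
    + (2 * scgs_beta L t)^-1 * dotp (delta t w) (delta t w).
  have := scgs_y_slope L_gt0 D_gt0 Om_conv Om_diam lmoP x0_Om xs_Om f_smooth (gest w) t0.
  have := gap_le_grad L_gt0 Om_conv Om_diam xs_Om f_diff f_smooth (run_Om w t).2.
  by rewrite [_ / (2 * scgs_beta L t)]mulrC; lra.
have := ex_le (integ_q tN0) i5 pt.
rewrite (exD i4 (integZ _ (delta_sqr tN))) (exD i3 (integ_bias tN)).
rewrite (exD (integ_cst P _) (integZ _ i2)) ex_cst (exZ _ i2).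
rewrite (exB (integ_r tN') (integ_r tN0)) (exZ _ (delta_sqr tN)) -/(r _) -/(r _).
have h1 := delta_bias tN.
have := ler_wpM2l b20 (delta_var tN).
have : scgs_beta L t / 2 * (r t.-1 - r t) <= scgs_beta L t / 2 * D ^+ 2.
  apply: ler_wpM2l; first by rewrite divr_ge0 // ltW.
  have /andP[_ ?] := r_itv tN'; have /andP[? _] := r_itv tN0; lra.
by rewrite [_ / (2 * scgs_beta L t)]mulrC -/(q t); lra.
Qed.

Lemma expected_rate A kappa :
  (forall t, (t < N)%N -> 3 * ((t%:R + 1) * (t%:R + 2)) * om1
    + 3 / (2 * L) * ((t%:R + 1) * (t%:R + 2) * (t%:R + 3)) * om2 <= kappa) ->
  0 <= A -> 3 * L * D ^+ 2 + 3 * q 0 + kappa <= A ->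
  (forall t, (t < N)%N -> (0 < t)%N ->
     15 / 4 * L * D ^+ 2 + 3 * q t + kappa <= 5 / 6 * A) ->
  forall t, (1 <= t <= N)%N ->
  phi t <= 6 * L * D ^+ 2 / (t%:R + 2) ^+ 2 + A / ((t%:R + 1) * (t%:R + 2)).
Proof.
move=> hk A0 h0 hq t tN.
apply: (sliding_rate (zeta := fun t => ex P (fun w => gap (z t w)))
  L_gt0 r_itv step _ _ _ hk A0 h0 hq tN) => k kN.
- exact: delta_bias.
- exact: delta_var.
- have kN1 : (1 <= k.+1 <= N)%N by [].
  have i1 := integZ (1 - scgs_gamma k.+1) (integ_phi (ltnW kN)).
  have i2 := integZ (scgs_gamma k.+1) (integ_q (ltnW kN)).
  have := ex_le (integ_z kN1) (integD i1 i2)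
    (fun w => scgs_z_gap lmo L D x0 xs f_conv (gest w) (ltn0Sn k)).
  by rewrite (exD i1 i2) (exZ _ (integ_phi (ltnW kN))) (exZ _ (integ_q (ltnW kN))).
Qed.

End stochastic_sliding.

(** * Measurability and laws of oracle answers *)

Section oracle_measurability.
Context {R : realType} {d : nat}.

(** Each partial derivative is a pointwise limit of difference quotients along a sequence. The
    function itself may depend on the sample point, hence the hypothesis on compositions with
    arbitrary measurable [Y]. *)
Lemma measurable_grad_along dT (T : measurableType dT) (phi : T -> 'rV[R]_d -> R)
    (Z : T -> 'rV[R]_d) :
  (forall Y : T -> 'rV[R]_d, measurable_fun setT Y ->
     measurable_fun setT (fun w => phi w (Y w))) ->
  measurable_fun setT Z ->
  (forall w, differentiable (phi w : _ -> R^o) (Z w)) ->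
  measurable_fun setT (fun w => grad (phi w) (Z w)).
Proof.
move=> mphi mZ dphi; apply: measurable_fun_rV => i.
pose e : 'rV[R]_d := delta_mx ord0 i.
apply: (@measurable_fun_cvg _ _ _ _
   (fun n w => n.+1%:R * (phi w (Z w + n.+1%:R^-1 *: e) - phi w (Z w)))).
  move=> n; apply: measurable_funM => //; apply: measurable_funB; apply: mphi => //.
  exact: measurable_rVD.
move=> w _ /=; have := grad_quotient_cvg (v := e) (dphi w).
suff -> : dotp (grad (phi w) (Z w)) e = grad (phi w) (Z w) ord0 i by [].
rewrite /dotp (bigD1 i) //= [e _ _]mxE !eqxx mulr1 big1 ?addr0 // => j ji.
by rewrite [e _ _]mxE eqxx (negbTE ji) mulr0.
Qed.

Context dX (Xi : measurableType dX) (mu : probability Xi R).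
Variable F : 'rV[R]_d -> Xi -> R.
Hypothesis mF : measurable_fun setT (fun p : 'rV[R]_d * Xi => F p.1 p.2).

(** Tonelli gives measurability of integrals with a parameter for nonnegative integrands; the two
    parts of [F] are treated apart and recombined. *)
Lemma objective_measurable : measurable_fun setT (objective mu F).
Proof.
have mFe : measurable_fun setT (fun p : 'rV[R]_d * Xi => (F p.1 p.2)%:E).
  exact/measurable_EFinP.
have split_int x : (\int[mu]_xi (F x xi)%:E =
    \int[mu]_xi maxe (F x xi)%:E 0 - \int[mu]_xi maxe (- (F x xi)%:E) 0)%E.
  rewrite integralE; congr (_ - _)%E; apply: eq_integral => xi _.
    by rewrite funeposE.
  by rewrite funenegE.
have -> : objective mu F = fine \o (fun x => \int[mu]_xi maxe (F x xi)%:E 0 -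
    \int[mu]_xi maxe (- (F x xi)%:E) 0)%E.
  by apply/funext => x /=; rewrite /objective /Rintegral split_int.
pose fp (p : 'rV[R]_d * Xi) : \bar R := maxe (F p.1 p.2)%:E 0%E.
pose fn (p : 'rV[R]_d * Xi) : \bar R := maxe (- (F p.1 p.2)%:E)%E 0%E.
have mp : measurable_fun setT (fubini_F mu fp).
  apply: measurable_fun_fubini_tonelli_F; first exact: measurable_maxe.
  by move=> p; rewrite /fp le_max lexx orbT.
have mn : measurable_fun setT (fubini_F mu fn).
  apply: measurable_fun_fubini_tonelli_F.
    by apply: measurable_maxe => //; exact: measurableT_comp.
  by move=> p; rewrite /fn le_max lexx orbT.
apply: measurableT_comp; first exact: fine_measurable.
exact: (emeasurable_funB mp mn).
Qed.

Lemma oracle_measurable dT (T : measurableType dT) (s : T -> Xi)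
    (Z : T -> 'rV[R]_d) : measurable_fun setT s -> measurable_fun setT Z ->
  measurable_fun setT (fun w => F (Z w) (s w)).
Proof.
by move=> ms mZ; exact: (measurableT_comp mF (measurable_fun_pair mZ ms)).
Qed.

Lemma oracle_grad_measurable dT (T : measurableType dT) (s : T -> Xi)
    (Z : T -> 'rV[R]_d) : measurable_fun setT s -> measurable_fun setT Z ->
  (forall w, differentiable (F ^~ (s w) : _ -> R^o) (Z w)) ->
  measurable_fun setT (fun w => grad (F ^~ (s w)) (Z w)).
Proof.
move=> ms mZ dF; apply: (measurable_grad_along (phi := fun w => F ^~ (s w))) => //.
by move=> Y mY; exact: oracle_measurable.
Qed.

End oracle_measurability.

Section law.
Context {R : realType} dX (Xi : measurableType dX) (mu : probability Xi R).
Context dW (W : measurableType dW) (P : probability W R).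
Variable xi : {RV P >-> Xi}.
Hypothesis law : forall A, measurable A -> distribution P xi A = mu A.

Lemma law_integral_ge0 (h : Xi -> R) : measurable_fun setT h -> (forall x, 0 <= h x) ->
  (\int[P]_w (h (xi w))%:E = \int[mu]_x (h x)%:E)%E.
Proof.
move=> mh h0; have mh' : measurable_fun setT (EFin \o h) by exact/measurable_EFinP.
transitivity (\int[distribution P xi]_x (EFin \o h) x)%E.
  by rewrite ge0_integral_distribution // => x; rewrite lee_fin.
by apply: eq_measure_integral => A mA _; exact: law.
Qed.

Lemma law_integ (h : Xi -> R) : integ mu h ->
  integ P (fun w => h (xi w)) /\ ex P (fun w => h (xi w)) = ex mu h.
Proof.
move=> ih; have mh := integ_measurable ih.
have mh' : measurable_fun setT (EFin \o h) by exact/measurable_EFinP.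
have mhx : measurable_fun setT (fun w => h (xi w)).
  exact: (measurableT_comp mh (measurable_funP xi)).
have ihx : integ P (fun w => h (xi w)).
  apply/integrableP; split; first exact/measurable_EFinP.
  have mah : measurable_fun setT (fun x => `|h x|) by exact: measurableT_comp.
  have /integrableP[_] := ih; apply: le_lt_trans.
  by rewrite -(law_integral_ge0 mah).
split => //; rewrite /ex /Rintegral; congr fine.
transitivity (\int[distribution P xi]_x (EFin \o h) x)%E.
  by rewrite (integral_distribution mh').
by apply: eq_measure_integral => A mA _; exact: law.
Qed.

Lemma law_ae (Q : Xi -> Prop) : {ae mu, forall x, Q x} -> {ae P, forall w, Q (xi w)}.
Proof.
move=> [N [mN N0 QN]]; exists (xi @^-1` N); split.
- by rewrite -[X in measurable X]setTI; exact: measurable_funP.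
- by rewrite -N0 -law.
- by move=> w /= nQ; apply: QN.
Qed.

End law.

Section batch_independence.
Context {R : realType} dW (W : measurableType dW) (P : probability W R).
Variables (I : choiceType) (A : set I) (G : I -> set (set W)).
Hypothesis indG : mutual_independence P A G.
Hypothesis sigG : forall i, A i -> sigma_algebra setT (G i).
Hypothesis Gm : forall i, A i -> G i `<=` measurable.
Variables (b : nat) (J : set I) (Jb : 'I_b -> set I).
Hypotheses (JA : J `<=` A) (JbA : forall j, Jb j `<=` A).
Hypothesis JJb : forall j, J `&` Jb j = set0.
Hypothesis JbJb : forall j k, j != k -> Jb j `&` Jb k = set0.
Context dE (E : measurableType dE) (Y : 'I_b -> W -> E).
Hypothesis mY : forall j, measurable_fun setT
  (Y j : g_sigma_algebraType (\bigcup_(i in Jb j) G i) -> E).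

Lemma indep_past j : indep_of P (\bigcup_(i in J) G i) (Y j).
Proof. exact: (indep_of_family indG sigG Gm JA (@JbA j) (JJb j) (@mY j)). Qed.

(** The past together with draw j lies in the block [J] united with [Jb j], which is again disjoint
    from [Jb k]. *)
Lemma indep_past_sample j k : j != k ->
  indep_of P (\bigcup_(i in J) G i `|` preimage_set_system setT (Y j) measurable)
    (Y k).
Proof.
move=> jk; have sub : <<s \bigcup_(i in J) G i `|`
     preimage_set_system setT (Y j) measurable >> `<=`
   <<s \bigcup_(i in J `|` Jb j) G i >>.
  apply: smallest_sub; first exact: smallest_sigma_algebra.
  move=> B [[i Ji GB]|[C mC <-]].
    by apply: sub_sigma_algebra; exists i => //; left.
  have : <<s \bigcup_(i in Jb j) G i >> (setT `&` Y j @^-1` C) by exact: mY.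
  apply: sub_smallest2r; first exact: smallest_sigma_algebra.
  by move=> S [i Ji GS]; exists i => //; right.
move=> B C /sub sB mC.
apply: (indep_of_family (J := J `|` Jb j) indG sigG Gm _ (@JbA k) _ (@mY k) sB mC).
  by move=> i [/JA|/JbA].
by rewrite setIUl JJb JbJb // setU0.
Qed.

End batch_independence.

Section nat_ceil.
Context {R : realType}.
Variable x : R.
Hypothesis x_ge0 : 0 <= x.

Let nat_ceilE : (`|Num.ceil x|%N)%:R = (Num.ceil x)%:~R :> R.
Proof.
have c0 : (0 <= Num.ceil x)%R by rewrite -[X in X <= _](ceil0 R) le_ceil.
by rewrite -[in RHS](gez0_abs c0) -pmulrn.
Qed.

Lemma nat_ceil_ge : x <= (`|Num.ceil x|%N)%:R.
Proof. by rewrite nat_ceilE ceil_ge. Qed.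

Lemma nat_ceil_lt : (`|Num.ceil x|%N)%:R < x + 1.
Proof. by rewrite nat_ceilE -ltrBlDr; have := ceil_itv x; rewrite intrD; case/andP. Qed.

End nat_ceil.

Section problem_facts.
Context {R : realType} {d : nat} dX (Xi : measurableType dX) (mu : probability Xi R).
Variables (L D : R) (F : 'rV[R]_d -> Xi -> R) (Om : set 'rV[R]_d) (xs : 'rV[R]_d).
Hypothesis sp : stochastic_problem L D mu F Om xs.

Lemma problem_diam x y : Om x -> Om y -> dotp (x - y) (x - y) <= D ^+ 2.
Proof.
move=> Ox Oy; have h := sp_diam sp Ox Oy.
by rewrite -enorm_le_dotp // (le_trans (enorm_ge0 _) h).
Qed.

Lemma problem_sample_measurable z : Om z ->
  measurable_fun setT (fun xi => grad (F ^~ xi) z).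
Proof.
move=> Oz; apply: (oracle_grad_measurable (sp_measurable sp) (s := id) (Z := fun=> z)) => //.
by move=> xi; exact: (sp_differentiable sp).
Qed.

Lemma problem_grad_measurable dT (T : measurableType dT) (Z : T -> 'rV[R]_d) :
  measurable_fun setT Z -> (forall w, Om (Z w)) ->
  measurable_fun setT (fun w => grad (objective mu F) (Z w)).
Proof.
move=> mZ OZ; apply: (measurable_grad_along (phi := fun=> objective mu F)) => //.
  by move=> Y mY; exact: (measurableT_comp (objective_measurable mu (sp_measurable sp)) mY).
by move=> w; exact: (sp_differentiable_objective sp).
Qed.

Lemma problem_unbiased z : Om z ->
  integ mu (fun xi => dotp (grad (F ^~ xi) z) (grad (F ^~ xi) z)) ->
  forall i, integ mu (fun xi => grad (F ^~ xi) z ord0 i) /\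
    ex mu (fun xi => grad (F ^~ xi) z ord0 i) = grad (objective mu F) z ord0 i.
Proof.
move=> Oz i2 i; have iz := integ_coord i (problem_sample_measurable Oz) i2.
split => //; apply: EFin_inj; rewrite -exE // -(sp_unbiased sp i Oz).
by rewrite unlock.
Qed.

Hypotheses (L_gt0 : 0 < L) (D_gt0 : 0 < D).
Context dW (W : measurableType dW) (P : probability W R).
Variable Z : W -> 'rV[R]_d.
Hypotheses (mZ : measurable_fun setT Z) (Z_Om : forall w, Om (Z w)).

Let gap_bound w : objective mu F (Z w) - objective mu F xs <=
  enorm (grad (objective mu F) xs) * D + L * D ^+ 2 / 2.
Proof.
exact: (gap_le_norm L_gt0 D_gt0 (convex_set_comb (sp_convex sp)) problem_diam
  (sp_feasible sp) (sp_differentiable_objective sp) (sp_smooth sp) (Z_Om w)).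
Qed.

Lemma integ_gap : integ P (fun w => objective mu F (Z w) - objective mu F xs).
Proof.
apply: (@integ_bounded _ _ _ _ _
    (enorm (grad (objective mu F) xs) * D + L * D ^+ 2 / 2)).
  apply: measurable_funB => //.
  exact: (measurableT_comp (objective_measurable mu (sp_measurable sp)) mZ).
by move=> w; rewrite ger0_norm ?subr_ge0 ?gap_bound //; exact: (sp_minimum sp).
Qed.

Lemma ex_gap_le : ex P (fun w => objective mu F (Z w) - objective mu F xs) <=
  enorm (grad (objective mu F) xs) * D + L * D ^+ 2 / 2.
Proof.
rewrite -[leRHS](ex_cst P); apply: ex_le; [exact: integ_gap|exact: integ_cst|].
exact: gap_bound.
Qed.

End problem_facts.

(** * First-order setting *)

Section first_order.
Context {R : realType} {d : nat} dX (Xi : measurableType dX) (mu : probability Xi R).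
Variables (L D rho : R) (F : 'rV[R]_d -> Xi -> R) (Om : set 'rV[R]_d) (xs : 'rV[R]_d).
Hypotheses (L_gt0 : 0 < L) (D_gt0 : 0 < D) (rho_gt0 : 0 < rho).
Hypothesis sp : stochastic_problem L D mu F Om xs.
Hypothesis var : fo_variance L rho mu F Om xs.
Variables (N : nat) (lmo : 'rV[R]_d -> 'rV[R]_d) (x0 : 'rV[R]_d).
Context dW (W : measurableType dW) (P : probability W R).
Variable xi : nat -> nat -> {RV P >-> Xi}.
Hypotheses (lmoP : is_lmo Om lmo) (x0_Om : Om x0).
Hypothesis samples : fo_samples mu (fo_batch rho) N xi.

Local Notation f := (objective mu F).
Local Notation b := (fo_batch rho).
Local Notation gap x := (f x - f xs).
Let gest (w : W) := fo_estimate F b (fun s i => xi s i w).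
Local Notation run w :=
  (scgs lmo (scgs_beta L) scgs_gamma (scgs_eta L D) (gest w) x0).
Local Notation z t w := (scgs_z scgs_gamma t (run w t.-1)).
Local Notation delta t w := (gest w t (z t w) - grad f (z t w)).

Let Om_conv := convex_set_comb (sp_convex sp).
Let Om_diam := problem_diam sp.
Let mf : measurable_fun setT f := objective_measurable mu (sp_measurable sp).
Let run_Om w t := scgs_Om L_gt0 D_gt0 Om_conv Om_diam lmoP x0_Om (gest w) t.
Let z_Om w t (t0 : (0 < t)%N) :=
  scgs_z_Om L_gt0 D_gt0 Om_conv Om_diam lmoP x0_Om (gest w) t0.

Lemma fo_batch_ge t : 3 * rho * t%:R * (t%:R + 1) <= (b t)%:R :> R.
Proof. by apply: nat_ceil_ge; nonneg. Qed.

Lemma fo_batch_gt0 t : (0 < t)%N -> (0 < b t)%N.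
Proof.
move=> t0; have t1 : 0 < t%:R :> R by rewrite ltr0n.
rewrite -(ltr0n R); apply: lt_le_trans (fo_batch_ge t).
by pos.
Qed.

Let fo_measurable dT (T : measurableType dT) (s : T -> nat -> nat -> Xi) t
    (Z : T -> 'rV[R]_d) :
  (forall i, (i < b t)%N -> measurable_fun setT (fun w => s w t i)) ->
  measurable_fun setT Z -> (forall w, Om (Z w)) ->
  measurable_fun setT (fun w => fo_estimate F b (s w) t (Z w)).
Proof.
move=> ms mZ OZ; apply: measurable_rVZ => //; apply: measurable_rV_sum => j.
apply: (oracle_grad_measurable (sp_measurable sp)) => //; first exact: ms.
by move=> w; exact: (sp_differentiable sp).
Qed.

Let mgest t Z : (1 <= t <= N)%N -> measurable_fun setT Z ->
  (forall w, Om (Z w)) -> measurable_fun setT (fun w => gest w t (Z w)).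
Proof. by move=> _ mZ OZ; apply: fo_measurable. Qed.

Let sample_var z : Om z ->
  integ mu (fun xi => dotp (grad (F ^~ xi) z - grad f z) (grad (F ^~ xi) z - grad f z))
  /\ ex mu (fun xi => dotp (grad (F ^~ xi) z - grad f z) (grad (F ^~ xi) z - grad f z))
    <= 2 * rho * L * gap z.
Proof.
move=> Oz; apply: integ_ge0_le.
- have m := problem_sample_measurable sp Oz.
  by apply: measurable_dotp; exact: measurable_rVB.
- by move=> x; exact: dotp_ge0.
- have := var Oz; rewrite unlock; apply: le_trans; rewrite le_eqVlt; apply/orP; left.
  by apply/eqP; apply: eq_integral => x _; rewrite sqr_enorm.
Qed.

Let sample_mean z i : Om z ->
  integ mu (fun xi => (grad (F ^~ xi) z - grad f z) ord0 i) /\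
  ex mu (fun xi => (grad (F ^~ xi) z - grad f z) ord0 i) = 0.
Proof.
move=> Oz; have m := problem_sample_measurable sp Oz.
have md : measurable_fun setT (fun xi => grad (F ^~ xi) z - grad f z).
  exact: measurable_rVB.
have [iv _] := sample_var Oz; have ic := integ_coord i md iv.
(* The variance assumption concerns the centred gradient; adding back the constant grad f z gives
   the second moment of the gradient itself. *)
have ig : integ mu (fun xi => dotp (grad (F ^~ xi) z) (grad (F ^~ xi) z)).
  have := integ_dotpD md (measurable_cst (grad f z)) iv (integ_cst mu (dotp (grad f z) (grad f z))).
  by apply: eq_integ => x /=; rewrite subrK.
have [iz ez] := problem_unbiased sp Oz ig i.
split => //.
rewrite (_ : (fun xi => _) = fun xi => grad (F ^~ xi) z ord0 i - grad f z ord0 i).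
  by rewrite exB ?ez ?ex_cst ?subrr //; exact: integ_cst.
by apply/funext => x; rewrite !mxE.
Qed.

Let past t : set (nat * nat) := [set k | drawn b N k /\ (k.1 < t)%N].
Let G (k : nat * nat) := sigma_rv (xi k.1 k.2).
Let past_sets t : set (set W) := \bigcup_(k in past t) G k.
Local Notation Wpast t := (g_sigma_algebraType (past_sets t)).

Let past_measurable t : past_sets t `<=` measurable.
Proof. by move=> B [k _]; exact: sigma_rv_measurable. Qed.

(** Measurability of runs with the past as measurable space and horizon t - 1: every draw used
    before iteration t generates events of the past. *)
Let run_past t : (1 <= t <= N)%N ->
  measurable_fun setT ((fun w => z t w) : Wpast t -> 'rV[R]_d) /\
  measurable_fun setT ((fun w => (run w t.-1).2) : Wpast t -> 'rV[R]_d).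
Proof.
move=> /andP[t0 tN].
have mg s Z : (1 <= s <= t.-1)%N -> measurable_fun setT (Z : Wpast t -> 'rV[R]_d) ->
    (forall w, Om (Z w)) ->
    measurable_fun setT ((fun w => gest w s (Z w)) : Wpast t -> 'rV[R]_d).
  move=> /andP[s0 st] mZ OZ.
  apply: (@fo_measurable _ (Wpast t) (fun w s i => xi s i w)) => // i ib _ A mA.
  apply: sub_sigma_algebra; exists (s, i); last by rewrite setTI; exact: sigma_rv_preimage.
  have st' : (s < t)%N by rewrite -(prednK t0) ltnS.
  by split => //; split => //=; rewrite s0 (leq_trans (ltnW st')).
have [m1 m2] := measurable_scgs L_gt0 D_gt0 Om_conv Om_diam lmoP x0_Om mg (leqnn _).
by split => //; apply: measurable_rVD; exact: measurable_rVZ.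
Qed.

Section iteration.
Variable t : nat.
Hypothesis tN : (1 <= t <= N)%N.

Let t0 : (0 < t)%N. Proof. by case/andP: tN. Qed.

Let Y (j : 'I_(b t)) : W -> Xi := xi t j.
Let phi (x : W * Xi) : 'rV[R]_d := grad (F ^~ x.2) (z t x.1) - grad f (z t x.1).
Let V w : R := 2 * rho * L * gap (z t w).

Let mz : measurable_fun setT (fun w => z t w).
Proof. exact: (measurable_scgs_z L_gt0 D_gt0 Om_conv Om_diam lmoP x0_Om mgest tN). Qed.

Let mphi : measurable_fun setT (phi : Wpast t * Xi -> 'rV[R]_d).
Proof.
have mz1 : measurable_fun setT (fun x : Wpast t * Xi => z t x.1).
  exact: (measurableT_comp (run_past tN).1 measurable_fst).
have Oz1 (x : Wpast t * Xi) : Om (z t x.1) by exact: z_Om.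
apply: measurable_rVB.
  apply: (oracle_grad_measurable (sp_measurable sp) (s := snd)) => //.
  by move=> x; exact: (sp_differentiable sp).
exact: (problem_grad_measurable sp mz1 Oz1).
Qed.

Let law_t (j : 'I_(b t)) A : measurable A -> distribution P (xi t j) A = mu A.
Proof. by move=> mA; apply: samples.1 => //; split => /=. Qed.

Let iV : integ P V.
Proof.
by apply: integZ; apply: (integ_gap sp L_gt0 D_gt0) => // w; exact: z_Om.
Qed.

Let deltaE : (fun w => delta t w) = batch_mean Y phi.
Proof.
apply/funext => w; rewrite /batch_mean /phi /= /gest /fo_estimate sumrB scalerBr.
rewrite sumr_const card_ord; congr (_ - _).
rewrite -[in RHS](scaler_nat (b t) (grad _ _)) scalerA mulVf ?scale1r //.
by rewrite pnatr_eq0 -lt0n fo_batch_gt0.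
Qed.

Let Jb (j : 'I_(b t)) : set (nat * nat) := [set (t, val j)].

Let Jb_drawn j : Jb j `<=` drawn b N.
Proof. by move=> k ->; split => /=. Qed.

Let past_drawn : past t `<=` drawn b N. Proof. by move=> k []. Qed.

Let past_Jb j : past t `&` Jb j = set0.
Proof. by apply/seteqP; split => // k [[_ kt] kj]; move: kt; rewrite kj /= ltnn. Qed.

Let Jb_Jb (j k : 'I_(b t)) : j != k -> Jb j `&` Jb k = set0.
Proof.
move=> jk; apply/seteqP; split => // i [-> [/val_inj kj]].
by rewrite kj eqxx in jk.
Qed.

Let mYJ j : measurable_fun setT
  (Y j : g_sigma_algebraType (\bigcup_(i in Jb j) G i) -> Xi).
Proof.
move=> _ A mA; apply: sub_sigma_algebra; exists (t, val j) => //.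
by rewrite setTI; exact: sigma_rv_preimage.
Qed.

Let sigG k : drawn b N k -> sigma_algebra setT (G k).
Proof. by move=> _; exact: sigma_rv_sigma_algebra. Qed.

Let Gm k : drawn b N k -> G k `<=` measurable.
Proof. by move=> _; exact: sigma_rv_measurable. Qed.

Let mY j : measurable_fun setT (Y j). Proof. exact: measurable_funP. Qed.

Let indY j : indep_of P (past_sets t) (Y j).
Proof. exact: (indep_past samples.2 sigG Gm past_drawn Jb_drawn past_Jb mYJ). Qed.

Let indYY j k : j != k ->
  indep_of P (past_sets t `|` preimage_set_system setT (Y j) measurable) (Y k).
Proof.
exact: (indep_past_sample samples.2 sigG Gm past_drawn Jb_drawn past_Jb Jb_Jb mYJ).
Qed.

Let phi_mean w j i : (\int[P]_w' (phi (w, Y j w') ord0 i)%:E = 0)%E.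
Proof.
have [im em] := sample_mean i (z_Om w t0).
have [iP eP] := law_integ (@law_t j) im.
by rewrite (exE iP) eP em.
Qed.

Let phi_var w j :
  (\int[P]_w' (dotp (phi (w, Y j w')) (phi (w, Y j w')))%:E <= (V w)%:E)%E.
Proof.
have [im em] := sample_var (z_Om w t0).
have [iP eP] := law_integ (@law_t j) im.
by rewrite (exE iP) eP lee_fin.
Qed.

Lemma fo_delta_measurable : measurable_fun setT (fun w => delta t w).
Proof.
apply: measurable_rVB; first by apply: mgest => // w; exact: z_Om.
by apply: (problem_grad_measurable sp mz) => w; exact: z_Om.
Qed.

(** b_t >= 3 rho t (t+1) turns 2 rho L / b_t into 2L / (3 t (t+1)), the coefficient that the
    recursion is built for. *)
Lemma fo_delta_var : integ P (fun w => dotp (delta t w) (delta t w)) /\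
  ex P (fun w => dotp (delta t w) (delta t w)) <=
  2 * L / (3 * (t%:R * (t%:R + 1))) * ex P (fun w => gap (z t w)) + 0.
Proof.
have [i v] := batch_mean_var (fo_batch_gt0 t0) (@past_measurable t) mY indY indYY
  mphi phi_mean iV phi_var.
have dE w : dotp (delta t w) (delta t w) = dotp (batch_mean Y phi w) (batch_mean Y phi w).
  by rewrite -deltaE.
split; first by apply: eq_integ i => w; rewrite dE.
rewrite addr0 (eq_ex P dE); apply: le_trans v _.
have t1 : 0 < t%:R :> R by rewrite ltr0n.
have g0 : 0 <= ex P (fun w => gap (z t w)).
  by apply: ex_ge0 => w; rewrite subr_ge0; apply: (sp_minimum sp); exact: z_Om.
have -> : ex P V = 2 * rho * L * ex P (fun w => gap (z t w)).
  rewrite exZ //; have rL : 2 * rho * L != 0 by apply: lt0r_neq0; pos.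
  by apply: eq_integ (integZ (2 * rho * L)^-1 iV) => w; rewrite /V mulrA mulVf ?mul1r.
rewrite [leLHS]mulrA; apply: ler_wpM2r => //.
have bt := fo_batch_ge t; have b0 : 0 < (b t)%:R :> R by rewrite ltr0n fo_batch_gt0.
rewrite mulrC ler_pdivrMr //.
apply: le_trans (ler_wpM2l _ bt); last by nonneg.
rewrite le_eqVlt; apply/orP; left; apply/eqP; field.
by apply/andP; split; apply: lt0r_neq0 => //; lra.
Qed.

Lemma fo_delta_bias : ex P (fun w => dotp (delta t w) (xs - (run w t.-1).2)) <= 0.
Proof.
rewrite (_ : (fun w => _) = fun w => dotp (batch_mean Y phi w) (xs - (run w t.-1).2));
  last by rewrite -deltaE.
rewrite (batch_mean_orth (@past_measurable t) mY indY mphi phi_mean iV phi_var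
   (h := fun w => xs - (run w t.-1).2) (c := D ^+ 2)) //.
  by apply: measurable_rVB => //; exact: (run_past tN).2.
by move=> w; apply: Om_diam; [exact: (sp_feasible sp)|exact: (run_Om w _).2].
Qed.

End iteration.

Let gap_z_le t : (1 <= t <= N)%N ->
  ex P (fun w => gap (z t w)) <= enorm (grad f xs) * D + L * D ^+ 2 / 2.
Proof.
move=> tN; have t0 : (0 < t)%N by case/andP: tN.
apply: (ex_gap_le sp L_gt0 D_gt0); first exact:
  (measurable_scgs_z L_gt0 D_gt0 Om_conv Om_diam lmoP x0_Om mgest tN).
by move=> w; exact: z_Om.
Qed.

Lemma fo_rate t : (1 <= t <= N)%N ->
  ('E_P[fun w => (f (run w t).1 - f xs)%R]
     <= (6 * L * D ^+ 2 / (t%:R + 2) ^+ 2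
         + (15 * L * D ^+ 2 + 3 * enorm (grad f xs) * D)
           / ((t%:R + 1) * (t%:R + 2)))%:E)%E.
Proof.
move=> tN; set g := enorm _.
have g0 : 0 <= g * D by rewrite mulr_ge0 ?enorm_ge0 // ltW.
have LD0 : 0 <= L * D ^+ 2 by nonneg.
have ms k (kN : (k <= N)%N) := measurable_scgs L_gt0 D_gt0 Om_conv Om_diam lmoP x0_Om mgest kN.
rewrite unlock exE; last first.
  by apply: (integ_gap sp L_gt0 D_gt0); [exact: (ms t (andP tN).2).1|move=> w; exact: (run_Om w t).1].
rewrite lee_fin.
have dv k (kN : (1 <= k <= N)%N) := (fo_delta_var kN).2.
have di k (kN : (1 <= k <= N)%N) := (fo_delta_var kN).1.
apply: (expected_rate L_gt0 D_gt0 Om_conv Om_diam lmoP x0_Om (sp_feasible sp)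
  (sp_convex_objective sp) (sp_differentiable_objective sp) (sp_smooth sp)
  (sp_minimum sp) mf mgest di fo_delta_measurable fo_delta_bias dv (kappa := 0)) => //.
- by move=> k _; rewrite !mulr0 addr0.
- by rewrite addr_ge0 // -mulrA; lra.
- have : ex P (fun w => gap (run w 0).2) <= g * D + L * D ^+ 2 / 2.
    by apply: (ex_gap_le sp L_gt0 D_gt0) => // w; exact: (run_Om w 0).2.
  by rewrite -!mulrA; lra.
(* All coefficients are worst at k = 1: q_k <= (3/2 + 1/2 + 2/3 + 1/16) L D^2 + g D / 8, so that 3
   q_k + 15/4 L D^2 stays below 25/2 L D^2 + 5/2 g D. *)
- move=> k kN k0; have kN' : (1 <= k <= N)%N by rewrite k0 ltnW.
  have := expected_slope L_gt0 D_gt0 Om_conv Om_diam lmoP x0_Om (sp_feasible sp)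
    (sp_differentiable_objective sp) (sp_smooth sp)
    (sp_minimum sp) mf mgest di fo_delta_measurable fo_delta_bias dv kN'.
  set q := ex P _; have := gap_z_le kN'; rewrite -/g; set Z := ex P _ => Zle.
  have k1 : 1 <= k%:R :> R by rewrite ler1n.
  have k2 : k%:R != 0 :> R /\ k%:R + 1 != 0 :> R /\ k%:R + 2 != 0 :> R /\ L != 0.
    by split; [|split; [|split]]; apply: lt0r_neq0 => //; lra.
  have Z0 : 0 <= Z.
    by apply: ex_ge0 => w; rewrite subr_ge0; apply: (sp_minimum sp); exact: z_Om.
  have e1 : scgs_eta L D k <= L * D ^+ 2 / 2.
    rewrite /scgs_eta; apply: ler_wpM2l => //.
    rewrite lef_pV2 ?posrE; [nra|nra|lra].
  have e2 : scgs_beta L k / 2 * D ^+ 2 <= 2 / 3 * (L * D ^+ 2).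
    rewrite /scgs_beta (_ : _ * D ^+ 2 = 2 / (k%:R + 2) * (L * D ^+ 2)).
      apply: ler_wpM2r => //; rewrite ler_pdivrMr; lra.
    by field; case: k2 => _ [_ []].
  have e3 : (2 * L / (3 * (k%:R * (k%:R + 1))) * Z + 0) / (2 * scgs_beta L k) <= Z / 8.
    rewrite addr0 (_ : _ / (2 * _) = (k%:R + 2) / (12 * (k%:R * (k%:R + 1))) * Z).
      rewrite [Z / 8]mulrC; apply: ler_wpM2r => //.
      have kk : 0 <= (k%:R - 1) * (k%:R - 1) :> R by nonneg.
      by rewrite ler_pdivrMr; lra.
    by rewrite /scgs_beta; case: k2 => ? [? [? ?]]; field; do ?(apply/andP; split).
  by move=> hq; lra.
Qed.

End first_order.

(** * Zeroth-order setting *)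

Section finite_difference.
Context {R : realType} {d : nat}.
Implicit Types (f : 'rV[R]_d -> R) (z u : 'rV[R]_d).

Lemma gradN f x : differentiable (f : _ -> R^o) x -> grad (- f) x = - grad f x.
Proof.
move=> df; apply/rowP => i; rewrite !mxE deriveN //; exact: diff_derivable.
Qed.

(** The quadratic upper bound for f and for -f gives the two sides of the absolute value. *)
Lemma finite_difference_error f (L nu : R) z u : 0 < nu ->
  (forall x, differentiable (f : _ -> R^o) x) ->
  (forall x y, enorm (grad f x - grad f y) <= L * enorm (x - y)) ->
  `|(f (z + nu *: u) - f z) / nu - dotp (grad f z) u| <= L / 2 * nu * dotp u u.
Proof.
move=> nu0 df Lf; set y := z + nu *: u.
have yz : y - z = nu *: u by rewrite /y addrC addKr.
have up : f y <= f z + dotp (grad f z) (y - z) + L / 2 * dotp (y - z) (y - z).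
  apply: smooth_taylor => // s _; apply: le_trans (Lf _ _) _.
  by rewrite [z + _]addrC addrK.
have lo : - f y <= - f z + dotp (grad (- f) z) (y - z)
    + L / 2 * dotp (y - z) (y - z).
  apply: (@smooth_taylor _ _ (- f)) => [s _|s _]; first exact: differentiableN.
  rewrite !gradN // -opprD enormN; apply: le_trans (Lf _ _) _.
  by rewrite [z + _]addrC addrK.
move: up lo; rewrite gradN // yz !dotpE /= => up lo.
have nu1 : nu^-1 * nu = 1 by rewrite mulVf // lt0r_neq0.
have -> : (f y - f z) / nu - dotp (grad f z) u =
    nu^-1 * (f y - f z - nu * dotp (grad f z) u).
  by rewrite mulrBr mulrA nu1 mul1r mulrC.
rewrite normrM gtr0_norm ?invr_gt0 // -(ler_pM2l nu0) mulrA mulfV ?lt0r_neq0 //.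
by rewrite mul1r ler_norml; apply/andP; split; lra.
Qed.

End finite_difference.

Section almost_sure_bound.
Context {R : realType} dW (W : measurableType dW) (P : probability W R).

Lemma integ_ae_le (X Y : W -> R) : measurable_fun setT X -> (forall w, 0 <= X w) ->
  integ P Y -> (forall w, 0 <= Y w) -> {ae P, forall w, X w <= Y w} ->
  integ P X /\ ex P X <= ex P Y.
Proof.
move=> mX X0 iY Y0 XY; apply: integ_ge0_le => //; rewrite -exE //.
apply: ae_ge0_le_integral => //.
- by move=> w _; rewrite lee_fin.
- exact/measurable_EFinP.
- by move=> w _; rewrite lee_fin.
- exact: measurable_int iY.
- by move: XY; apply: filterS => w XY _; rewrite lee_fin.
Qed.

(** Convexity of the squared norm, read off from the sum of |X_j - M|^2. The smoothing errors are
    not centred, so their average is bounded this way rather than by orthogonality. *)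
Lemma ex_mean_sqr_le d (b : nat) (X : 'I_b -> W -> 'rV[R]_d) (c : R) : (0 < b)%N ->
  (forall j, measurable_fun setT (X j)) ->
  (forall j, integ P (fun w => dotp (X j w) (X j w))) ->
  (forall j, ex P (fun w => dotp (X j w) (X j w)) <= c) ->
  let M w := b%:R^-1 *: \sum_j X j w in
  integ P (fun w => dotp (M w) (M w)) /\ ex P (fun w => dotp (M w) (M w)) <= c.
Proof.
move=> b0 mX iX Xc M; have bR : 0 < b%:R :> R by rewrite ltr0n.
have b1 : b%:R^-1 * b%:R = 1 :> R by rewrite mulVf // lt0r_neq0.
have iS : integ P (fun w => b%:R^-1 * \sum_j dotp (X j w) (X j w)).
  by apply: integZ; apply: integ_sum.
have mM : measurable_fun setT M by apply: measurable_rVZ => //; exact: measurable_rV_sum.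
have pt w : dotp (M w) (M w) <= b%:R^-1 * \sum_j dotp (X j w) (X j w).
  have : 0 <= b%:R^-1 * \sum_j dotp (X j w - M w) (X j w - M w).
    apply: mulr_ge0; first by rewrite invr_ge0 ltW.
    by apply: sumr_ge0 => j _; exact: dotp_ge0.
  have -> : \sum_j dotp (X j w - M w) (X j w - M w) =
      \sum_j dotp (X j w) (X j w) - 2 * dotp (\sum_j X j w) (M w)
        + b%:R * dotp (M w) (M w).
    have E j : dotp (X j w - M w) (X j w - M w) = dotp (X j w) (X j w)
        - 2 * dotp (X j w) (M w) + dotp (M w) (M w).
      by move: (M w) (X j w) => m x; rewrite !dotpE (dotpC m x); ring.
    under eq_bigr do rewrite E.
    rewrite big_split /= sumrB -mulr_sumr -dotp_suml sumr_const card_ord.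
    by congr (_ + _); rewrite mulr_natl.
  have -> : dotp (\sum_j X j w) (M w) = b%:R * dotp (M w) (M w).
    rewrite {2}/M dotpZl mulrA mulfV ?mul1r //; exact: lt0r_neq0.
  move: (dotp (M w) (M w)) (\sum_j _) => m s.
  have -> : b%:R^-1 * (s - 2 * (b%:R * m) + b%:R * m) =
    b%:R^-1 * s - (b%:R^-1 * b%:R) * m by ring.
  by rewrite b1; lra.
have iM : integ P (fun w => dotp (M w) (M w)).
  apply: (integ_dom _ _ iS); first exact: measurable_dotp.
  by move=> w; rewrite ger0_norm ?dotp_ge0.
split => //; apply: le_trans (ex_le iM iS pt) _.
rewrite exZ ?ex_sum //; last exact: integ_sum.
apply: (@le_trans _ _ (b%:R^-1 * \sum_(j < b) c)).
  by apply: ler_wpM2l; [rewrite invr_ge0 ltW|apply: ler_sum].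
by rewrite sumr_const card_ord -(mulr_natl c) mulrA b1 mul1r.
Qed.

End almost_sure_bound.

Section zeroth_order.
Context {R : realType} {d : nat} dX (Xi : measurableType dX) (mu : probability Xi R).
Variables (L D rho : R) (F : 'rV[R]_d -> Xi -> R) (Om : set 'rV[R]_d) (xs : 'rV[R]_d).
Hypotheses (L_gt0 : 0 < L) (D_gt0 : 0 < D) (rho_gt0 : 0 < rho).
Hypothesis sp : stochastic_problem L D mu F Om xs.
Hypothesis smooth : zo_smooth L mu F.
Hypothesis mom : zo_second_moment L rho mu F Om xs.
Variables (N : nat) (lmo : 'rV[R]_d -> 'rV[R]_d) (x0 : 'rV[R]_d).
Context dW (W : measurableType dW) (P : probability W R).
Variables (xi : nat -> nat -> {RV P >-> Xi}) (u : nat -> nat -> {RV P >-> 'rV[R]_d}).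
Hypotheses (lmoP : is_lmo Om lmo) (x0_Om : Om x0).
Hypothesis samples : zo_samples mu (zo_batch rho d) N xi u.

Local Notation f := (objective mu F).
Local Notation b := (zo_batch rho d).
Local Notation nu := (zo_nu D d N).
Local Notation gap x := (f x - f xs).
Let gest (w : W) :=
  zo_estimate F b nu (fun s i => xi s i w) (fun s i => u s i w).
Local Notation run w :=
  (scgs lmo (scgs_beta L) scgs_gamma (scgs_eta L D) (gest w) x0).
Local Notation z t w := (scgs_z scgs_gamma t (run w t.-1)).
Local Notation delta t w := (gest w t (z t w) - grad f (z t w)).

Let Om_conv := convex_set_comb (sp_convex sp).
Let Om_diam := problem_diam sp.
Let mf : measurable_fun setT f := objective_measurable mu (sp_measurable sp).
Let run_Om w t := scgs_Om L_gt0 D_gt0 Om_conv Om_diam lmoP x0_Om (gest w) t.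
Let z_Om w t (t0 : (0 < t)%N) :=
  scgs_z_Om L_gt0 D_gt0 Om_conv Om_diam lmoP x0_Om (gest w) t0.

Lemma zo_batch_ge t : 6 * rho * (d%:R + 4) * t%:R * (t%:R + 1) <= (b t)%:R :> R.
Proof. by apply: nat_ceil_ge; nonneg. Qed.

Lemma zo_batch_gt0 t : (0 < t)%N -> (0 < b t)%N.
Proof.
move=> t0; have t1 : 0 < t%:R :> R by rewrite ltr0n.
rewrite -(ltr0n R); apply: lt_le_trans (zo_batch_ge t).
by have := ler0n R d => d0; pos.
Qed.

Lemma zo_nu_gt0 : 0 < nu.
Proof.
have n2 : 0 < N%:R + 2 :> R by rewrite ltr_wpDl.
have d6 : 0 < d%:R + 6 :> R by rewrite ltr_wpDl.
by rewrite /zo_nu divr_gt0 // mulr_gt0 ?exprn_gt0 ?powR_gt0.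
Qed.

Lemma zo_nu_sqr : nu ^+ 2 = D ^+ 2 / ((N%:R + 2) ^+ 4 * (d%:R + 6) ^+ 3).
Proof.
have d6 : 0 <= d%:R + 6 :> R by rewrite addr_ge0.
rewrite /zo_nu expr_div_n exprMn -exprM; congr (_ / (_ * _)).
rewrite -powR_mulrn ?powR_ge0 // -powRrM -[in RHS]powR_mulrn //.
by congr (_ `^ _); field.
Qed.

Let zo_measurable dT (T : measurableType dT) (s : T -> nat -> nat -> Xi)
    (v : T -> nat -> nat -> 'rV[R]_d) t (Z : T -> 'rV[R]_d) :
  (forall i, (i < b t)%N -> measurable_fun setT (fun w => s w t i)) ->
  (forall i, (i < b t)%N -> measurable_fun setT (fun w => v w t i)) ->
  measurable_fun setT Z ->
  measurable_fun setT (fun w => zo_estimate F b nu (s w) (v w) t (Z w)).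
Proof.
move=> ms mv mZ; apply: measurable_rVZ => //; apply: measurable_rV_sum => j.
have msj := ms j (ltn_ord j); have mvj := mv j (ltn_ord j).
have mF := oracle_measurable (sp_measurable sp) msj.
apply: measurable_rVZ => //; apply: measurable_funM => //.
apply: measurable_funB; apply: mF => //.
by apply: measurable_rVD => //; exact: measurable_rVZ.
Qed.

Let mgest t Z : (1 <= t <= N)%N -> measurable_fun setT Z ->
  (forall w, Om (Z w)) -> measurable_fun setT (fun w => gest w t (Z w)).
Proof. by move=> _ mZ OZ; apply: zo_measurable. Qed.

Let sample_sqr z : Om z ->
  integ mu (fun xi => dotp (grad (F ^~ xi) z) (grad (F ^~ xi) z))
  /\ ex mu (fun xi => dotp (grad (F ^~ xi) z) (grad (F ^~ xi) z))
    <= 2 * rho * L * gap z.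
Proof.
move=> Oz; apply: integ_ge0_le.
- by have m := problem_sample_measurable sp Oz; exact: measurable_dotp.
- by move=> x; exact: dotp_ge0.
- have := mom Oz; rewrite unlock; apply: le_trans; rewrite le_eqVlt; apply/orP; left.
  by apply/eqP; apply: eq_integral => x _; rewrite sqr_enorm.
Qed.

Lemma zo_grad_min : grad f xs = 0.
Proof.
have Os := sp_feasible sp; have [i2 e2] := sample_sqr Os.
have ig := problem_unbiased sp Os i2.
apply: dotp_eq0; apply/eqP; rewrite eq_le dotp_ge0 andbT.
have ms := problem_sample_measurable sp Os.
(* Jensen: the squared norm of the mean is at most the second moment. *)
have j : 0 <= ex mu (fun xi => dotp (grad (F ^~ xi) xs - grad f xs)
    (grad (F ^~ xi) xs - grad f xs)) by apply: ex_ge0 => x; exact: dotp_ge0.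
have il : integ mu (fun x => \sum_i grad f xs ord0 i * grad (F ^~ x) xs ord0 i).
  by apply: integ_sum => i; exact: (integZ (grad f xs ord0 i) (ig i).1).
have ic := integ_cst mu (dotp (grad f xs) (grad f xs)).
have E x : dotp (grad (F ^~ x) xs - grad f xs) (grad (F ^~ x) xs - grad f xs) =
    dotp (grad (F ^~ x) xs) (grad (F ^~ x) xs)
    + (- 2) * (\sum_i grad f xs ord0 i * grad (F ^~ x) xs ord0 i)
    + dotp (grad f xs) (grad f xs).
  by rewrite -/(dotp (grad f xs) (grad (F ^~ x) xs)) !dotpE
    (dotpC (grad (F ^~ x) xs) (grad f xs)); ring.
have ES : ex mu (fun x => \sum_i grad f xs ord0 i * grad (F ^~ x) xs ord0 i) =
    dotp (grad f xs) (grad f xs).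
  rewrite ex_sum => [|i]; last exact: (integZ (grad f xs ord0 i) (ig i).1).
  by apply: eq_bigr => i _; rewrite exZ ?(ig i).2 //; exact: (ig i).1.
move: j; rewrite (eq_ex _ E) (exD (integD i2 (integZ _ il)) ic).
rewrite (exD i2 (integZ _ il)) (exZ _ il) ex_cst ES.
move: e2; rewrite subrr mulr0; move: (ex mu _) (dotp (grad f xs) _) => m2 m1.
by move=> ? ?; lra.
Qed.

Let drawn_at (k : (nat * nat) + (nat * nat)) : nat * nat :=
  match k with inl ti => ti | inr ti => ti end.
Let A : set ((nat * nat) + (nat * nat)) := [set k | drawn b N (drawn_at k)].
Let past t : set ((nat * nat) + (nat * nat)) :=
  [set k | drawn b N (drawn_at k) /\ ((drawn_at k).1 < t)%N].
Let G (k : (nat * nat) + (nat * nat)) : set (set W) :=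
  match k with
  | inl ti => sigma_rv (xi ti.1 ti.2)
  | inr ti => sigma_rv (u ti.1 ti.2)
  end.
Let past_sets t : set (set W) := \bigcup_(k in past t) G k.
Local Notation Wpast t := (g_sigma_algebraType (past_sets t)).

Let indG : mutual_independence P A G. Proof. by case: samples. Qed.

Let G_measurable k : G k `<=` measurable.
Proof. by case: k => ?; exact: sigma_rv_measurable. Qed.

Let G_sigma k : sigma_algebra setT (G k).
Proof. by case: k => ?; exact: sigma_rv_sigma_algebra. Qed.

Let past_measurable t : past_sets t `<=` measurable.
Proof. by move=> B [k _]; exact: G_measurable. Qed.

Let run_past t : (1 <= t <= N)%N ->
  measurable_fun setT ((fun w => z t w) : Wpast t -> 'rV[R]_d) /\
  measurable_fun setT ((fun w => (run w t.-1).2) : Wpast t -> 'rV[R]_d).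
Proof.
move=> /andP[t0 tN].
have mg s Z : (1 <= s <= t.-1)%N -> measurable_fun setT (Z : Wpast t -> 'rV[R]_d) ->
    (forall w, Om (Z w)) ->
    measurable_fun setT ((fun w => gest w s (Z w)) : Wpast t -> 'rV[R]_d).
  move=> /andP[s0 st] mZ OZ; have st' : (s < t)%N by rewrite -(prednK t0) ltnS.
  have drs i : (i < b s)%N -> drawn b N (s, i).
    by move=> ib; split => //=; rewrite s0 (leq_trans (ltnW st')).
  apply: (@zo_measurable _ (Wpast t) (fun w s i => xi s i w) (fun w s i => u s i w)) => //.
    move=> i ib _ B mB; apply: sub_sigma_algebra; exists (inl (s, i)).
      by split => //; exact: drs.
    by rewrite setTI; exact: sigma_rv_preimage.
  move=> i ib _ B mB; apply: sub_sigma_algebra; exists (inr (s, i)).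
    by split => //; exact: drs.
  by rewrite setTI; exact: sigma_rv_preimage.
have [m1 m2] := measurable_scgs L_gt0 D_gt0 Om_conv Om_diam lmoP x0_Om mg (leqnn _).
by split => //; apply: measurable_rVD; exact: measurable_rVZ.
Qed.

Section iteration.
Variable t : nat.
Hypothesis tN : (1 <= t <= N)%N.

Let t0 : (0 < t)%N. Proof. by case/andP: tN. Qed.

Let dr (j : 'I_(b t)) : drawn b N (t, val j). Proof. by split => /=. Qed.

Let Y (j : 'I_(b t)) (w : W) : Xi * 'rV[R]_d := (xi t j w, u t j w).
(** The error splits into [phi], which uses the exact directional derivative and is centred given
    the past, and [fd_error], the discrepancy of the finite difference, small but not centred. *)
Let phi (x : W * (Xi * 'rV[R]_d)) : 'rV[R]_d :=
  dotp (grad (F ^~ x.2.1) (z t x.1)) x.2.2 *: x.2.2 - grad f (z t x.1).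
Let V w : R := (d%:R + 4) * (2 * rho * L * gap (z t w)).
Let fd_error (j : 'I_(b t)) w : 'rV[R]_d :=
  ((F (z t w + nu *: u t j w) (xi t j w) - F (z t w) (xi t j w)) / nu) *: u t j w
  - dotp (grad (F ^~ (xi t j w)) (z t w)) (u t j w) *: u t j w.
Let bias w : 'rV[R]_d := (b t)%:R^-1 *: \sum_j fd_error j w.

Let mz : measurable_fun setT (fun w => z t w).
Proof. exact: (measurable_scgs_z L_gt0 D_gt0 Om_conv Om_diam lmoP x0_Om mgest tN). Qed.

Let mphi : measurable_fun setT (phi : Wpast t * (Xi * 'rV[R]_d) -> 'rV[R]_d).
Proof.
have mz1 : measurable_fun setT (fun x : Wpast t * (Xi * 'rV[R]_d) => z t x.1).
  exact: (measurableT_comp (run_past tN).1 measurable_fst).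
have Oz1 (x : Wpast t * (Xi * 'rV[R]_d)) : Om (z t x.1) by exact: z_Om.
have m21 : measurable_fun setT (fun x : Wpast t * (Xi * 'rV[R]_d) => x.2.1).
  exact: (measurableT_comp measurable_fst measurable_snd).
have m22 : measurable_fun setT (fun x : Wpast t * (Xi * 'rV[R]_d) => x.2.2).
  exact: (measurableT_comp measurable_snd measurable_snd).
apply: measurable_rVB; last exact: (problem_grad_measurable sp mz1 Oz1).
apply: measurable_rVZ => //; apply: measurable_dotp => //.
apply: (oracle_grad_measurable (sp_measurable sp)) => //.
by move=> x; exact: (sp_differentiable sp).
Qed.

Let law_t (j : 'I_(b t)) B : measurable B -> distribution P (xi t j) B = mu B.
Proof. by case: samples => h _ _; exact: (h _ _ (dr j)). Qed.

Let gauss_t (j : 'I_(b t)) : std_gaussian (u t j).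
Proof. by case: samples => _ h _; exact: (h _ _ (dr j)). Qed.

Let iV : integ P V.
Proof.
by do 2 apply: integZ; apply: (integ_gap sp L_gt0 D_gt0) => // w; exact: z_Om.
Qed.

Let deltaE w : delta t w = batch_mean Y phi w + bias w.
Proof.
rewrite /batch_mean /bias -scalerDr -big_split /=.
have -> : \sum_(j < b t) (phi (w, Y j w) + fd_error j w) = \sum_(j < b t)
    (((F (z t w + nu *: u t j w) (xi t j w) - F (z t w) (xi t j w)) / nu) *: u t j w
     - grad f (z t w)).
  by apply: eq_bigr => j _; rewrite /phi /fd_error /= addrC addrA subrK.
rewrite sumrB scalerBr sumr_const card_ord; congr (_ - _).
rewrite -[in RHS](scaler_nat (b t) (grad _ _)) scalerA mulVf ?scale1r //.
by rewrite pnatr_eq0 -lt0n zo_batch_gt0.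
Qed.

(** One block holds both the sample and the direction of a draw, since [Y j] is their pair. *)
Let Jb (j : 'I_(b t)) : set ((nat * nat) + (nat * nat)) :=
  [set k | drawn_at k = (t, val j)].

Let Jb_drawn j : Jb j `<=` A.
Proof. by move=> k kj; rewrite /A /= kj; exact: dr. Qed.

Let past_drawn : past t `<=` A. Proof. by move=> k []. Qed.

Let past_Jb j : past t `&` Jb j = set0.
Proof.
by apply/seteqP; split => // k [[_ kt] kj]; move: kt; rewrite kj /= ltnn.
Qed.

Let Jb_Jb (j k : 'I_(b t)) : j != k -> Jb j `&` Jb k = set0.
Proof.
move=> jk; apply/seteqP; split => // i [ij]; rewrite /Jb /= ij => -[/val_inj kj].
by rewrite kj eqxx in jk.
Qed.

Let mYJ j : measurable_fun setT
  (Y j : g_sigma_algebraType (\bigcup_(i in Jb j) G i) -> Xi * 'rV[R]_d).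
Proof.
apply: measurable_fun_pair => _ B mB; apply: sub_sigma_algebra.
  by exists (inl (t, val j)) => //; rewrite setTI; exact: sigma_rv_preimage.
by exists (inr (t, val j)) => //; rewrite setTI; exact: sigma_rv_preimage.
Qed.

Let mY j : measurable_fun setT (Y j). Proof. exact: measurable_fun_pair. Qed.

Let indY j : indep_of P (past_sets t) (Y j).
Proof.
exact: (indep_past indG (fun k _ => G_sigma k) (fun k _ => @G_measurable k)
  past_drawn Jb_drawn past_Jb mYJ).
Qed.

Let indYY j k : j != k ->
  indep_of P (past_sets t `|` preimage_set_system setT (Y j) measurable) (Y k).
Proof.
exact: (indep_past_sample indG (fun k _ => G_sigma k) (fun k _ => @G_measurable k)
  past_drawn Jb_drawn past_Jb Jb_Jb mYJ).
Qed.

Let H (j : 'I_(b t)) : set (set W) := sigma_rv (xi t j).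

Let Hm j : H j `<=` measurable.
Proof. exact: sigma_rv_measurable. Qed.

Let indHu j : indep_of P (H j) (u t j).
Proof.
have sub k : drawn_at k = (t, val j) -> [set k] `<=` A.
  by move=> kj _ ->; rewrite /A /= kj; exact: dr.
have dis : [set inl (t, val j)] `&` [set inr (t, val j)] = set0 :> set ((nat * nat) + (nat * nat)).
  by apply/seteqP; split => // k [->].
have mu' : measurable_fun setT (u t j :
    g_sigma_algebraType (\bigcup_(i in [set inr (t, val j)]) G i) -> 'rV[R]_d).
  by rewrite bigcup_set1 => _ B mB; rewrite setTI; apply: sub_sigma_algebra; exact: sigma_rv_preimage.
have := indep_of_family indG (fun k _ => G_sigma k) (fun k _ => @G_measurable k)
  (sub (inl (t, val j)) erefl) (sub (inr (t, val j)) erefl) dis mu'.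
by rewrite bigcup_set1.
Qed.

Let mgH w j i : measurable_fun setT
  ((fun w' => grad (F ^~ (xi t j w')) (z t w) ord0 i) : g_sigma_algebraType (H j) -> R).
Proof.
have m := measurable_fun_coord i (problem_sample_measurable sp (z_Om w t0)).
have mx : measurable_fun setT (xi t j : g_sigma_algebraType (H j) -> Xi).
  by move=> _ B mB; rewrite setTI; apply: sub_sigma_algebra; exact: sigma_rv_preimage.
exact: (measurableT_comp m mx).
Qed.

Let sample_grad w (j : 'I_(b t)) :
  integ P (fun w' => dotp (grad (F ^~ (xi t j w')) (z t w)) (grad (F ^~ (xi t j w')) (z t w)))
  /\ ex P (fun w' => dotp (grad (F ^~ (xi t j w')) (z t w)) (grad (F ^~ (xi t j w')) (z t w)))
    <= 2 * rho * L * gap (z t w).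
Proof.
have [im em] := sample_sqr (z_Om w t0).
by have [iP ->] := law_integ (@law_t j) im.
Qed.

Let sample_grad_mean w (j : 'I_(b t)) i :
  ex P (fun w' => grad (F ^~ (xi t j w')) (z t w) ord0 i) = grad f (z t w) ord0 i.
Proof.
have [ig eg] := problem_unbiased sp (z_Om w t0) (sample_sqr (z_Om w t0)).1 i.
by have [_ ->] := law_integ (@law_t j) ig.
Qed.

Let phi_sqr w j := directional_error_var (gauss_t j) (@Hm j) (@mgH w j) (@indHu j)
  (sample_grad w j).1 (sample_grad_mean w j).

Let phi_var w j :
  (\int[P]_w' (dotp (phi (w, Y j w')) (phi (w, Y j w')))%:E <= (V w)%:E)%E.
Proof.
have [i e] := phi_sqr w j; rewrite (exE i) lee_fin; apply: le_trans e _.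
by apply: ler_wpM2l; [rewrite addr_ge0|exact: (sample_grad w j).2].
Qed.

Let phi_mean w j i : (\int[P]_w' (phi (w, Y j w') ord0 i)%:E = 0)%E.
Proof.
have m := directional_error_mean (gauss_t j) (@Hm j) (@mgH w j) (@indHu j)
  (sample_grad w j).1 (sample_grad_mean w j) i.
rewrite exE; last first.
  apply: integ_coord; last exact: (phi_sqr w j).1.
  exact: (measurableT_comp (measurableT_comp mphi (pair1_measurable (w : Wpast t))) (mY j)).
by congr (_%:E); exact: m.
Qed.

Let delta_measurable : measurable_fun setT (fun w => delta t w).
Proof.
apply: measurable_rVB; first by apply: mgest => // w; exact: z_Om.
by apply: (problem_grad_measurable sp mz) => w; exact: z_Om.
Qed.

Let fd_error_measurable j : measurable_fun setT (fd_error j).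
Proof.
have mx : measurable_fun setT (xi t j) by exact: measurable_funP.
have mu' : measurable_fun setT (u t j) by exact: measurable_funP.
have mF := oracle_measurable (sp_measurable sp) mx.
apply: measurable_rVB; apply: measurable_rVZ => //.
  apply: measurable_funM => //; apply: measurable_funB; apply: mF => //.
  by apply: measurable_rVD => //; exact: measurable_rVZ.
apply: measurable_dotp => //.
apply: (oracle_grad_measurable (sp_measurable sp)) => // w.
by apply: (sp_differentiable sp); exact: z_Om.
Qed.

Let fd_error_sqr j : integ P (fun w => dotp (fd_error j w) (fd_error j w)) /\
  ex P (fun w => dotp (fd_error j w) (fd_error j w)) <= 16 * (L ^+ 2 * D ^+ 2) / (N%:R + 2) ^+ 4.
Proof.
have [i6 e6] := gaussian_pow6 (gauss_t j).
pose c := (L / 2 * nu) ^+ 2.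
have c0 : 0 <= c by exact: sqr_ge0.
(* The squared discrepancy is at most (L nu / 2)^2 |u|^6. The power (d+6)^3 contained in nu^2
   absorbs the d^3 of E|u|^6, and 64/4 = 16. *)
have cE : c * (64 * d%:R ^+ 3) <= 16 * (L ^+ 2 * D ^+ 2) / (N%:R + 2) ^+ 4.
  have -> : c = L ^+ 2 / 4 * nu ^+ 2 by rewrite /c; field.
  have d6 : 0 < d%:R + 6 :> R by rewrite ltr_wpDl.
  have n2 : 0 < N%:R + 2 :> R by rewrite ltr_wpDl.
  rewrite zo_nu_sqr.
  have -> : L ^+ 2 / 4 * (D ^+ 2 / ((N%:R + 2) ^+ 4 * (d%:R + 6) ^+ 3)) * (64 * d%:R ^+ 3)
    = 16 * (L ^+ 2 * D ^+ 2) / (N%:R + 2) ^+ 4 * (d%:R ^+ 3 / (d%:R + 6) ^+ 3).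
    by field; rewrite !lt0r_neq0.
  rewrite -[leRHS]mulr1; apply: ler_wpM2l; first by nonneg.
  by rewrite ler_pdivrMr ?exprn_gt0 // mul1r lerXn2r ?nnegrE ?lerDl // ltW.
have [|||||i e] := @integ_ae_le _ _ _ P (fun w => dotp (fd_error j w) (fd_error j w))
    (fun w => c * dotp (u t j w) (u t j w) ^+ 3).
- by apply: measurable_dotp; exact: fd_error_measurable.
- by move=> w; exact: dotp_ge0.
- exact: integZ.
- by move=> w; rewrite mulr_ge0 // exprn_ge0 ?dotp_ge0.
- have := law_ae (@law_t j) smooth; apply: filterS => w [dF LF].
  have := finite_difference_error (z t w) (u t j w) zo_nu_gt0 dF LF.
  rewrite /fd_error -scalerBl; set a := (_ / nu - dotp _ _); move: (dotp_ge0 (u t j w)) => q0 h.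
  rewrite !dotpE exprSr [leRHS]mulrA mulrA; apply: ler_wpM2r => //.
  rewrite -expr2 -(real_normK (num_real a)) -exprMn; apply: lerXn2r => //.
  by rewrite nnegrE (le_trans _ h).
split => //; apply: le_trans e _; rewrite exZ //; apply: le_trans cE.
exact: ler_wpM2l.
Qed.

Let bias_sqr : integ P (fun w => dotp (bias w) (bias w)) /\
  ex P (fun w => dotp (bias w) (bias w)) <= 16 * (L ^+ 2 * D ^+ 2) / (N%:R + 2) ^+ 4.
Proof.
apply: (ex_mean_sqr_le (zo_batch_gt0 t0)) => j.
- exact: fd_error_measurable.
- exact: (fd_error_sqr j).1.
- exact: (fd_error_sqr j).2.
Qed.

Let bias_measurable : measurable_fun setT bias.
Proof.
by apply: measurable_rVZ => //; apply: measurable_rV_sum => j; exact: fd_error_measurable.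
Qed.

Let mean_sqr := batch_mean_var (zo_batch_gt0 t0) (@past_measurable t) mY indY indYY
    mphi phi_mean iV phi_var.

Let mean_measurable : measurable_fun setT (batch_mean Y phi).
Proof. exact: (batch_mean_measurable (@past_measurable t) mY mphi). Qed.

Lemma zo_delta_measurable : measurable_fun setT (fun w => delta t w).
Proof. exact: delta_measurable. Qed.

(** From |a + b|^2 <= 2|a|^2 + 2|b|^2. The factor 2 on the centred part is why the batch size has 6
    rho where the first-order one has 3 rho, and d + 4 is the price of a random direction. *)
Lemma zo_delta_var : integ P (fun w => dotp (delta t w) (delta t w)) /\
  ex P (fun w => dotp (delta t w) (delta t w)) <=
  2 * L / (3 * (t%:R * (t%:R + 1))) * ex P (fun w => gap (z t w))
  + 32 * (L ^+ 2 * D ^+ 2) / (N%:R + 2) ^+ 4.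
Proof.
have [ia ea] := mean_sqr; have [ib eb] := bias_sqr.
have i2 := integD (integZ 2 ia) (integZ 2 ib).
have pt w : dotp (delta t w) (delta t w) <=
    2 * dotp (batch_mean Y phi w) (batch_mean Y phi w) + 2 * dotp (bias w) (bias w).
  rewrite deltaE; move: (batch_mean Y phi w) (bias w) => x y.
  by have := dotp_ge0 (x - y); rewrite !dotpE (dotpC y x); lra.
have i : integ P (fun w => dotp (delta t w) (delta t w)).
  apply: (integ_dom _ _ i2).
    by apply: measurable_dotp; exact: delta_measurable.
  by move=> w; rewrite ger0_norm ?dotp_ge0.
split => //; apply: le_trans (ex_le i i2 pt) _.
rewrite (exD (integZ 2 ia) (integZ 2 ib)) !exZ //.
have t1 : 0 < t%:R :> R by rewrite ltr0n.
have d0 : 0 <= d%:R :> R by [].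
have g0 : 0 <= ex P (fun w => gap (z t w)).
  by apply: ex_ge0 => w; rewrite subr_ge0; apply: (sp_minimum sp); exact: z_Om.
have igap : integ P (fun w => gap (z t w)).
  by apply: (integ_gap sp L_gt0 D_gt0) => // w; exact: z_Om.
have EV : ex P V = (d%:R + 4) * (2 * rho * L * ex P (fun w => gap (z t w))).
  by rewrite exZ ?exZ //; exact: integZ.
have ea2 : 2 * ((b t)%:R^-1 * ex P V) <=
    2 * L / (3 * (t%:R * (t%:R + 1))) * ex P (fun w => gap (z t w)).
  rewrite EV; move: (ex P _) g0 => Z Z0.
  have -> : 2 * ((b t)%:R^-1 * ((d%:R + 4) * (2 * rho * L * Z))) =
    (4 * (d%:R + 4) * rho * L) / (b t)%:R * Z by ring.
  apply: ler_wpM2r => //.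
  have bt := zo_batch_ge t; have b0 : 0 < (b t)%:R :> R by rewrite ltr0n zo_batch_gt0.
  rewrite ler_pdivrMr //.
  apply: le_trans (ler_wpM2l _ bt); last by nonneg.
  rewrite le_eqVlt; apply/orP; left; apply/eqP; field.
  by apply/andP; split; apply: lt0r_neq0 => //; lra.
apply: lerD; last by lra.
by apply: le_trans ea2; apply: ler_wpM2l.
Qed.

(** The centred part is orthogonal to the past; the smoothing part is paired with a vector of length
    at most D. *)
Lemma zo_delta_bias : ex P (fun w => dotp (delta t w) (xs - (run w t.-1).2)) <=
  4 * (L * D ^+ 2) / (N%:R + 2) ^+ 2.
Proof.
pose h w := xs - (run w t.-1).2.
have mh : measurable_fun setT (h : Wpast t -> 'rV[R]_d).
  by apply: measurable_rVB => //; exact: (run_past tN).2.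
have tN' : (t.-1 <= N)%N.
  by case/andP: tN => _; exact: leq_trans (leq_pred t).
have mh' : measurable_fun setT h.
  apply: measurable_rVB => //.
  exact: (measurable_scgs L_gt0 D_gt0 Om_conv Om_diam lmoP x0_Om mgest tN').2.
have hD w : dotp (h w) (h w) <= D ^+ 2.
  by apply: Om_diam; [exact: (sp_feasible sp)|exact: (run_Om w _).2].
have ih : integ P (fun w => dotp (h w) (h w)).
  apply: (@integ_bounded _ _ _ _ _ (D ^+ 2)); first exact: measurable_dotp.
  by move=> w; rewrite ger0_norm ?dotp_ge0.
have [ia _] := mean_sqr; have [ib eb] := bias_sqr.
have iah := integ_dotp mean_measurable mh' ia ih.
have ibh := integ_dotp bias_measurable mh' ib ih.
rewrite (_ : (fun w => _) = fun w => dotp (batch_mean Y phi w) (h w) + dotp (bias w) (h w));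
  last by apply/funext => w; rewrite deltaE dotpDl.
rewrite (exD iah ibh).
rewrite (batch_mean_orth (@past_measurable t) mY indY mphi phi_mean iV phi_var mh hD) add0r.
have n2 : 0 < N%:R + 2 :> R by rewrite ltr_wpDl.
(* This Young weight balances the smoothing bias against the diameter. *)
pose c := 4 * L / (N%:R + 2) ^+ 2.
have c0 : 0 < c by rewrite divr_gt0 ?exprn_gt0 // mulr_gt0.
have i1 := integZ (2 * c)^-1 ib.
have i2 := integD i1 (integ_cst P (c / 2 * D ^+ 2)).
have pt w : dotp (bias w) (h w) <= (2 * c)^-1 * dotp (bias w) (bias w) + c / 2 * D ^+ 2.
  apply: le_trans (dotp_young _ _ c0) _; rewrite mulrC lerD2l.
  by apply: ler_wpM2l => //; rewrite divr_ge0 // ltW.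
apply: le_trans (ex_le ibh i2 pt) _.
rewrite (exD i1 (integ_cst P _)) exZ // ex_cst.
apply: (@le_trans _ _ ((2 * c)^-1 * (16 * (L ^+ 2 * D ^+ 2) / (N%:R + 2) ^+ 4)
    + c / 2 * D ^+ 2)).
  by rewrite lerD2r; apply: ler_wpM2l => //; rewrite invr_ge0 mulr_ge0 // ltW.
rewrite le_eqVlt; apply/orP; left; apply/eqP; rewrite /c; field.
by rewrite !lt0r_neq0.
Qed.

End iteration.

Let gap_le (Z : W -> 'rV[R]_d) : measurable_fun setT Z -> (forall w, Om (Z w)) ->
  ex P (fun w => gap (Z w)) <= L * D ^+ 2 / 2.
Proof.
move=> mZ OZ; apply: le_trans (ex_gap_le sp L_gt0 D_gt0 P mZ OZ) _.
by rewrite zo_grad_min enorm0 mul0r add0r.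
Qed.

Lemma zo_rate t : (1 <= t <= N)%N ->
  ('E_P[fun w => (f (run w t).1 - f xs)%R]
     <= (8 * L * D ^+ 2 / (t%:R + 2) ^+ 2
         + 32 * L * D ^+ 2 / ((t%:R + 1) * (t%:R + 2)))%:E)%E.
Proof.
move=> tN; have LD0 : 0 <= L * D ^+ 2 by nonneg.
have ms k (kN : (k <= N)%N) := measurable_scgs L_gt0 D_gt0 Om_conv Om_diam lmoP x0_Om mgest kN.
rewrite unlock exE; last first.
  by apply: (integ_gap sp L_gt0 D_gt0); [exact: (ms t (andP tN).2).1|move=> w; exact: (run_Om w t).1].
rewrite lee_fin.
have q_le k : (k <= N)%N -> ex P (fun w => gap (run w k).2) <= L * D ^+ 2 / 2.
  by move=> kN; apply: gap_le => [|w]; [exact: (ms k kN).2|exact: (run_Om w k).2].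
have dv k (kN : (1 <= k <= N)%N) := (zo_delta_var kN).2.
have di k (kN : (1 <= k <= N)%N) := (zo_delta_var kN).1.
(* The recursion gives 6 where 8 is claimed. *)
apply: (@le_trans _ _ (6 * L * D ^+ 2 / (t%:R + 2) ^+ 2
    + 32 * L * D ^+ 2 / ((t%:R + 1) * (t%:R + 2)))); last first.
  rewrite lerD2r; apply: ler_wpM2r; last by rewrite -!mulrA; lra.
  by rewrite invr_ge0 exprn_ge0 // addr_ge0.
apply: (expected_rate L_gt0 D_gt0 Om_conv Om_diam lmoP x0_Om (sp_feasible sp)
  (sp_convex_objective sp) (sp_differentiable_objective sp) (sp_smooth sp)
  (sp_minimum sp) mf mgest di zo_delta_measurable zo_delta_bias dv
  (kappa := 18 * (L * D ^+ 2))) => //.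
- move=> k kN; have n2 : 0 < N%:R + 2 :> R by rewrite ltr_wpDl.
  have k1 : k%:R + 1 <= N%:R :> R by rewrite natr1 ler_nat.
  have k0 : 0 <= k%:R :> R by [].
  have -> : 3 * ((k%:R + 1) * (k%:R + 2)) * (4 * (L * D ^+ 2) / (N%:R + 2) ^+ 2) +
      3 / (2 * L) * ((k%:R + 1) * (k%:R + 2) * (k%:R + 3)) *
      (32 * (L ^+ 2 * D ^+ 2) / (N%:R + 2) ^+ 4) =
    (12 * ((k%:R + 1) * (k%:R + 2)) * (N%:R + 2) ^+ 2
     + 48 * ((k%:R + 1) * (k%:R + 2) * (k%:R + 3))) / (N%:R + 2) ^+ 4 * (L * D ^+ 2).
    by field; rewrite !lt0r_neq0.
  apply: ler_wpM2r => //; rewrite ler_pdivrMr ?exprn_gt0 //.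
  move: k0 k1 n2; move: k%:R N%:R => x n x0' xn n2.
  have p2 : (x + 1) * (x + 2) <= n * (n + 1) by apply: ler_pM; lra.
  have p3 : (x + 1) * (x + 2) * (x + 3) <= n * (n + 1) * (n + 2).
    by apply: ler_pM => //; [apply: mulr_ge0|..]; lra.
  have p4 : (x + 1) * (x + 2) * (n + 2) ^+ 2 <= n * (n + 1) * (n + 2) ^+ 2.
    by apply: ler_wpM2r => //; exact: sqr_ge0.
  (* This is 18 (n+2)^4 - 12 n (n+1) (n+2)^2 - 48 n (n+1) (n+2), the slack that justifies kappa = 18
     L D^2. *)
  have p5 : 0 <= (n + 2) * (6 * (n + 2) ^+ 2 * n + 120 * n + 144).
    have n0 : 0 <= n by lra.
    by have n20 := ltW n2; nonneg.
  lra.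
- by rewrite -mulrA; nonneg.
- by have := q_le 0 (leq0n N); rewrite -!mulrA; lra.
- by move=> k kN _; have := q_le k (ltnW kN); rewrite -!mulrA; lra.
Qed.

End zeroth_order.

(** * Oracle complexity *)

Section complexity.
Context {R : realType}.
Implicit Types (K eps c : R).

(** T is the ceiling of sqrt(K / eps). Since eps <= K this root is at least 1, so rounding up at
    most doubles it; whence the factors 8 and 4. *)
Lemma sliding_horizon K eps : 0 < K -> 0 < eps <= K ->
  exists T : nat, [/\ (1 <= T)%N, K <= eps * T%:R ^+ 2,
    T%:R ^+ 3 <= 8 * (K `^ (3 / 2)) * eps `^ (- (3 / 2)) &
    T%:R ^+ 2 <= 4 * K * eps^-1].
Proof.
move=> K0 /andP[eps0 epsK]; set s := Num.sqrt (K / eps).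
have Ke : 1 <= K / eps by rewrite ler_pdivlMr // mul1r.
have s1 : 1 <= s by rewrite -sqrtr1 ler_sqrt //; lra.
have s2 : s ^+ 2 = K / eps by rewrite sqr_sqrtr //; lra.
have s0 : 0 <= s by lra.
have s3 : s ^+ 3 = K `^ (3 / 2) * eps `^ (- (3 / 2)).
  rewrite -powR_mulrn // /s -powR12_sqrt; last lra.
  rewrite -powRrM (_ : 2^-1 * 3%:R = 3 / 2); last by field.
  rewrite powRM ?invr_ge0 ?ltW // -(powR_inv1 (ltW eps0)) -powRrM.
  by rewrite mulN1r.
set T := `|Num.ceil s|%N; exists T.
have sT : s <= T%:R by exact: nat_ceil_ge.
have T2 : T%:R <= 2 * s by have : T%:R < s + 1; [exact: nat_ceil_lt|lra].
split.
- by rewrite -(ler1n R); lra.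
- apply: (@le_trans _ _ (eps * s ^+ 2)).
    by rewrite s2 mulrCA mulfV ?mulr1 // lt0r_neq0.
  by rewrite ler_pM2l // lerXn2r ?nnegrE.
- apply: (@le_trans _ _ ((2 * s) ^+ 3)); first by rewrite lerXn2r ?nnegrE //; lra.
  by rewrite exprMn s3; lra.
- apply: (@le_trans _ _ ((2 * s) ^+ 2)); first by rewrite lerXn2r ?nnegrE //; lra.
  by rewrite exprMn s2; lra.
Qed.

Lemma rate_le_eps K eps a c (T : nat) : (1 <= T)%N -> 0 <= a -> 0 <= c -> 0 < K ->
  a + c = K -> K <= eps * T%:R ^+ 2 ->
  a / (T%:R + 2) ^+ 2 + c / ((T%:R + 1) * (T%:R + 2)) <= eps.
Proof.
move=> T1 a0 c0 K0 acK KT.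
have t1 : 1 <= T%:R :> R by rewrite ler1n.
move: t1 KT; move: T%:R => t t1 KT.
have t2 : 0 < t ^+ 2 by rewrite exprn_gt0 //; lra.
apply: (@le_trans _ _ (K / t ^+ 2)); last by rewrite ler_pdivrMr.
rewrite -acK [leRHS]mulrDl; apply: lerD; apply: ler_wpM2l => //.
  have t4 : 0 < (t + 2) ^+ 2 by rewrite exprn_gt0 //; lra.
  by rewrite lef_pV2 ?posrE //; apply: lerXn2r; rewrite ?nnegrE; lra.
have t3 : 0 < (t + 1) * (t + 2) by apply: mulr_gt0; lra.
by rewrite lef_pV2 ?posrE //; lra.
Qed.

Lemma sum_calls_le (b : nat -> nat) c (T : nat) :
  (forall t, (1 <= t <= T)%N -> (b t)%:R <= c * T%:R ^+ 2) ->
  (\sum_(1 <= t < T.+1) b t)%N%:R <= c * T%:R ^+ 3.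
Proof.
move=> hb; rewrite natr_sum.
apply: (@le_trans _ _ (\sum_(1 <= t < T.+1) c * T%:R ^+ 2)).
  by rewrite !big_nat; apply: ler_sum => t tT; apply: hb.
by rewrite sumr_const_nat subSS subn0 -[X in X <= _]mulr_natr -mulrA -exprSr.
Qed.

Let sq_le (t T : nat) : (1 <= t <= T)%N -> t%:R * (t%:R + 1) <= 2 * T%:R ^+ 2 :> R.
Proof.
case/andP; rewrite -(ler1n R) -(ler_nat R); move: t%:R T%:R => x y *; nra.
Qed.

Lemma fo_batch_le (rho : R) t T : 0 < rho -> (1 <= t <= T)%N ->
  (fo_batch rho t)%:R <= (6 * rho + 1) * T%:R ^+ 2.
Proof.
move=> rho0 tT; have := sq_le tT; have /andP[t1 tT'] := tT.
have T1 : 1 <= T%:R ^+ 2 :> R by rewrite expr_ge1 // ler1n (leq_trans t1).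
have x0 : 0 <= 3 * rho * t%:R * (t%:R + 1) by nonneg.
have := nat_ceil_lt x0; rewrite -/(fo_batch rho t) => h1 h2.
have := ler_wpM2l (ltW rho0) h2; lra.
Qed.

(** For d >= 1 one has d + 4 <= 5d, so a batch is at most 60 rho d T^2 + 1; two calls per finite
    difference double this. *)
Lemma zo_batch_le (rho : R) d t T : 0 < rho -> (0 < d)%N -> (1 <= t <= T)%N ->
  (2 * zo_batch rho d t)%N%:R <= (120 * rho + 2) * d%:R * T%:R ^+ 2.
Proof.
move=> rho0 d0 tT; have := sq_le tT; have /andP[t1 tT'] := tT.
have T1 : 1 <= T%:R ^+ 2 :> R by rewrite expr_ge1 // ler1n (leq_trans t1).
have d1 : 1 <= d%:R :> R by rewrite ler1n.
have x0 : 0 <= 6 * rho * (d%:R + 4) * t%:R * (t%:R + 1) by nonneg.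
have := nat_ceil_lt x0; rewrite -/(zo_batch rho d t) => h1 h2; rewrite natrM.
have c0 : 0 <= rho * (d%:R + 4) by nonneg.
have h3 := ler_wpM2l c0 h2.
have h4 : 1 <= d%:R * T%:R ^+ 2 :> R by rewrite -[leLHS]mulr1 ler_pM.
have h5 : rho * T%:R ^+ 2 * (d%:R + 4) <= rho * T%:R ^+ 2 * (5 * d%:R).
  by apply: ler_wpM2l; [nonneg|lra].
lra.
Qed.

End complexity.

Theorem theorem3 (R : realType) (L D rho : R)
    (hL : 0 < L) (hD : 0 < D) (hrho : 0 < rho) :
  ((forall (d : nat) (dX : measure_display) (Xi : measurableType dX)
      (mu : probability Xi R) (F : 'rV[R]_d -> Xi -> R)
      (Om : set 'rV[R]_d) (xs : 'rV[R]_d),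
      stochastic_problem L D mu F Om xs ->
      fo_variance L rho mu F Om xs ->
    forall (T : nat) (lmo : 'rV[R]_d -> 'rV[R]_d) (x0 : 'rV[R]_d)
      (dW : measure_display) (W : measurableType dW) (P : probability W R)
      (xi : nat -> nat -> {RV P >-> Xi}),
      is_lmo Om lmo -> Om x0 -> fo_samples mu (fo_batch rho) T xi ->
    forall t : nat, (1 <= t <= T)%N ->
    ('E_P[fun w => (objective mu F
                     (fo_x L D rho F lmo x0 (fun s i => xi s i w) t)
                   - objective mu F xs)%R]
     <= (6 * L * D ^+ 2 / (t%:R + 2) ^+ 2
         + (15 * L * D ^+ 2 + 3 * enorm (grad (objective mu F) xs) * D)
           / ((t%:R + 1) * (t%:R + 2)))%:E)%E)
   /\
   (forall G : R, exists C eps0 : R, 0 < C /\ 0 < eps0 /\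
    forall (d : nat) (dX : measure_display) (Xi : measurableType dX)
      (mu : probability Xi R) (F : 'rV[R]_d -> Xi -> R)
      (Om : set 'rV[R]_d) (xs : 'rV[R]_d),
      stochastic_problem L D mu F Om xs ->
      fo_variance L rho mu F Om xs ->
      enorm (grad (objective mu F) xs) = G ->
    forall eps : R, 0 < eps <= eps0 ->
    exists T : nat, (1 <= T)%N /\
    (fo_calls (fo_batch rho) T)%:R <= C * eps `^ (- (3 / 2)) /\
    forall (lmo : 'rV[R]_d -> 'rV[R]_d) (x0 : 'rV[R]_d)
      (dW : measure_display) (W : measurableType dW) (P : probability W R)
      (xi : nat -> nat -> {RV P >-> Xi}),
      is_lmo Om lmo -> Om x0 -> fo_samples mu (fo_batch rho) T xi ->
    eps_optimal P Om (objective mu F) xs eps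
      (fun w => fo_x L D rho F lmo x0 (fun s i => xi s i w) T) /\
    (forall w, (fo_lmo_calls L D rho F lmo x0 (fun s i => xi s i w) T
                <= (C * eps^-1)%:E)%E)))
  /\
  ((forall (d : nat) (dX : measure_display) (Xi : measurableType dX)
      (mu : probability Xi R) (F : 'rV[R]_d -> Xi -> R)
      (Om : set 'rV[R]_d) (xs : 'rV[R]_d),
      stochastic_problem L D mu F Om xs ->
      zo_smooth L mu F -> zo_second_moment L rho mu F Om xs ->
    forall (T : nat) (lmo : 'rV[R]_d -> 'rV[R]_d) (x0 : 'rV[R]_d)
      (dW : measure_display) (W : measurableType dW) (P : probability W R)
      (xi : nat -> nat -> {RV P >-> Xi})
      (u : nat -> nat -> {RV P >-> 'rV[R]_d}),
      is_lmo Om lmo -> Om x0 -> zo_samples mu (zo_batch rho d) T xi u ->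
    forall t : nat, (1 <= t <= T)%N ->
    ('E_P[fun w => (objective mu F
                     (zo_x L D rho F lmo x0 T (fun s i => xi s i w)
                           (fun s i => u s i w) t)
                   - objective mu F xs)%R]
     <= (8 * L * D ^+ 2 / (t%:R + 2) ^+ 2
         + 32 * L * D ^+ 2 / ((t%:R + 1) * (t%:R + 2)))%:E)%E)
   /\
   (forall G : R, exists C eps0 : R, 0 < C /\ 0 < eps0 /\
    forall (d : nat) (dX : measure_display) (Xi : measurableType dX)
      (mu : probability Xi R) (F : 'rV[R]_d -> Xi -> R)
      (Om : set 'rV[R]_d) (xs : 'rV[R]_d),
      (0 < d)%N ->
      stochastic_problem L D mu F Om xs ->
      zo_smooth L mu F -> zo_second_moment L rho mu F Om xs ->
      enorm (grad (objective mu F) xs) = G ->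
    forall eps : R, 0 < eps <= eps0 ->
    exists T : nat, (1 <= T)%N /\
    (zo_calls (zo_batch rho d) T)%:R <= C * d%:R * eps `^ (- (3 / 2)) /\
    forall (lmo : 'rV[R]_d -> 'rV[R]_d) (x0 : 'rV[R]_d)
      (dW : measure_display) (W : measurableType dW) (P : probability W R)
      (xi : nat -> nat -> {RV P >-> Xi})
      (u : nat -> nat -> {RV P >-> 'rV[R]_d}),
      is_lmo Om lmo -> Om x0 -> zo_samples mu (zo_batch rho d) T xi u ->
    eps_optimal P Om (objective mu F) xs eps
      (fun w => zo_x L D rho F lmo x0 T (fun s i => xi s i w)
                     (fun s i => u s i w) T) /\
    (forall w, (zo_lmo_calls L D rho F lmo x0 T (fun s i => xi s i w)
                             (fun s i => u s i w)
                <= (C * eps^-1)%:E)%E))).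
Proof.
have LD0 : 0 < L * D ^+ 2 by rewrite mulr_gt0 ?exprn_gt0.
split; split.
- move=> d dX Xi mu F Om xs sp var T lmo x0 dW W P xi lmoP Ox samples t tT.
  exact: (fo_rate hL hD hrho sp var lmoP Ox samples tT).
(* 21 = 6 + 15 collects the constants of the rate. [K] is fixed before the problem is given, for an
   arbitrary real [G]; the absolute value keeps it positive. *)
- move=> G; pose K := 21 * (L * D ^+ 2) + 3 * (`|G| * D).
  have GD : 0 <= `|G| * D by rewrite mulr_ge0 // ltW.
  have K0 : 0 < K by rewrite /K; lra.
  have K32 : 0 < K `^ (3 / 2) by rewrite powR_gt0.
  have C0 : 0 < (6 * rho + 1) * (8 * K `^ (3 / 2)) by rewrite mulr_gt0 //; lra.
  (* One constant serves both counts: the batches sum to at most (6 rho + 1) T^3, and the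
     minimization oracle is called at most 16 T^2 <= 64 K / eps times. *)
  exists ((6 * rho + 1) * (8 * K `^ (3 / 2)) + 64 * K), K; split; [lra|split => //].
  move=> d dX Xi mu F Om xs sp var EG eps epsK.
  have eps0 : 0 < eps by case/andP: epsK.
  have [T [T1 KT T3 T2]] := sliding_horizon K0 epsK.
  exists T; split => //; split.
    apply: le_trans (sum_calls_le (fun t => @fo_batch_le _ rho t T hrho)) _.
    have e0 := powR_ge0 eps (- (3 / 2)).
    have r0 : 0 <= 6 * rho + 1 by lra.
    have := ler_wpM2l r0 T3; have := mulr_ge0 (ltW K0) e0; lra.
  move=> lmo x0 dW W P xi lmoP Ox samples; split; first split.
  + move=> w; exact: (scgs_Om hL hD (convex_set_comb (sp_convex sp)) (problem_diam sp)
      lmoP Ox _ T).1.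
  + have TT : (1 <= T <= T)%N by rewrite T1 leqnn.
    apply: le_trans (fo_rate hL hD hrho sp var lmoP Ox samples TT) _.
    rewrite lee_fin EG; apply: (rate_le_eps T1 _ _ K0 _ KT).
    * by rewrite -mulrA; lra.
    * by rewrite -EG in GD *; rewrite -!mulrA; have := mulr_ge0 (enorm_ge0 (grad (objective mu F) xs)) (ltW hD); lra.
    * by rewrite /K -EG ger0_norm ?enorm_ge0 //; ring.
  + move=> w; apply: le_trans (scgs_lmo_calls_le hL hD
      (convex_set_comb (sp_convex sp)) (problem_diam sp) lmoP Ox _ T) _.
    have e0 : 0 < eps^-1 by rewrite invr_gt0.
    rewrite lee_fin !natrM; have := mulr_gt0 C0 e0; lra.
- move=> d dX Xi mu F Om xs sp smooth mom T lmo x0 dW W P xi u lmoP Ox samples t tT.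
  exact: (zo_rate hL hD hrho sp smooth mom lmoP Ox samples tT).
(* 40 = 8 + 32, the constants of the rate. *)
- move=> G; pose K := 40 * (L * D ^+ 2).
  have K0 : 0 < K by rewrite /K; lra.
  have K32 : 0 < K `^ (3 / 2) by rewrite powR_gt0.
  have C0 : 0 < (120 * rho + 2) * (8 * K `^ (3 / 2)) by rewrite mulr_gt0 //; lra.
  exists ((120 * rho + 2) * (8 * K `^ (3 / 2)) + 64 * K), K; split; [lra|split => //].
  move=> d dX Xi mu F Om xs d0 sp smooth mom _ eps epsK.
  have eps0 : 0 < eps by case/andP: epsK.
  have [T [T1 KT T3 T2]] := sliding_horizon K0 epsK.
  exists T; split => //; split.
    apply: le_trans (sum_calls_le (fun t => @zo_batch_le _ rho d t T hrho d0)) _.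
    have e0 := powR_ge0 eps (- (3 / 2)).
    have r0 : 0 <= (120 * rho + 2) * d%:R by rewrite mulr_ge0 //; lra.
    have := ler_wpM2l r0 T3.
    have := mulr_ge0 (ler0n R d) (mulr_ge0 (ltW K0) e0); lra.
  move=> lmo x0 dW W P xi u lmoP Ox samples; split; first split.
  + move=> w; exact: (scgs_Om hL hD (convex_set_comb (sp_convex sp)) (problem_diam sp)
      lmoP Ox _ T).1.
  + have TT : (1 <= T <= T)%N by rewrite T1 leqnn.
    apply: le_trans (zo_rate hL hD hrho sp smooth mom lmoP Ox samples TT) _.
    rewrite lee_fin; apply: (rate_le_eps T1 _ _ K0 _ KT); rewrite -?mulrA; [lra|lra|].
    by rewrite /K; lra.
  + move=> w; apply: le_trans (scgs_lmo_calls_le hL hD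
      (convex_set_comb (sp_convex sp)) (problem_diam sp) lmoP Ox _ T) _.
    have e0 : 0 < eps^-1 by rewrite invr_gt0.
    rewrite lee_fin !natrM; have := mulr_gt0 C0 e0; lra.
Qed.
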